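(* Let $\vec p=(p_1,\dots,p_n)$ with $1<p_i<\infty$ for all $i$, let $1<\theta\le\infty$ and $1<v<\infty$, and let $w\in\Omega_\theta$ or $w\in\Omega_{\vec p,\theta}$. Define weights on $(0,\infty)$ by $$\hat v_1(r)=r^{\sum_{i=1}^n\frac1{p_i}+1}w(r),\qquad \hat v_2(r)=r^{\sum_{i=1}^n\frac1{p_i}}w(r).$$ Assume that the operator $H^*$ is bounded from $L_{\theta,\hat v_1}(0,\infty)$ to $L_{\theta,\hat v_2}(0,\infty)$. Then there is a constant $C>0$ such that for every measurable $f$ and every sequence $\{f_j\}_{j=1}^\infty$ of measurable functions on $\mathbb R^n$, $$\|Mf\|_{LM_{\vec p\theta,w}}\le C\|f\|_{LM_{\vec p\theta,w}},$$ $$\left\|\left(\sum_{j=1}^\infty (Mf_j)^v\right)^{1/v}\right\|_{LM_{\vec p\theta,w}}\le C\left\|\left(\sum_{j=1}^\infty |f_j|^v\right)^{1/v}\right\|_{LM_{\vec p\theta,w}},$$ and in particular $$\left\|M\left[\sup_{j\in\mathbb N}|f_j|\right]\right\|_{LM_{\vec p\theta,w}}\le C\left\|\sup_{j\in\mathbb N}|f_j|\right\|_{LM_{\vec p\theta,w}}.$$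
   Context: Mixed Lebesgue norm: for $\vec p=(p_1,\dots,p_n)$, $0<p_i\le\infty$, and $f$ measurable on $\mathbb R^n$, $$\|f\|_{L_{\vec p}}=\left(\int_{\mathbb R}\cdots\left(\int_{\mathbb R}\left(\int_{\mathbb R}|f(x_1,\dots,x_n)|^{p_1}dx_1\right)^{p_2/p_1}dx_2\right)^{p_3/p_2}\cdots dx_n\right)^{1/p_n},$$ with the usual essential supremum modification when some $p_i=\infty$; $\|f\|_{L_{\vec p}(E)}=\|f\chi_E\|_{L_{\vec p}}$. Local mixed Morrey-type (quasi-)norm: $\|f\|_{LM_{\vec p\theta,w}}=\big\|\,w(r)\|f\|_{L_{\vec p}(Q(0,r))}\big\|_{L_\theta(0,\infty)}$, where the $L_\theta$ norm is taken in $r$ with respect to Lebesgue measure $dr$, and $Q(0,r)=B(0,r)=\{x\in\mathbb R^n:|x|<r\}$. $\Omega_\theta$ is the set of non-negative measurable functions $w$ on $(0,\infty)$, not equivalent to $0$, with $\|w\|_{L_\theta(t,\infty)}<\infty$ for some $t>0$. $\Omega_{\vec p,\theta}$ is the set of non-negative measurable $w$ on $(0,\infty)$, not equivalent to $0$, such that for some $t_1,t_2>0$, $\|w\|_{L_\theta(t_1,\infty)}<\infty$ and $\|w(r)r^{\sum_{i=1}^n 1/p_i}\|_{L_\theta(0,t_2)}<\infty$. $H^*g(r)=\int_r^\infty g(t)\,dt$. For a weight $u$ on $(0,\infty)$, $\|g\|_{L_{\theta,u}(0,\infty)}=\|ug\|_{L_\theta(0,\infty)}$; boundedness of $H^*$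 from $L_{\theta,\hat v_1}$ to $L_{\theta,\hat v_2}$ means that $\|\hat v_2H^*g\|_{L_\theta(0,\infty)}\le C'\|\hat v_1g\|_{L_\theta(0,\infty)}$ for all non-negative measurable $g$, with $C'$ independent of $g$. $M$ is the Hardy–Littlewood maximal operator, $Mf(x)=\sup_{B\ni x}\frac1{|B|}\int_B|f(y)|dy$, the supremum being over open balls $B$ containing $x$. *)

(* Defs.v *)
From HB Require Import structures.
From mathcomp Require Import all_boot all_order all_algebra.
From mathcomp Require Import all_classical all_reals all_analysis.
From mathcomp Require Import measurable_realfun ess_sup_inf.

Set Implicit Arguments.
Unset Strict Implicit.
Unset Printing Implicit Defensive.

Import Order.TTheory GRing.Theory Num.Theory.
Import numFieldNormedType.Exports.

Local Open Scope classical_set_scope.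
Local Open Scope ring_scope.
Local Open Scope ereal_scope.

(* R^n; its canonical sigma-algebra is the Borel (product) one. *)
Notation Rn R n := (n.-tuple (measurableTypeR R)).

Section sigma_finite_pack.
Context d (T : measurableType d) (R : realType).
Variables (m : {measure set T -> \bar R}) (sf : sigma_finite setT m).

Definition sf_measure of sigma_finite setT m : set T -> \bar R := m.

HB.instance Definition _ := Measure.on (sf_measure sf).
HB.instance Definition _ :=
  Measure_isSigmaFinite.Build _ _ _ (sf_measure sf) sf.

End sigma_finite_pack.

Section lebesgue_measure_Rn.
Context {R : realType}.

Definition tcons n (x : measurableTypeR R * Rn R n) : Rn R n.+1 :=
  [tuple of x.1 :: x.2].

Fixpoint lebRn n : set (Rn R n) -> \bar R :=
  match n with
  | 0 => \d_ [tuple]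
  | m.+1 => pushforward (lebesgue_measure \x @lebRn m) (@tcons m)
  end.

Lemma measurable_tcons n : measurable_fun setT (@tcons n).
Proof. exact: measurable_cons. Qed.

Let tsplit n (t : Rn R n.+1) : measurableTypeR R * Rn R n :=
  (thead t, [tuple of behead t]).

Let measurable_tsplit n : measurable_fun setT (@tsplit n).
Proof.
by apply/measurable_fun_pairP; split;
  [exact: measurable_tnth|exact: measurable_behead].
Qed.

Let tconsK n : cancel (@tcons n) (@tsplit n).
Proof.
by move=> [x t]; congr pair => //; apply/val_inj.
Qed.

Let tsplitK n : cancel (@tsplit n) (@tcons n).
Proof. by move=> t; rewrite [RHS]tuple_eta; apply/val_inj. Qed.

Lemma lebRn_sigma_finite_measure n :
  exists m : {sigma_finite_measure set (Rn R n) -> \bar R},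
    (m : set _ -> \bar R) = @lebRn n.
Proof.
elim: n => [|n [m mE]]; first by exists (dirac [tuple]).
have mt := @measurable_tcons n.
pose Q := pushforward (lebesgue_measure \x m) (@tcons n).
pose Qm : {measure set (Rn R n.+1) -> \bar R} :=
  @measure_function_pushforward__canonical__measure_function_Measure
    _ _ _ _ _ (lebesgue_measure \x m) _ mt.
have Qsf : sigma_finite setT Q.
  have /sigma_finiteP[F [FT ndF Foo]] :=
    sigma_finiteT (@lebesgue_measure R).
  have /sigma_finiteP[G [GT ndG Goo]] := sigma_finiteT m.
  exists (fun k => @tsplit n @^-1` (F k `*` G k)).
    rewrite -preimage_bigcup (_ : \bigcup_k _ = setT) ?preimage_setT//.
    apply/seteqP; split=> // -[x y] _.
    have [i _ Fx] : (\bigcup_i F i) x by rewrite -FT.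
    have [j _ Gy] : (\bigcup_i G i) y by rewrite -GT.
    exists (maxn i j) => //; split.
    - by move: x Fx; exact/subsetPset/ndF/leq_maxl.
    - by move: y Gy; exact/subsetPset/ndG/leq_maxr.
  move=> k; have [mF ltF] := Foo k; have [mG ltG] := Goo k; split.
    rewrite -[X in measurable X]setTI.
    by apply: measurable_tsplit => //; exact: measurableX.
  rewrite /Q /pushforward -comp_preimage.
  rewrite (_ : @tsplit n \o @tcons n = id); last exact/funext/tconsK.
  rewrite preimage_id product_measure1E//.
  by rewrite lte_mul_pinfty// ge0_fin_numE.
exists (@sf_measure _ _ _ Qm Qsf : {sigma_finite_measure set _ -> \bar R}).
by rewrite /= -mE.
Qed.

Let lebRn0 n : @lebRn n set0 = 0.
Proof. by have [m <-] := lebRn_sigma_finite_measure n; exact: measure0. Qed.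

Let lebRn_ge0 n A : 0 <= @lebRn n A.
Proof. by have [m <-] := lebRn_sigma_finite_measure n; exact: measure_ge0. Qed.

Let lebRn_semi_sigma_additive n : semi_sigma_additive (@lebRn n).
Proof.
have [m <-] := lebRn_sigma_finite_measure n.
exact: measure_semi_sigma_additive.
Qed.

HB.instance Definition _ n := isMeasure.Build _ _ _ (@lebRn n)
  (@lebRn0 n) (@lebRn_ge0 n) (@lebRn_semi_sigma_additive n).

Let lebRn_sigma_finite n : sigma_finite setT (@lebRn n).
Proof.
by have [m <-] := lebRn_sigma_finite_measure n; exact: sigma_finiteT.
Qed.

HB.instance Definition _ n := Measure_isSigmaFinite.Build _ _ _ (@lebRn n)
  (@lebRn_sigma_finite n).

End lebesgue_measure_Rn.

(* Measurability with respect to the completion of the Borel sigma-algebra by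
   the mu-negligible sets, i.e. Lebesgue measurability when mu is
   lebesgue_measure or lebRn. The library integral of a non-negative function
   is the supremum of the integrals of the Borel simple functions below it; on
   Lebesgue-measurable functions it agrees with the Lebesgue integral. *)
Definition lmeasurable_fun d (T : measurableType d) (R : realType)
    (mu : set T -> \bar R) d' (U : measurableType d') (D : set T) (f : T -> U) :=
  measurable_fun (D : set (g_sigma_algebraType (completed_algebra_gen mu))) f.

Section mixed_morrey.
Context {R : realType}.

Definition Lnorm_on (theta : \bar R) (E : set R) (g : R -> \bar R) : \bar R :=
  'N[lebesgue_measure]_theta [g \_ E].

(* The innermost norm is the one in the first variable. *)
Fixpoint mixed_norm n : n.-tuple (\bar R) -> (Rn R n -> \bar R) -> \bar R :=
  match n with
  | 0 => fun _ f => `|f [tuple]|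
  | m.+1 => fun p f =>
      mixed_norm [tuple of behead p]
        (fun y : Rn R m =>
           'N[lebesgue_measure]_(thead p) [(fun x => f (tcons (x, y)))])
  end.

Definition eball n (c : Rn R n) (r : R) : set (Rn R n) :=
  [set x | (Num.sqrt (\sum_(i < n) (tnth x i - tnth c i) ^+ 2) < r)%R].

Definition origin n : Rn R n := [tuple 0%R | _ < n].

Definition local_morrey_norm n (p : n.-tuple (\bar R)) (theta : \bar R)
    (w : R -> R) (f : Rn R n -> \bar R) : \bar R :=
  Lnorm_on theta `]0%R, +oo[
    (fun r => (w r)%:E * mixed_norm p (f \_ (eball (origin n) r))).

Definition HL_max n (f : Rn R n -> \bar R) (x : Rn R n) : \bar R :=
  ereal_sup [set (@lebRn R n (eball cr.1 cr.2))^-1 *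
                 \int[@lebRn R n]_(y in eball cr.1 cr.2) `|f y|
            | cr in [set cr : Rn R n * R | eball cr.1 cr.2 x]].

(* sum_i 1 / p_i, with the convention 1 / +oo = 0 *)
Definition sum_inv n (p : n.-tuple (\bar R)) : R :=
  (\sum_(i < n) fine (tnth p i)^-1%E)%R.

Definition weight (w : R -> R) :=
  [/\ lmeasurable_fun lebesgue_measure `]0%R, +oo[ w,
      (forall r, 0 < r -> 0 <= w r)%R &
      ~ (\forall r \ae lebesgue_measure, (0 < r)%R -> w r = 0%R)].

Definition Omega (theta : \bar R) (w : R -> R) :=
  weight w /\
  exists2 t : R, (0 < t)%R & Lnorm_on theta `]t, +oo[ (EFin \o w) < +oo.

Definition Omega_mixed n (p : n.-tuple (\bar R)) (theta : \bar R)
    (w : R -> R) :=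
  weight w /\
  exists t1 t2 : R, [/\ (0 < t1)%R, (0 < t2)%R,
    Lnorm_on theta `]t1, +oo[ (EFin \o w) < +oo &
    Lnorm_on theta `]0%R, t2[ (fun r => (w r * r `^ sum_inv p)%:E) < +oo].

Definition Hstar (g : R -> \bar R) (r : R) : \bar R :=
  \int[lebesgue_measure]_(t in `]r, +oo[) g t.

(* g may take the value +oo, with the convention 0 * +oo = 0 *)
Definition Hstar_bounded (theta : \bar R) (u1 u2 : R -> R) :=
  exists2 C' : R, (0 < C')%R & forall g : R -> \bar R,
    lmeasurable_fun lebesgue_measure `]0%R, +oo[ g ->
    (forall r, (0 < r)%R -> 0 <= g r) ->
    Lnorm_on theta `]0%R, +oo[ (fun r => (u2 r)%:E * Hstar g r) <=
    C'%:E * Lnorm_on theta `]0%R, +oo[ (fun r => (u1 r)%:E * g r).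

Definition lv_norm n (v : R) (f : nat -> Rn R n -> \bar R) (x : Rn R n)
  : \bar R := (\sum_(0 <= j <oo) `|f j x| `^ v) `^ v^-1.

Definition sup_abs n (f : nat -> Rn R n -> \bar R) (x : Rn R n) : \bar R :=
  ereal_sup (range (fun j => `|f j x|)).

End mixed_morrey.

(* Main.v *)
Require Import Defs.
From HB Require Import structures.
From mathcomp Require Import all_boot all_order all_algebra.
From mathcomp Require Import all_classical all_reals all_analysis.
From mathcomp Require Import measurable_realfun ess_sup_inf.
From mathcomp Require Import zify ring lra.
Import Order.TTheory GRing.Theory Num.Theory.
Import numFieldNormedType.Exports.
Local Open Scope classical_set_scope.
Local Open Scope ring_scope.
Local Open Scope ereal_scope.

(** The vector-valued inequality carries the theorem: the scalar one is the case
    of the sequence [(f, 0, 0, ...)], and the one for the supremum is the scalar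
    one applied to [sup_j |f_j|], which is again measurable.

    Local part. Fix [r > 0], let [S = sum_i 1 / p_i], and let [F] be the [l^v]
    norm of the sequence. For [x] in the ball [B_r] about the origin, a ball
    containing [x] either has radius at most [r], and then only sees [f_j] on
    [B_(4 n r)], or is larger, and then its average is at most
    [C \int max(r, |y|)^(-n) f_j(y) dy], which does not depend on [x]
    ([HL_max_le_local]). The first part is bounded by the maximal inequality for
    mixed norms; for the second, Minkowski's inequality in [j] replaces [f_j]
    by [F], the integral is cut into dyadic annuli, and Hoelder's inequality
    bounds the integral of [F] over [B_t] by
    [C t^(n - S) ||F||_(L_p(B_t))]. As [||F||_(L_p(B_t))] increases with
    [t], the dyadic sum is an integral, and
      [||M f||_(L_p(B_r)) <= C r^S \int_r^oo t^(- S - 1) ||F||_(L_p(B_t)) dt]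
    ([local_maximal_estimate]). The right-hand side is [C r^S (H^* g)(r)], so
    that after multiplication by [w] the assumed boundedness of [H^*] is exactly
    what is needed ([vector_morrey_bound]).

    Maximal inequality in mixed norm ([maximal_inequality]). It is transferred
    from a finite grid: the averages of [f_j] over balls are limits of averages
    over rectangles of small cubes, the mixed norm of a step function is a
    discrete mixed norm ([mixed_norm_step]), averaging over the cubes does not
    increase the norm ([dmix_cube_average]), and Fatou's lemma removes the grid.
    On the grid an average over a rectangle is bounded by applying in each
    variable the dyadic maximal operators of two families of intervals, one
    being a translate of the other by a third ([sum_rectangle_le]). The
    remaining point is that the maximal operator of a chain of partitions is
    bounded on [L^q(E)] for all spaces [E] that are iterated from finite
    [l^p] spaces. Call this [maximal_bound]. It passes from [E] to [l^q(E)]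
    with the same exponent ([maximal_bound_lpnorm]), and the exponent may then be
    changed for a fixed [E]: it is raised by Garsia's argument for increasing
    processes ([maximal_bound_up]) and lowered by a martingale transform
    ([maximal_bound_down]). Alternating the two steps, starting from Doob's
    inequality, reaches every finite list of exponents ([itmax_bound]).

    Measurability. Maximal functions and mixed norms enter inequalities without
    being shown measurable, since the integral of a non-negative function is
    a supremum over the simple functions below it and is therefore monotone. A
    Lebesgue measurable [f] is replaced by the Borel function equal to [|f|]
    off a null set and to [0] on it, which does not decrease the maximal
    function and does not increase the norm of [f]. *)

(** * Finite sums of powers *)

Section power_sums.
Set Implicit Arguments.
Unset Strict Implicit.
Local Open Scope ring_scope.
Context {R : realType}.
Implicit Types (q s : R).

Lemma conj_exponent q : 1 < q -> q^-1 + (q / (q - 1))^-1 = 1.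
Proof.
move=> q1; rewrite invf_div.
have q0 : q != 0 by rewrite gt_eqF// (lt_trans ltr01).
by field.
Qed.

Lemma conj_gt0 q : 1 < q -> 0 < q / (q - 1).
Proof. by move=> q1; rewrite divr_gt0 ?subr_gt0// (lt_trans ltr01). Qed.

Lemma powR_conj q (b : R) : 1 < q -> (b `^ (q - 1)) `^ (q / (q - 1)) = b `^ q.
Proof.
move=> q1; rewrite -powRrM mulrCA divff ?mulr1// gt_eqF// subr_gt0//.
Qed.

Lemma powRV_K q (a : R) : q != 0 -> 0 <= a -> (a `^ q^-1) `^ q = a.
Proof. by move=> q0 a0; rewrite -powRrM mulVf// powRr1. Qed.

Lemma powR_KV q (a : R) : q != 0 -> 0 <= a -> (a `^ q) `^ q^-1 = a.
Proof. by move=> q0 a0; rewrite -powRrM mulfV// powRr1. Qed.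

Lemma divr_powRV q (a b : R) : 0 < q -> 0 <= a -> 0 <= b ->
  (a / b `^ q^-1) `^ q = a `^ q / b.
Proof.
move=> q0 a0 b0; rewrite powRM ?invr_ge0 ?powR_ge0//; congr (_ * _).
rewrite -powR_inv1 ?powR_ge0// powRAC powRV_K ?gt_eqF// powR_inv1//.
Qed.

Lemma le_powR q (a b : R) : 0 <= q -> 0 <= a -> a <= b -> a `^ q <= b `^ q.
Proof.
move=> q0 a0 ab; apply: ge0_ler_powR => //; rewrite nnegrE//.
exact: le_trans ab.
Qed.

Lemma powR_conj_split q (a : R) : 1 < q -> 0 <= a ->
  a = a `^ q^-1 * a `^ (q / (q - 1))^-1.
Proof.
move=> q1 a0; rewrite -powRD; first by rewrite conj_exponent// powRr1.
by rewrite conj_exponent// oner_eq0.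
Qed.

Lemma young_powR q (a b : R) : 1 < q -> 0 <= a -> 0 <= b ->
  q * (a * b `^ (q - 1)) <= a `^ q + (q - 1) * b `^ q.
Proof.
move=> q1 a0 b0; have q0 : 0 < q by rewrite (lt_trans ltr01).
have := conjugate_powR a0 (powR_ge0 b (q - 1)) q0 (conj_gt0 q1)
  (conj_exponent q1).
rewrite powR_conj// => H.
rewrite -(ler_pM2l q0) in H; apply: (le_trans H).
rewrite mulrDr mulrCA divff ?mulr1 ?gt_eqF// lerD2l invf_div.
by rewrite mulrCA [q * _]mulrC divfK ?gt_eqF// mulrC.
Qed.

(** The tangent to the convex function [t `^ q] at [b] lies below it. *)
Lemma powRB_le q (a b : R) : 1 < q -> 0 <= a -> 0 <= b ->
  b `^ q - a `^ q <= q * ((b - a) * b `^ (q - 1)).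
Proof.
move=> q1 a0 b0; have := young_powR q1 a0 b0.
have <- := @mulr_powRB1 _ b q b0 (lt_trans ltr01 q1).
nra.
Qed.

(** Young's inequality with weights [A] and [B]; when these are the two sums of
    powers in Hoelder's inequality, adding up gives the latter. *)
Lemma young_scaled (a b A B p q : R) : 0 <= a -> 0 <= b -> 0 < A -> 0 < B ->
  0 < p -> 0 < q -> p^-1 + q^-1 = 1 ->
  a * b <= A `^ p^-1 * B `^ q^-1 * (a `^ p / A / p + b `^ q / B / q).
Proof.
move=> a0 b0 A0 B0 p0 q0 pq.
have Ap := powR_gt0 p^-1 A0; have Bq := powR_gt0 q^-1 B0.
have := @conjugate_powR _ (a / A `^ p^-1) (b / B `^ q^-1) p q
  (divr_ge0 a0 (ltW Ap)) (divr_ge0 b0 (ltW Bq)) p0 q0 pq.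
rewrite (divr_powRV p0 a0 (ltW A0)) (divr_powRV q0 b0 (ltW B0)).
move: (A `^ p^-1) (B `^ q^-1) Ap Bq => x y x0 y0 H.
rewrite -ler_pdivrMl ?mulr_gt0//; apply: le_trans H.
by rewrite invfM mulrC mulrACA.
Qed.

Lemma holder_sum (I : finType) (a b : I -> R) (p q : R) :
  (forall i, 0 <= a i) -> (forall i, 0 <= b i) ->
  0 < p -> 0 < q -> p^-1 + q^-1 = 1 ->
  \sum_i a i * b i <= (\sum_i a i `^ p) `^ p^-1 * (\sum_i b i `^ q) `^ q^-1.
Proof.
move=> a0 b0 p0 q0 pq.
set A := \sum_i a i `^ p; set B := \sum_i b i `^ q.
have A0 : 0 <= A by apply: sumr_ge0 => i _; exact: powR_ge0.
have B0 : 0 <= B by apply: sumr_ge0 => i _; exact: powR_ge0.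
have [A_eq0|An0] := eqVneq A 0.
  rewrite big1 ?mulr_ge0 ?powR_ge0// => i _.
  have /eqP := A_eq0; rewrite psumr_eq0; last by move=> *; exact: powR_ge0.
  by move=> /allP/(_ i (mem_index_enum _))/= /eqP/powR_eq0_eq0 ->; rewrite mul0r.
have [B_eq0|Bn0] := eqVneq B 0.
  rewrite big1 ?mulr_ge0 ?powR_ge0// => i _.
  have /eqP := B_eq0; rewrite psumr_eq0; last by move=> *; exact: powR_ge0.
  by move=> /allP/(_ i (mem_index_enum _))/= /eqP/powR_eq0_eq0 ->; rewrite mulr0.
have Ap : 0 < A by rewrite lt_neqAle eq_sym An0.
have Bp : 0 < B by rewrite lt_neqAle eq_sym Bn0.
have H i := young_scaled (a0 i) (b0 i) Ap Bp p0 q0 pq.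
apply: (le_trans (ler_sum _ (fun i _ => H i))).
rewrite -mulr_sumr big_split/= -!mulr_suml -/A -/B !divff//.
by rewrite !mul1r pq mulr1.
Qed.

Lemma holder_sum_conj (I : finType) (c b : I -> R) (q : R) : 1 < q ->
  (forall i, 0 <= c i) -> (forall i, 0 <= b i) ->
  \sum_i c i * b i `^ (q - 1) <=
  (\sum_i c i `^ q) `^ q^-1 * (\sum_i b i `^ q) `^ (q / (q - 1))^-1.
Proof.
move=> q1 c0 b0.
have q0 : 0 < q by rewrite (lt_trans ltr01).
have := holder_sum c0 (fun i => powR_ge0 (b i) (q - 1)) q0
    (conj_gt0 q1) (conj_exponent q1).
have -> : \sum_i (b i `^ (q - 1)) `^ (q / (q - 1)) = \sum_i b i `^ q.
  by apply: eq_bigr => i _; exact: powR_conj.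
exact.
Qed.

Lemma minkowski_sum (I : finType) (a b : I -> R) (q : R) : 1 < q ->
  (forall i, 0 <= a i) -> (forall i, 0 <= b i) ->
  (\sum_i (a i + b i) `^ q) `^ q^-1 <=
  (\sum_i a i `^ q) `^ q^-1 + (\sum_i b i `^ q) `^ q^-1.
Proof.
move=> q1 a0 b0; have q0 : 0 < q by rewrite (lt_trans ltr01).
set S := \sum_i (a i + b i) `^ q.
have S0 : 0 <= S by apply: sumr_ge0 => i _; exact: powR_ge0.
have [S_eq0|Sn0] := eqVneq S 0.
  by rewrite S_eq0 powR0 ?invr_neq0 ?gt_eqF// addr_ge0// powR_ge0.
have Sp : 0 < S by rewrite lt_neqAle eq_sym Sn0.
have ab0 i : 0 <= a i + b i by rewrite addr_ge0.
have H (c : I -> R) : (forall i, 0 <= c i) ->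
    \sum_i c i * (a i + b i) `^ (q - 1) <=
    (\sum_i c i `^ q) `^ q^-1 * S `^ (q / (q - 1))^-1.
  by move=> c0; exact: holder_sum_conj.
have : S <= ((\sum_i a i `^ q) `^ q^-1 + (\sum_i b i `^ q) `^ q^-1) *
            S `^ (q / (q - 1))^-1.
  rewrite mulrDl; apply: le_trans (lerD (H a a0) (H b b0)).
  rewrite -big_split/= /S; apply: ler_sum => i _.
  by rewrite -mulrDl mulr_powRB1.
rewrite {1}(powR_conj_split q1 S0) ler_pM2r; first exact.
exact: powR_gt0.
Qed.

(** A self-improving estimate: [\sum F^q <= c \sum phi F^(q-1)] and Hoelder's
    inequality let one factor of [F] be traded for [phi]. *)
Lemma absorb_sum (I : finType) (F phi : I -> R) (q c : R) : 1 < q -> 0 <= c ->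
  (forall i, 0 <= F i) -> (forall i, 0 <= phi i) ->
  \sum_i F i `^ q <= c * \sum_i phi i * F i `^ (q - 1) ->
  \sum_i F i `^ q <= c `^ q * \sum_i phi i `^ q.
Proof.
move=> q1 c0 F0 phi0; have q0 : 0 < q by rewrite (lt_trans ltr01).
set S := \sum_i F i `^ q; set A := \sum_i phi i `^ q => H.
have S0 : 0 <= S by apply: sumr_ge0 => i _; exact: powR_ge0.
have A0 : 0 <= A by apply: sumr_ge0 => i _; exact: powR_ge0.
have [->|Sn0] := eqVneq S 0; first by rewrite mulr_ge0// powR_ge0.
have Sp : 0 < S by rewrite lt_neqAle eq_sym Sn0.
have {}H : S <= c * A `^ q^-1 * S `^ (q / (q - 1))^-1.
  apply: (le_trans H); rewrite -mulrA ler_wpM2l//.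
  exact: holder_sum_conj.
clearbody S A; move: H.
rewrite {1}(powR_conj_split q1 S0) ler_pM2r ?powR_gt0// => H.
have := le_powR (ltW q0) (powR_ge0 _ _) H.
have qn0 : q != 0 by rewrite gt_eqF.
by rewrite powRM ?powR_ge0// (powRV_K qn0 S0) (powRV_K qn0 A0).
Qed.

End power_sums.

(** * Averages along a chain of partitions *)

Section averages.
Set Implicit Arguments.
Unset Strict Implicit.
Local Open Scope ring_scope.
Context {R : realType}.

(** What is used of a Banach function norm on [W -> R]; the iterated norms
    below produce such functionals with ever larger index types [W]. *)
Record lattice_norm (W : Type) (N : (W -> R) -> R) : Prop := LatticeNorm {
  lattice_norm_le : forall a b : W -> R,
    (forall w, `|a w| <= `|b w|) -> N a <= N b;
  lattice_normD : forall a b : W -> R, N (fun w => a w + b w) <= N a + N b;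
  lattice_normZ : forall (c : R) (a : W -> R), 0 <= c ->
    N (fun w => c * a w) = c * N a }.

Section lattice_norm_theory.
Context {W : Type} (N : (W -> R) -> R) (hN : lattice_norm N).

Lemma lattice_norm0 : N (fun=> 0) = 0.
Proof.
rewrite -[RHS](mul0r (N (fun=> 0))) -(lattice_normZ hN)//.
by congr N; apply/funext => w; rewrite mulr0.
Qed.

Lemma lattice_norm_ge0 a : 0 <= N a.
Proof.
rewrite -lattice_norm0; apply: lattice_norm_le => // w.
by rewrite normr0.
Qed.

Lemma lattice_norm_sum (I : Type) (r : seq I) (P : pred I) (a : I -> W -> R) :
  N (fun w => \sum_(i <- r | P i) a i w) <= \sum_(i <- r | P i) N (a i).
Proof.
elim: r => [|i r IH].
  rewrite big_nil (_ : (fun _ => _) = fun=> 0) ?lattice_norm0//.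
  by apply/funext => w; rewrite big_nil.
rewrite big_cons; case: ifPn => Pi; last first.
  rewrite (_ : (fun _ => _) = fun w => \sum_(j <- r | P j) a j w)//.
  by apply/funext => w; rewrite big_cons (negbTE Pi).
rewrite (_ : (fun _ => _) = fun w => a i w + \sum_(j <- r | P j) a j w).
  by apply: (le_trans (lattice_normD hN _ _)); rewrite lerD2l.
by apply/funext => w; rewrite big_cons Pi.
Qed.

Lemma lattice_norm_abs a : N (fun w => `|a w|) = N a.
Proof.
by apply/eqP; rewrite eq_le; apply/andP; split;
  apply: (lattice_norm_le hN) => w; rewrite normr_id.
Qed.

End lattice_norm_theory.

Section partitions.
Context {T : finType} (pi : nat -> T -> nat).

(** The [k]-th partition of [T] is given by labels, two points being in the
    same block when [pi k] takes the same value at both. *)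
Definition block k x : {set T} := [set y | pi k y == pi k x].

Definition avg k (f : T -> R) x : R :=
  (#|block k x|%:R)^-1 * \sum_(y in block k x) f y.

Lemma avgE k f x : avg k f x = (#|block k x|%:R)^-1 * \sum_(y in block k x) f y.
Proof. by []. Qed.

Definition level_fun k (h : T -> R) := forall x y, pi k x = pi k y -> h x = h y.

Lemma block_refl k x : x \in block k x.
Proof. by rewrite inE. Qed.

Lemma blockP k x y : reflect (pi k y = pi k x) (y \in block k x).
Proof. by rewrite inE; exact: eqP. Qed.

Lemma block_eq k x y : pi k x = pi k y -> block k x = block k y.
Proof. by move=> E; apply/setP => z; rewrite !inE E. Qed.

Lemma card_block_gt0 k x : 0 < #|block k x|%:R :> R.
Proof. by rewrite ltr0n card_gt0; apply/set0Pn; exists x; exact: block_refl. Qed.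

Lemma avg_level k f : level_fun k (avg k f).
Proof. by move=> x y E; rewrite /avg (block_eq E). Qed.

Lemma eq_avg_in k f g x : (forall y, pi k y = pi k x -> f y = g y) ->
  avg k f x = avg k g x.
Proof.
by move=> fg; rewrite /avg; congr (_ * _); apply: eq_bigr => y /blockP/fg.
Qed.

Lemma avg_cst k (c : R) x : avg k (fun=> c) x = c.
Proof.
rewrite /avg sumr_const -[c *+ _]mulr_natl mulrA mulVf ?mul1r// gt_eqF//.
exact: card_block_gt0.
Qed.

Lemma avg_level_id k h x : level_fun k h -> avg k h x = h x.
Proof.
by move=> lh; rewrite -[RHS](avg_cst k _ x); apply: eq_avg_in => y; exact: lh.
Qed.

Lemma avgM k h f x : level_fun k h -> avg k (fun y => h y * f y) x = h x * avg k f x.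
Proof.
move=> lh; rewrite /avg mulrCA [in RHS]mulr_sumr; congr (_ * _).
by apply: eq_bigr => y /blockP/lh ->.
Qed.

Lemma avgD k f g x : avg k (fun y => f y + g y) x = avg k f x + avg k g x.
Proof. by rewrite /avg big_split/= mulrDr. Qed.

Lemma avgZ k c f x : avg k (fun y => c * f y) x = c * avg k f x.
Proof. by rewrite avgM. Qed.

Lemma avgB k f g x : avg k (fun y => f y - g y) x = avg k f x - avg k g x.
Proof.
rewrite -[in RHS]mulN1r -avgZ -avgD.
by apply: eq_avg_in => y _; rewrite mulN1r.
Qed.

Lemma avg_le k f g x : (forall y, pi k y = pi k x -> f y <= g y) ->
  avg k f x <= avg k g x.
Proof.
move=> fg; rewrite /avg ler_pM2l ?invr_gt0 ?card_block_gt0//.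
by apply: ler_sum => y /blockP/fg.
Qed.

Lemma avg_ge0 k f x : (forall y, 0 <= f y) -> 0 <= avg k f x.
Proof. by move=> f0; rewrite -(avg_cst k 0 x); apply: avg_le. Qed.

Lemma avg_norm k f x : `|avg k f x| <= avg k (fun y => `|f y|) x.
Proof.
rewrite /avg normrM ger0_norm ?invr_ge0 ?ler0n// ler_wpM2l ?invr_ge0 ?ler0n//.
exact: ler_norm_sum.
Qed.

(** Averaging is self-adjoint and fixes the functions of its level. *)
Lemma sum_avg k h f : level_fun k h ->
  \sum_x h x * avg k f x = \sum_x h x * f x.
Proof.
move=> lh; transitivity
    (\sum_x \sum_(y in block k x) h x * ((#|block k x|%:R)^-1 * f y)).
  by apply: eq_bigr => x _; rewrite /avg !mulr_sumr.
rewrite (exchange_big_dep xpredT)//=; apply: eq_bigr => y _.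
transitivity (\sum_(x in block k y) h y * ((#|block k y|%:R)^-1 * f y)).
  apply: eq_big => [x|x /blockP xy]; first by rewrite !inE eq_sym.
  by rewrite (lh x y)// (block_eq (x := x) (y := y)).
rewrite sumr_const -[LHS]mulr_natl mulrCA; congr (_ * _).
by rewrite mulrA mulfV ?mul1r// gt_eqF// card_block_gt0.
Qed.

(** Jensen's inequality, by averaging the tangent line at [avg k f x]. *)
Lemma avg_powR k f x (s : R) : 1 < s -> (forall y, 0 <= f y) ->
  avg k f x `^ s <= avg k (fun y => f y `^ s) x.
Proof.
move=> s1 f0; have s0 : 0 < s by exact: lt_trans ltr01 s1.
pose c := avg k f x; have c0 : 0 <= c by exact: avg_ge0.
have c1 : c * c `^ (s - 1) = c `^ s by exact: mulr_powRB1.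
have H : avg k (fun y => s * (c `^ (s - 1) * f y)) x <=
         avg k (fun y => f y `^ s + (s - 1) * c `^ s) x.
  apply: avg_le => y _; rewrite [c `^ _ * _]mulrC.
  exact: young_powR.
rewrite avgZ avgZ avgD avg_cst -/c mulrC [_ * c]mulrC c1 in H.
rewrite -/c; move: H; set u := c `^ s; move: (avg _ _ _) => v; nra.
Qed.

Lemma lattice_norm_avg (W : Type) (N : (W -> R) -> R) k (f : T -> W -> R) x :
  lattice_norm N ->
  N (fun w => avg k (fun y => f y w) x) <= avg k (fun y => N (f y)) x.
Proof.
move=> hN; rewrite /avg (lattice_normZ hN) ?invr_ge0 ?ler0n//.
by rewrite ler_wpM2l ?invr_ge0 ?ler0n//; exact: lattice_norm_sum.
Qed.

Fixpoint rmax (a : nat -> R) k : R :=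
  if k is j.+1 then Num.max (rmax a j) (a j.+1) else a 0%N.

Lemma rmax_ub a i k : (i <= k)%N -> a i <= rmax a k.
Proof.
elim: k => [|k IH]; first by rewrite leqn0 => /eqP ->.
by rewrite leq_eqVlt => /predU1P[->|/IH H]/=; rewrite le_max ?lexx ?orbT ?H.
Qed.

Lemma rmax_le a k c : (forall i, (i <= k)%N -> a i <= c) -> rmax a k <= c.
Proof.
elim: k => [|k IH] H /=; first exact: H.
by rewrite ge_max H// IH// => i /leqW; exact: H.
Qed.

Lemma le_rmax a k l : (k <= l)%N -> rmax a k <= rmax a l.
Proof. by move=> kl; apply: rmax_le => i ik; apply: rmax_ub; exact: leq_trans kl. Qed.

Lemma eq_rmax a b k : (forall i, (i <= k)%N -> a i = b i) -> rmax a k = rmax b k.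
Proof.
elim: k => [|k IH] H /=; first exact: H.
by rewrite H// IH// => i /leqW; exact: H.
Qed.

Definition maxavg k (f : T -> R) x := rmax (fun i => `|avg i f x|) k.

Lemma maxavg_ge0 k f x : 0 <= maxavg k f x.
Proof. by apply: le_trans (rmax_ub _ (leq0n k)); rewrite normr_ge0. Qed.

(** A refining chain of partitions with one block at level [0]. The doubling
    condition makes the running maximum of averages comparable at two
    consecutive levels. *)
Record filtration : Prop := Filtration {
  filtration_refine : forall k x y, pi k.+1 x = pi k.+1 y -> pi k x = pi k y;
  filtration_trivial : forall x y, pi 0 x = pi 0 y;
  filtration_doubling : forall k x, (#|block k x| <= 2 * #|block k.+1 x|)%N }.

Section filtration_theory.
Context (fil : filtration).

Lemma refine_le k l x y : (k <= l)%N -> pi l x = pi l y -> pi k x = pi k y.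
Proof.
by move=> kl; rewrite -(subnK kl); elim: (l - k)%N => // n IH;
  rewrite addSn => /(filtration_refine fil)/IH.
Qed.

Lemma avg_tower k l f x : (k <= l)%N -> avg k (avg l f) x = avg k f x.
Proof.
move=> kl; pose h z : R := (z \in block k x)%:R.
have lh : level_fun l h.
  by move=> y z /(refine_le kl) E; rewrite /h !inE E.
have S g : \sum_(y in block k x) g y = \sum_y h y * g y.
  rewrite big_mkcond; apply: eq_bigr => y _; rewrite /h.
  by case: (_ \in _); rewrite ?mul1r ?mul0r.
by rewrite /avg !S -/(avg l f) -(sum_avg f lh).
Qed.

Lemma avg_double k f x : (forall y, 0 <= f y) -> avg k.+1 f x <= 2 * avg k f x.
Proof.
move=> f0; rewrite /avg.
have c1 := card_block_gt0 k x; have c2 := card_block_gt0 k.+1 x.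
have H : \sum_(y in block k.+1 x) f y <= \sum_(y in block k x) f y.
  rewrite big_mkcond [leRHS]big_mkcond/=; apply: ler_sum => y _.
  case: ifPn => [/blockP/(filtration_refine fil)/blockP -> //|_].
  by case: ifP.
apply: (@le_trans _ _ ((#|block k.+1 x|%:R)^-1 * \sum_(y in block k x) f y)).
  by rewrite ler_wpM2l// invr_ge0 ltW.
rewrite mulrA ler_wpM2r//; first exact: sumr_ge0.
rewrite -[leLHS]mul1r ler_pdivrMr// -mulrA mulrC -mulrA ler_pdivlMl// mulr1.
by rewrite mulrC -natrM ler_nat (filtration_doubling fil).
Qed.

Lemma rmax_avg_level k f : level_fun k (fun x => rmax (fun i => avg i f x) k).
Proof.
move=> x y E; apply: eq_rmax => i ik; apply: avg_level.
exact: refine_le ik E.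
Qed.

Lemma maxavg_level k f : level_fun k (maxavg k f).
Proof.
move=> x y E; apply: eq_rmax => i ik; congr `|_|; apply: avg_level.
exact: refine_le ik E.
Qed.

End filtration_theory.
End partitions.
End averages.

(** * Vector-valued maximal inequalities for averages *)

Section vector_valued_maximal.
Set Implicit Arguments.
Unset Strict Implicit.
Local Open Scope ring_scope.
Context {R : realType} {T : finType} (pi : nat -> T -> nat) {m : nat}.
Hypothesis fil : filtration pi.

Notation avg := (@avg R T pi).

(** The pathwise form of Doob's inequality: summation by parts turns the powers
    of the running maximum into its increments, and an increment at [k] is
    present only when [a k] is the maximum. *)
Lemma rmax_powR_telescope (a : nat -> R) (q : R) n : 1 < q ->
  (forall k, 0 <= a k) ->
  (q - 1) * rmax a n `^ q <= q * \sum_(k < n.+1) a k *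
    (rmax a k `^ (q - 1) - if val k is j.+1 then rmax a j `^ (q - 1) else 0).
Proof.
move=> q1 a0; have q0 : 0 < q by exact: lt_trans ltr01 q1.
have D0 k : 0 <= rmax a k by apply: le_trans (rmax_ub a (leq0n k)).
elim: n => [|n IH].
  rewrite big_ord_recr big_ord0/= add0r subr0 mulr_powRB1//.
  by rewrite ler_wpM2r ?powR_ge0// lerBlDr lerDl.
rewrite big_ord_recr/= mulrDr; move: IH.
set S := (X in q * X); case: (leP (rmax a n) (a n.+1)) => ha IH; last first.
  by rewrite subrr mulr0 mulr0 addr0.
have := young_powR q1 (a0 n.+1) (D0 n).
have := young_powR q1 (D0 n) (a0 n.+1).
have := @mulr_powRB1 _ _ q (a0 n.+1) q0.
have := @mulr_powRB1 _ _ q (D0 n) q0.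
clearbody S.
move: IH; move: (rmax a n) (a n.+1) => d b.
move: (b `^ q) (d `^ q) (b `^ (q - 1)) (d `^ (q - 1)) => bq dq bq1 dq1.
nra.
Qed.

(** Doob's inequality. The increments of [D_k ^ (q - 1)], with [D] the running
    maximum, are constant on the blocks of level [k] and vanish unless the
    maximum is attained there, so that the average can be removed. *)
Lemma doob (q : R) (f : T -> R) : 1 < q -> (forall x, 0 <= f x) ->
  \sum_x rmax (fun i => avg i f x) m `^ q <=
  (q / (q - 1)) `^ q * \sum_x f x `^ q.
Proof.
move=> q1 f0; have q0 : 0 < q by exact: lt_trans ltr01 q1.
have q10 : 0 < q - 1 by rewrite subr_gt0.
have a0 k x : 0 <= avg k f x by exact: avg_ge0.
pose D k x := rmax (fun i => avg i f x) k.
have D0 k x : 0 <= D k x by apply: le_trans (rmax_ub _ (leq0n k)); exact: a0.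
apply: (absorb_sum q1 (ltW (conj_gt0 q1)) (D0 m) f0).
pose h k x := D k x `^ (q - 1) - if k is j.+1 then D j x `^ (q - 1) else 0.
have lh k : level_fun pi k (h k).
  move=> x y E; rewrite /h /D (rmax_avg_level fil f E); congr (_ - _).
  by case: k E => // k /(filtration_refine fil) E; rewrite (rmax_avg_level fil f E).
have tel x n : \sum_(k < n.+1) h k x = D n x `^ (q - 1).
  elim: n => [|n IH]; first by rewrite big_ord_recr big_ord0/= add0r /h subr0.
  by rewrite big_ord_recr/= IH /h addrC subrK.
have H x : (q - 1) * D m x `^ q <= q * \sum_(k < m.+1) avg k f x * h k x.
  by apply: rmax_powR_telescope.
have := ler_sum (index_enum T) (fun x (_ : xpredT x) => H x).
rewrite -!mulr_sumr exchange_big/=.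
have -> : \sum_(k < m.+1) \sum_x avg k f x * h k x =
          \sum_x f x * D m x `^ (q - 1).
  transitivity (\sum_(k < m.+1) \sum_x f x * h k x).
    apply: eq_bigr => k _; have := sum_avg f (lh k).
    by under eq_bigr do rewrite mulrC; under [RHS]eq_bigr do rewrite mulrC.
  by rewrite exchange_big/=; apply: eq_bigr => x _; rewrite -mulr_sumr tel.
move=> E; rewrite -(ler_pM2l q10); apply: (le_trans E).
rewrite mulrA [_ * (q / _)]mulrCA divff ?mulr1//.
by rewrite gt_eqF.
Qed.

Section lattice.
Context {W : Type} (N : (W -> R) -> R) (hN : lattice_norm N).
Implicit Types f : T -> W -> R.

Definition lmax k f x : W -> R := fun w => maxavg pi k (fun y => f y w) x.

Definition maximal_bound (s K : R) := forall f,
  \sum_x N (lmax m f x) `^ s <= K * \sum_x N (f x) `^ s.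

(** Raising the exponent (Garsia's argument). For the increasing process
    [F_k = N (M_k f)], the average of [F_m - F_(k-1)] over a block [Q] of level
    [k] only sees [f] on [Q], where the bound with exponent [s] controls it by
    the [s]-th power average of [N f]. *)
Lemma maximal_bound_up (s q K : R) : 1 < s -> s < q -> 0 <= K ->
  maximal_bound s K ->
  maximal_bound q ((q * K `^ s^-1) `^ q * (q / s / (q / s - 1)) `^ (q / s)).
Proof.
move=> s1 sq K0 HK f.
have s0 : 0 < s by exact: lt_trans ltr01 s1.
have q1 : 1 < q by exact: lt_trans sq.
have q0 : 0 < q by exact: lt_trans ltr01 q1.
have sn0 : s != 0 by rewrite gt_eqF.
have qs1 : 1 < q / s by rewrite ltr_pdivlMr// mul1r.
have N0 a : 0 <= N a by exact: lattice_norm_ge0.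
pose F k x := N (lmax k f x).
have F0 k x : 0 <= F k x by exact: N0.
have Fmono k l x : (k <= l)%N -> F k x <= F l x.
  move=> kl; apply: (lattice_norm_le hN) => w.
  by rewrite !ger0_norm ?maxavg_ge0//; exact: le_rmax.
have Flev k : level_fun pi k (F k).
  move=> x y E; congr N; apply/funext => w; exact: (maxavg_level fil _ E).
pose P k x := if k is j.+1 then F j x else 0.
pose Z x := rmax (fun i => avg i (fun y => N (f y) `^ s) x) m `^ s^-1.
have Z0 x : 0 <= Z x by exact: powR_ge0.
pose h k x := F k x `^ (q - 1) - P k x `^ (q - 1).
have q10 : 0 <= q - 1 by rewrite subr_ge0 ltW.
have h0 k x : 0 <= h k x.
  rewrite subr_ge0; apply: le_powR => //; rewrite /P; case: k => // k.
  exact: Fmono.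
have lP k : level_fun pi k (P k).
  by case: k => // k x y /(filtration_refine fil); exact: Flev.
have lh k : level_fun pi k (h k).
  by move=> x y E; rewrite /h (Flev _ _ _ E) (lP _ _ _ E).
have P0 k x : 0 <= P k x by rewrite /P; case: k.
have tel x n : \sum_(k < n.+1) h k x = F n x `^ (q - 1).
  elim: n => [|n IH].
    rewrite big_ord_recr big_ord0/= add0r /h /= powR0 ?subr0//.
    by rewrite gt_eqF// subr_gt0.
  by rewrite big_ord_recr/= IH /h/= addrC subrK.
have loc k x : (k <= m)%N ->
    avg k (fun y => F m y - P k y) x <= K `^ s^-1 * Z x.
  move=> km; pose g y w := if y \in block pi k x then f y w else 0.
  have Hy y : pi k y = pi k x -> F m y - P k y <= N (lmax m g y).
    move=> yx; rewrite lerBlDr.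
    apply: (@le_trans _ _ (N (fun w => lmax m g y w +
        (if k is j.+1 then lmax j f y w else 0)))).
      apply: (lattice_norm_le hN) => w.
      have u0 : 0 <= (if k is j.+1 then lmax j f y w else 0).
        by case: (k) => // j; exact: maxavg_ge0.
      rewrite !ger0_norm ?addr_ge0 ?maxavg_ge0//.
      apply: rmax_le => i im; have [ki|ik] := leqP k i.
        rewrite -[leLHS]addr0 lerD//.
        rewrite (@eq_avg_in _ _ _ i _ (fun y => g y w)).
          exact: (rmax_ub (fun i => `|avg i (fun y => g y w) y|) im).
        move=> z /(refine_le fil ki) zy; rewrite /g ifT//.
        by apply/blockP; rewrite zy.
      rewrite -[leLHS]add0r lerD ?maxavg_ge0//.
      case: (k) ik => // j; rewrite ltnS => ij.
      exact: (rmax_ub (fun i => `|avg i (fun y => f y w) y|) ij).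
    apply: (le_trans (lattice_normD hN _ _)); rewrite lerD2l /P.
    by case: (k) => //; rewrite lattice_norm0.
  have G0 y : 0 <= N (lmax m g y) by exact: N0.
  apply: (le_trans (avg_le Hy)).
  have : avg k (fun y => N (lmax m g y)) x `^ s <=
         K * avg k (fun y => N (f y) `^ s) x.
    apply: (le_trans (avg_powR _ _ _ s1 G0)).
    rewrite !avgE mulrCA ler_pM2l ?invr_gt0 ?card_block_gt0//.
    apply: (@le_trans _ _ (\sum_y N (lmax m g y) `^ s)).
      rewrite big_mkcond/=; apply: ler_sum => y _.
      by case: ifP => _ //; rewrite powR_ge0.
    apply: (le_trans (HK g)); rewrite ler_wpM2l//.
    rewrite [leRHS]big_mkcond/=; apply: ler_sum => y _; rewrite /g.
    by case: ifP => _ //; rewrite (lattice_norm0 hN) powR0.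
  have A0 : 0 <= avg k (fun y => N (f y) `^ s) x.
    by apply: avg_ge0 => y; exact: powR_ge0.
  have s'0 : 0 <= s^-1 by rewrite invr_ge0 ltW.
  move=> /(le_powR s'0 (powR_ge0 _ _)).
  rewrite (powR_KV sn0) ?(powRM _ K0 A0); last by apply: avg_ge0.
  move=> /le_trans; apply; apply: ler_wpM2l; first exact: powR_ge0.
  rewrite /Z; apply: (le_powR s'0 A0).
  exact: (rmax_ub (fun i => avg i (fun y => N (f y) `^ s) x) km).
have garsia x : F m x `^ q <= q * \sum_(k < m.+1) (F m x - P k x) * h k x.
  suff H n : (n <= m)%N ->
      F n x `^ q + q * ((F m x - F n x) * F n x `^ (q - 1)) <=
      q * \sum_(k < n.+1) (F m x - P k x) * h k x.
    by have := H m (leqnn m); rewrite subrr mul0r mulr0 addr0.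
  elim: n => [_|n IH nm].
    rewrite big_ord_recr big_ord0/= add0r subr0 /h/= powR0 ?subr0; last first.
      by rewrite gt_eqF// subr_gt0.
    have := @mulr_powRB1 _ (F 0%N x) q (F0 _ _) q0.
    have := powR_ge0 (F 0%N x) q.
    move: (_ `^ q) (_ `^ (q - 1)) => u v; nra.
  rewrite big_ord_recr/= mulrDr; apply: le_trans (lerD (IH (ltnW nm)) (lexx _)).
  have := powRB_le q1 (F0 n x) (F0 n.+1 x); rewrite /h/=.
  move: (_ `^ q) (_ `^ q) (_ `^ (q - 1)) (_ `^ (q - 1)) => u v u' v'.
  nra.
have key : \sum_x F m x `^ q <= q * K `^ s^-1 *
           \sum_x Z x * F m x `^ (q - 1).
  apply: (le_trans (ler_sum _ (fun x _ => garsia x))).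
  rewrite -mulr_sumr -mulrA (ler_pM2l q0) exchange_big/= mulr_sumr.
  under [leRHS]eq_bigr do rewrite -tel mulrA mulr_sumr.
  rewrite [leRHS]exchange_big/=; apply: ler_sum => k _.
  under eq_bigr do rewrite mulrC.
  rewrite -(sum_avg (fun y => F m y - P k y) (lh k)).
  apply: ler_sum => x _; rewrite mulrC ler_wpM2r// loc//.
  by rewrite -ltnS.
have qK0 : 0 <= q * K `^ s^-1 by rewrite mulr_ge0 ?powR_ge0// ltW.
apply: (le_trans (absorb_sum q1 qK0 (F0 m) Z0 key)).
rewrite -mulrA ler_wpM2l ?powR_ge0//.
have -> : \sum_x Z x `^ q =
    \sum_x rmax (fun i => avg i (fun y => N (f y) `^ s) x) m `^ (q / s).
  by apply: eq_bigr => x _; rewrite /Z -powRrM mulrC.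
have -> : \sum_x N (f x) `^ q = \sum_x (N (f x) `^ s) `^ (q / s).
  by apply: eq_bigr => x _; rewrite -powRrM mulrCA divff// mulr1.
by apply: doob => // x; exact: powR_ge0.
Qed.

End lattice.
End vector_valued_maximal.

Section lowering_the_exponent.
Set Implicit Arguments.
Unset Strict Implicit.
Local Open Scope ring_scope.

(** The logarithm turns both sides into functions of [L = ln y - ln x]; the
    assumption [y <= 2 x] is what allows [y] to be replaced by [x] on the left
    before [1 + t <= expR t] is used twice. *)
Lemma powR_increment {R : realType} (x y b : R) : 0 < b < 1 -> 0 < x -> x <= y -> y <= 2 * x ->
  (x `^ (- b) - y `^ (- b)) * y <=
  2 * b / (1 - b) * (y `^ (1 - b) - x `^ (1 - b)).
Proof.
move=> /andP[b0 b1] x0 xy yx; have y0 : 0 < y by exact: lt_le_trans xy.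
have b1' : 0 < 1 - b by rewrite subr_gt0.
pose L := ln y - ln x; have L0 : 0 <= L by rewrite subr_ge0 ler_ln.
pose X := x `^ (1 - b); have X0 : 0 < X by exact: powR_gt0.
have e c : y `^ c = x `^ c * expR (c * L).
  by rewrite /powR !gt_eqF// -expRD mulrBr addrC subrK.
have xX : x `^ (- b) * x = X.
  by rewrite /X addrC powRD ?powRr1 ?(ltW x0)// (gt_eqF x0) implybT.
rewrite (e (1 - b)) -/X.
have h1 := expR_ge1Dx (- b * L); have h2 := expR_ge1Dx ((1 - b) * L).
have xb0 : 0 < x `^ (- b) by exact: powR_gt0.
clearbody L X.
apply: (@le_trans _ _ (2 * (b * L) * X)).
  apply: (@le_trans _ _ ((x `^ (- b) * (b * L)) * y)).
    rewrite ler_wpM2r ?(ltW y0)// (e (- b)).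
    rewrite -[Z in Z - _]mulr1 -mulrBr ler_wpM2l ?(ltW xb0)//.
    by move: h1; rewrite mulNr !lerBlDl addrC.
  rewrite -xX (_ : 2 * (b * L) * _ = x `^ (- b) * (b * L) * (2 * x)); last ring.
  by rewrite ler_wpM2l// mulr_ge0 ?(ltW xb0)// mulr_ge0// ltW.
rewrite -[2 * b / _]mulrA -[X in _ <= _ * (_ - X)]mulr1 -mulrBr.
apply: (@le_trans _ _ (2 * (b / (1 - b)) * (X * ((1 - b) * L)))).
  rewrite le_eqVlt; apply/orP; left; apply/eqP.
  by field; rewrite gt_eqF.
rewrite ler_wpM2l//; first by rewrite mulr_ge0// divr_ge0// ltW.
rewrite ler_wpM2l ?(ltW X0)//.
by rewrite lerBrDl.
Qed.

Context {R : realType} {T : finType} (pi : nat -> T -> nat) {m : nat}.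
Hypothesis fil : filtration pi.

Notation avg := (@avg R T pi).

(** The martingale transform of [u] by [D_k ^ (- b)], stopped at level [k]. *)
Fixpoint transform (D : nat -> T -> R) (b : R) (u : T -> R) k x : R :=
  if k is j.+1 then
    transform D b u j x + D j x `^ (- b) * (avg j.+1 u x - avg j u x)
  else D 0%N x `^ (- b) * avg 0 u x.

Section transform_theory.
Variables (D : nat -> T -> R) (b : R).
Hypotheses (D0 : forall k x, 0 < D k x) (b01 : 0 < b < 1).
Hypothesis Dmono : forall k x, D k x <= D k.+1 x.
Hypothesis Dlev : forall k, level_fun pi k (D k).

Lemma transform_level u k : level_fun pi k (transform D b u k).
Proof.
elim: k => [|k IH] x y E /=; first by rewrite (Dlev E) (avg_level u E).
have E' := filtration_refine fil E.
by rewrite (IH _ _ E') (Dlev E') (avg_level u E) (avg_level u E').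
Qed.

Lemma avg_transform u k l x : (k <= l)%N ->
  avg k (transform D b u l) x = transform D b u k x.
Proof.
elim: l => [|l IH] kl.
  by move: kl; rewrite leqn0 => /eqP ->; apply: avg_level_id; exact: transform_level.
move: kl; rewrite leq_eqVlt => /predU1P[->|].
  by apply: avg_level_id; exact: transform_level.
rewrite ltnS => kl; rewrite /= avgD IH// -[RHS]addr0; congr (_ + _).
rewrite -(avg_tower fil _ _ kl) -[RHS](avg_cst pi k 0 x).
apply: eq_avg_in => y _.
rewrite avgM; last by move=> z t E; rewrite (Dlev E).
rewrite avgB (avg_tower fil u y (leqnSn l)).
by rewrite (avg_level_id y (avg_level (pi := pi) (k := l) u)) subrr mulr0.
Qed.

Lemma powR_opp_mul x (y : R) : 0 < y -> y `^ x * y `^ (- x) = 1.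
Proof.
move=> y0; rewrite -powRD ?subrr ?powRr0//.
by rewrite (gt_eqF y0) implybT.
Qed.

(** Summation by parts, the multipliers [D_k ^ b] being nondecreasing. *)
Lemma avg_le_transform u k x :
  `|avg k u x| <= 2 * (D k x `^ b * rmax (fun i => `|transform D b u i x|) k).
Proof.
have b0 : 0 <= b by case/andP: b01 => /ltW.
pose G i := transform D b u i x.
pose M k := rmax (fun i => `|G i|) k.
pose a k := if k is j.+1 then D j x `^ b else D 0%N x `^ b.
have GM i : `|G i| <= M i by exact: (rmax_ub (fun i => `|G i|)).
have aD i : a i <= D i x `^ b.
  by case: i => // i; apply: le_powR => //; rewrite ltW.
have aM i : a i <= a i.+1 by exact: aD.
have a00 : 0 <= a 0%N by exact: powR_ge0.
have a0M i : a 0%N <= a i by elim: i => // i /le_trans; apply.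
suff H : `|avg k u x - a k * G k| <= (a k - a 0%N) * M k.
  apply: (@le_trans _ _ (2 * (a k * M k))).
    have := ler_normD (avg k u x - a k * G k) (a k * G k).
    rewrite subrK (normrM (a k) (G k)) (ger0_norm (le_trans a00 (a0M k))).
    have := GM k; have := a0M k; have M0 := le_trans (normr_ge0 _) (GM k).
    move: H; move: (a k) (a 0%N) (M k) (`|G k|) a00 M0 => A B C E; nra.
  rewrite ler_wpM2l// ler_wpM2r//; exact: le_trans (normr_ge0 _) (GM k).
elim: k => [|k IH].
  rewrite /G/= mulrA powR_opp_mul// mul1r subrr normr0.
  by rewrite subrr mul0r.
have -> : avg k.+1 u x - a k.+1 * G k.+1 =
          avg k u x - a k * G k - (a k.+1 - a k) * G k.
  have -> : G k.+1 = G k + D k x `^ (- b) * (avg k.+1 u x - avg k u x) by [].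
  have := powR_opp_mul b (D0 k x); rewrite -/(a k.+1).
  move: (a k.+1) (D k x `^ (- b)) => A c /eqP E.
  rewrite [A * (_ + _)]mulrDr mulrA (eqP E); ring.
apply: (le_trans (ler_normB _ _)); rewrite (normrM (_ - _) (G k)).
rewrite (ger0_norm (_ : 0 <= a k.+1 - a k)); last by rewrite subr_ge0.
have MM : M k <= M k.+1 by exact: le_rmax.
have := GM k; have := a0M k; have := aM k; move: IH MM.
have := normr_ge0 (G k); move: `|G k| `|_ - _| => g d.
move: (M k) (M k.+1) (a k) (a k.+1) (a 0%N) => M1 M2 A1 A2 A0; nra.
Qed.

Lemma transform_step u k x : transform D b u k.+1 x - D k.+1 x `^ (- b) * avg k.+1 u x =
  (transform D b u k x - D k x `^ (- b) * avg k u x) +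
  (D k x `^ (- b) - D k.+1 x `^ (- b)) * avg k.+1 u x.
Proof. rewrite /=; ring. Qed.

End transform_theory.

Section lattice.
Context {W : Type} (N : (W -> R) -> R) (hN : lattice_norm N).

(** The difference between the transform and [D_k ^ (- b)] times the average is
    a sum of terms [(D_i ^ (- b) - D_(i+1) ^ (- b)) E_(i+1) f]; their norms
    telescope because [N (E_(i+1) f) <= D_(i+1) <= 2 D_i]. *)
Lemma lattice_norm_transform (D : nat -> T -> R) b (f : T -> W -> R) k x :
  (forall k x, 0 < D k x) -> 0 < b < 1 ->
  (forall k x, D k x <= D k.+1 x <= 2 * D k x) ->
  (forall k, avg k (fun y => N (f y)) x <= D k x) ->
  N (fun w => transform D b (fun y => f y w) k x) <=
  (1 + 2 * b / (1 - b)) * D k x `^ (1 - b).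
Proof.
move=> D0 b01 Dstep fD; have /andP[b0 b1] := b01.
have b1' : 0 < 1 - b by rewrite subr_gt0.
have kap0 : 0 <= 2 * b / (1 - b) by rewrite divr_ge0 ?mulr_ge0// ltW.
have Nf k' : N (fun w => avg k' (fun y => f y w) x) <= D k' x.
  by apply: le_trans (fD k'); exact: lattice_norm_avg.
have cD k' : D k' x `^ (- b) * D k' x = D k' x `^ (1 - b).
  rewrite addrC [RHS]powRD ?powRr1 ?(ltW (D0 _ _))//.
  by rewrite (gt_eqF (D0 _ _)) implybT.
suff H : N (fun w => transform D b (fun y => f y w) k x -
    D k x `^ (- b) * avg k (fun y => f y w) x) <=
    2 * b / (1 - b) * (D k x `^ (1 - b) - D 0%N x `^ (1 - b)).
  have -> : (fun w => transform D b (fun y => f y w) k x) =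
    (fun w => D k x `^ (- b) * avg k (fun y => f y w) x +
      (transform D b (fun y => f y w) k x -
       D k x `^ (- b) * avg k (fun y => f y w) x)).
    by apply/funext => w; rewrite addrC subrK.
  apply: (le_trans (lattice_normD hN _ _)).
  rewrite (lattice_normZ hN) ?powR_ge0// mulrDl mul1r; apply: lerD.
    by rewrite -cD ler_wpM2l// powR_ge0.
  apply: (le_trans H); rewrite ler_wpM2l// lerBlDr lerDl.
  exact: powR_ge0.
elim: k => [|k IH].
  rewrite (_ : (fun _ => _) = fun=> 0) ?(lattice_norm0 hN) ?subrr ?mulr0//.
  by apply/funext => w; rewrite /= subrr.
rewrite (_ : (fun _ => _) = fun w => (transform D b (fun y => f y w) k x -
     D k x `^ (- b) * avg k (fun y => f y w) x) +
    (D k x `^ (- b) - D k.+1 x `^ (- b)) * avg k.+1 (fun y => f y w) x).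
  apply: (le_trans (lattice_normD hN _ _)).
  have /andP[d1 d2] := Dstep k x.
  have c0 : 0 <= D k x `^ (- b) - D k.+1 x `^ (- b).
    rewrite subr_ge0 !powRN lef_pV2 ?posrE ?powR_gt0//.
    by apply: le_powR => //; exact: ltW.
  rewrite (lattice_normZ hN)//.
  have := powR_increment b01 (D0 k x) d1 d2.
  have := ler_wpM2l c0 (Nf k.+1).
  move: IH; rewrite !mulrBr.
  move: (N _) (_ * N _) (_ * D k.+1 x) (2 * b / (1 - b)) => u v z kp.
  lra.
by apply/funext => w; exact: transform_step.
Qed.

(** Lowering the exponent. With [D_k] the running maximum of the averages of
    [N f], the transform [g] of [f] by [D_k ^ (- b)] satisfies
    [M f <= 2 D^b M g] and [N g <= C D^(1 - b)], and for [b = 1 - q / s] the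
    bound with exponent [s] applied to [g] gives the one with exponent [q]
    for [f] after Hoelder's and Doob's inequalities. *)
Lemma maximal_bound_down (s q K : R) : 1 < q -> q < s -> 0 <= K ->
  maximal_bound pi N (m := m) s K ->
  let b := (s - q) / s in
  maximal_bound pi N (m := m) q
    (2 `^ q * (K * (1 + 2 * b / (1 - b)) `^ s) `^ (q / s) *
     (q / (q - 1)) `^ q).
Proof.
move=> q1 qs K0 HK b f.
have q0 : 0 < q by exact: lt_trans ltr01 q1.
have s0 : 0 < s by exact: lt_trans qs.
have sn0 : s != 0 by rewrite gt_eqF.
have qn0 : q != 0 by rewrite gt_eqF.
have sq0 : 0 < s - q by rewrite subr_gt0.
have N0 a : 0 <= N a by exact: lattice_norm_ge0.
have b01 : 0 < b < 1.
  by rewrite divr_gt0//= ltr_pdivrMr// mul1r ltrBlDr ltrDl.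
have b1 : 1 - b = q / s by rewrite /b; field.
set kap := 1 + _; have kap0 : 0 <= kap.
  have /andP[b0 b1'] := b01; apply: addr_ge0 => //; apply: divr_ge0.
    by rewrite mulr_ge0// ltW.
  by rewrite subr_ge0 ltW.
have [/forallP f_eq0|/forallPn[y0 fy0]] :=
    boolP [forall x, N (f x) == 0].
  rewrite [leLHS]big1; last first.
    move=> x _; rewrite (_ : N _ = 0) ?powR0//; apply/eqP; rewrite eq_le N0 andbT.
    apply: (@le_trans _ _ (N (fun w => \sum_y `|f y w|))).
      apply: (lattice_norm_le hN) => w.
      rewrite ger0_norm ?maxavg_ge0// ger0_norm ?sumr_ge0//.
      apply: rmax_le => i _; apply: (le_trans (avg_norm _ _ _ _)).
      rewrite -[leRHS](avg_cst pi i _ x); apply: avg_le => y _.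
      by rewrite (bigD1 y)//= lerDl sumr_ge0.
    apply: (le_trans (lattice_norm_sum hN _ _ _)).
    by rewrite big1// => y _; rewrite (lattice_norm_abs hN); exact/eqP/f_eq0.
  by rewrite !mulr_ge0 ?powR_ge0// sumr_ge0// => x _; exact: powR_ge0.
pose D k x := rmax (fun i => avg i (fun y => N (f y)) x) k.
have E0 k x : 0 <= avg k (fun y => N (f y)) x by exact: avg_ge0.
have D0 k x : 0 < D k x.
  apply: lt_le_trans (rmax_ub _ (leq0n k)).
  rewrite avgE mulr_gt0 ?invr_gt0 ?card_block_gt0//.
  rewrite (bigD1 y0)/=; last by apply/blockP; exact: (filtration_trivial fil).
  rewrite ltr_pwDl//; last exact: sumr_ge0.
  by rewrite lt_neqAle N0 andbT eq_sym.
have Dmono k x : D k x <= D k.+1 x by exact: le_rmax.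
have Dlev k : level_fun pi k (D k).
  by move=> x y E; exact: (rmax_avg_level fil _ E).
have Dstep k x : D k x <= D k.+1 x <= 2 * D k x.
  rewrite Dmono/= ge_max; apply/andP; split.
    by rewrite -[leLHS]mul1r; apply: ler_wpM2r; rewrite ?ler1n//; exact/ltW/D0.
  apply: (le_trans (avg_double fil k x (fun y => N0 (f y)))).
  rewrite ler_wpM2l//.
  exact: (rmax_ub (fun i => avg i (fun y => N (f y)) x)).
pose g x w := transform D b (fun y => f y w) m x.
have gD x : N (g x) <= kap * D m x `^ (1 - b).
  apply: lattice_norm_transform => // k.
  exact: (rmax_ub (fun i => avg i (fun y => N (f y)) x)).
have fg x : N (lmax pi m f x) <= 2 * D m x `^ b * N (lmax pi m g x).
  rewrite -(lattice_normZ hN); last by rewrite mulr_ge0 ?powR_ge0.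
  apply: (lattice_norm_le hN) => w.
  rewrite !ger0_norm ?mulr_ge0 ?powR_ge0 ?maxavg_ge0//.
  apply: rmax_le => i im.
  apply: (le_trans (avg_le_transform D0 b01 Dmono _ _ _)).
  rewrite -mulrA ler_wpM2l//; apply: ler_pM.
  - exact: powR_ge0.
  - exact: le_trans (rmax_ub _ (leq0n i)).
  - by apply: le_powR; [case/andP: b01 => /ltW|exact/ltW|exact: le_rmax].
  rewrite (eq_rmax (b := fun i => `|avg i (fun y => g y w) x|)).
    exact: le_rmax.
  by move=> j ji; rewrite (avg_transform b Dlev)// (leq_trans ji).
set S := \sum_x N (f x) `^ q.
pose SD := \sum_x D m x `^ q.
have SD0 : 0 <= SD by apply: sumr_ge0 => x _; exact: powR_ge0.
have SDS : SD <= (q / (q - 1)) `^ q * S by exact: (doob fil q1).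
apply: (@le_trans _ _ (2 `^ q * (K * kap `^ s) `^ (q / s) * SD)); last first.
  rewrite -[leRHS]mulrA; apply: (ler_wpM2l _ SDS).
  by rewrite mulr_ge0// powR_ge0.
apply: (@le_trans _ _ (2 `^ q *
    \sum_x N (lmax pi m g x) `^ q * D m x `^ (b * q))).
  rewrite mulr_sumr; apply: ler_sum => x _.
  apply: (le_trans (le_powR (ltW q0) (N0 _) (fg x))).
  rewrite powRM ?mulr_ge0 ?powR_ge0// powRM ?powR_ge0// -powRrM.
  by rewrite -mulrA [_ * N _ `^ _]mulrC lexx.
rewrite -[leRHS]mulrA; apply: ler_wpM2l; first exact: powR_ge0.
have sq1 : (s / q)^-1 + (s / (s - q))^-1 = 1.
  by rewrite !invf_div -mulrDl addrC subrK divff.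
apply: (le_trans (holder_sum (fun x => powR_ge0 _ _) (fun x => powR_ge0 _ _)
  (divr_gt0 s0 q0) (divr_gt0 s0 sq0) sq1)).
have -> : \sum_x (N (lmax pi m g x) `^ q) `^ (s / q) =
          \sum_x N (lmax pi m g x) `^ s.
  by apply: eq_bigr => x _; rewrite -powRrM mulrCA divff ?mulr1.
have -> : \sum_x (D m x `^ (b * q)) `^ (s / (s - q)) = SD.
  apply: eq_bigr => x _; rewrite -powRrM; congr (_ `^ _).
  by rewrite /b; field; rewrite sn0 gt_eqF.
have gS : \sum_x N (lmax pi m g x) `^ s <= K * kap `^ s * SD.
  apply: (le_trans (HK g)); rewrite -mulrA ler_wpM2l// /SD mulr_sumr.
  apply: ler_sum => x _.
  apply: (le_trans (le_powR (ltW s0) (N0 _) (gD x))).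
  by rewrite powRM ?powR_ge0// -powRrM b1 divfK.
have Kk : 0 <= K * kap `^ s by rewrite mulr_ge0 ?powR_ge0.
rewrite !invf_div.
apply: (@le_trans _ _ ((K * kap `^ s * SD) `^ (q / s) * SD `^ ((s - q) / s))).
  rewrite ler_wpM2r ?powR_ge0//; apply: le_powR => //.
    by rewrite divr_ge0// ltW.
  by apply: sumr_ge0 => x _; exact: powR_ge0.
rewrite powRM// -mulrA ler_wpM2l ?powR_ge0//.
have e : q / s + (s - q) / s = 1 by rewrite -mulrDl addrC subrK divff.
by rewrite -powRD ?e ?powRr1// oner_eq0.
Qed.

End lattice.
End lowering_the_exponent.

(** * The iterated maximal operator on mixed norms over a finite grid *)

Section mixed_norms_on_a_grid.
Set Implicit Arguments.
Unset Strict Implicit.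
Local Open Scope ring_scope.
Context {R : realType}.

Definition lpnorm (I : finType) (h q : R) (a : I -> R) : R :=
  (h * \sum_i `|a i| `^ q) `^ q^-1.

Lemma eqW (x y : R) : x = y -> x <= y.
Proof. by move=> ->. Qed.

Lemma ler_norm_ge0 (x y : R) : 0 <= x -> x <= y -> `|x| <= `|y|.
Proof. by move=> x0 xy; rewrite !ger0_norm// (le_trans x0). Qed.

Section lpnorm_theory.
Context {I : finType} (h q : R).
Hypotheses (h0 : 0 < h) (q1 : 1 < q).
Let q0 : 0 < q := lt_trans ltr01 q1.

Lemma sum_powR_ge0 (J : finType) (a : J -> R) (r : R) : 0 <= \sum_i `|a i| `^ r.
Proof. by apply: sumr_ge0 => i _; exact: powR_ge0. Qed.

Lemma lpnorm_powR (a : I -> R) : lpnorm h q a `^ q = h * \sum_i `|a i| `^ q.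
Proof.
by rewrite /lpnorm powRV_K ?gt_eqF// mulr_ge0 ?sum_powR_ge0// ltW.
Qed.

Lemma sum_powR_norm (a : I -> R) (r : R) : (forall i, 0 <= a i) ->
  \sum_i `|a i| `^ r = \sum_i a i `^ r.
Proof. by move=> a0; apply: eq_bigr => i _; rewrite ger0_norm. Qed.

Lemma lpnorm_le (a b : I -> R) : (forall i, `|a i| <= `|b i|) ->
  lpnorm h q a <= lpnorm h q b.
Proof.
move=> ab; apply: le_powR; first by rewrite invr_ge0 ltW.
  by rewrite mulr_ge0 ?sum_powR_ge0// ltW.
rewrite ler_wpM2l ?(ltW h0)//; apply: ler_sum => i _.
by apply: le_powR => //; exact: ltW.
Qed.

Lemma lpnormZ (c : R) (a : I -> R) : 0 <= c ->
  lpnorm h q (fun i => c * a i) = c * lpnorm h q a.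
Proof.
move=> c0; rewrite /lpnorm.
have -> : \sum_i `|c * a i| `^ q = c `^ q * \sum_i `|a i| `^ q.
  rewrite mulr_sumr; apply: eq_bigr => i _.
  by rewrite normrM (ger0_norm c0) powRM.
have S0 : 0 <= h * \sum_i `|a i| `^ q by rewrite mulr_ge0 ?sum_powR_ge0// ltW.
rewrite mulrCA (powRM _ (powR_ge0 c q) S0).
by rewrite powR_KV// gt_eqF.
Qed.

Lemma lpnorm_bound (a b : I -> R) (K : R) : 0 <= K ->
  \sum_i `|a i| `^ q <= K * \sum_i `|b i| `^ q ->
  lpnorm h q a <= K `^ q^-1 * lpnorm h q b.
Proof.
move=> K0 H; rewrite /lpnorm -powRM//; last first.
  by rewrite mulr_ge0 ?sum_powR_ge0// ltW.
apply: le_powR; first by rewrite invr_ge0 ltW.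
  by rewrite mulr_ge0 ?sum_powR_ge0// ltW.
by rewrite mulrCA ler_wpM2l// ltW.
Qed.

Lemma lattice_norm_lpnorm (W : Type) (N : (W -> R) -> R) : lattice_norm N ->
  lattice_norm (fun a : I * W -> R => lpnorm h q (fun i => N (fun w => a (i, w)))).
Proof.
move=> hN; have N0 := lattice_norm_ge0 hN; split => [a b ab|a b|c a c0].
- apply: lpnorm_le => i; rewrite !ger0_norm//.
  by apply: (lattice_norm_le hN) => w; exact: ab.
- apply: (@le_trans _ _ (lpnorm h q
      (fun i => N (fun w => a (i, w)) + N (fun w => b (i, w))))).
    apply: lpnorm_le => i; rewrite !ger0_norm ?addr_ge0//.
    exact: (lattice_normD hN).
  rewrite /lpnorm; have hq0 := powR_ge0 h q^-1.
  rewrite !(powRM _ (ltW h0) (sum_powR_ge0 _ _)) -mulrDr ler_wpM2l//.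
  rewrite !sum_powR_norm//; last by move=> i; rewrite addr_ge0.
  exact: minkowski_sum.
- rewrite -(lpnormZ (fun i => N (fun w => a (i, w))) c0).
  congr (lpnorm h q _); apply/funext => i; exact: (lattice_normZ hN).
Qed.

(** With equal exponents the order of summation is exchanged, and the bound
    passes from [N] to the [l^q] norm of [N] with the same constant. *)
Lemma maximal_bound_lpnorm (T : finType) (pi : nat -> T -> nat) m
    (W : Type) (N : (W -> R) -> R) (K : R) : lattice_norm N ->
  maximal_bound pi N (m := m) q K ->
  maximal_bound pi
    (fun a : I * W -> R => lpnorm h q (fun i => N (fun w => a (i, w))))
    (m := m) q K.
Proof.
move=> hN HK f; have N0 := lattice_norm_ge0 hN.
have E (g : T -> I * W -> R) : \sum_(x : T) lpnorm h q (fun i => N (fun w => g x (i, w))) `^ q =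
    h * \sum_i \sum_x N (fun w => g x (i, w)) `^ q.
  rewrite [in RHS]exchange_big/= mulr_sumr; apply: eq_bigr => x _.
  by rewrite lpnorm_powR sum_powR_norm.
apply: (le_trans (eqW (E (lmax pi m f)))).
apply: le_trans (eqW (esym (congr1 ( *%R K) (E f)))).
rewrite [leRHS]mulrCA (ler_pM2l h0) mulr_sumr; apply: ler_sum => i _.
exact: (HK (fun x w => f x (i, w))).
Qed.

End lpnorm_theory.

(** The constant is chosen before the partitions and the space, so that it
    survives the refinement of the grid. *)
Lemma maximal_bound_any (s q K : R) : 1 < s -> 1 < q -> 0 <= K ->
  exists2 K' : R, 0 <= K' &
  forall (T : finType) (pi : nat -> T -> nat) m (fil : filtration pi)
    (W : Type) (N : (W -> R) -> R), lattice_norm N ->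
  maximal_bound pi N (m := m) s K -> maximal_bound pi N (m := m) q K'.
Proof.
move=> s1 q1 K0; case: (ltgtP s q) => [sq|qs|<-].
- exists ((q * K `^ s^-1) `^ q * (q / s / (q / s - 1)) `^ (q / s)).
    by rewrite mulr_ge0// powR_ge0.
  by move=> T pi m fil W N hN; exact: maximal_bound_up.
- pose b := (s - q) / s.
  exists (2 `^ q * (K * (1 + 2 * b / (1 - b)) `^ s) `^ (q / s) *
          (q / (q - 1)) `^ q).
    by apply: mulr_ge0; [apply: mulr_ge0|]; exact: powR_ge0.
  by move=> T pi m fil W N hN; exact: maximal_bound_down.
- by exists K.
Qed.

Lemma lattice_norm_abs1 : lattice_norm (fun a : unit -> R => `|a tt|).
Proof.
split=> [a b|a b|c a c0]; [exact|exact: ler_normD|].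
by rewrite normrM ger0_norm.
Qed.

Lemma maximal_bound_scalar (T : finType) (pi : nat -> T -> nat) m (q : R) :
  filtration pi -> 1 < q ->
  maximal_bound pi (fun a : unit -> R => `|a tt|) (m := m) q ((q / (q - 1)) `^ q).
Proof.
move=> fil q1 f; have q0 : 0 < q by exact: lt_trans ltr01 q1.
apply: le_trans (doob (m := m) fil q1 (fun x => normr_ge0 (f x tt))).
apply: ler_sum => x _; apply: le_powR => //; first exact: ltW.
rewrite ger0_norm ?maxavg_ge0//; apply: rmax_le => i im.
apply: (le_trans (avg_norm _ _ _ _)).
exact: (rmax_ub (fun i => avg pi i (fun y => `|f y tt|) x)).
Qed.

Section two_filtrations.
Context {T : finType} (pi0 pi1 : nat -> T -> nat) (m : nat).

Definition max2 (f : T -> R) x := maxavg pi0 m f x + maxavg pi1 m f x.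

Lemma max2_ge0 f x : 0 <= max2 f x.
Proof. by rewrite addr_ge0 ?maxavg_ge0. Qed.

Lemma max2_bound (W : Type) (N : (W -> R) -> R) (h q K : R) (f : T -> W -> R) :
  lattice_norm N -> 0 < h -> 1 < q -> 0 <= K ->
  maximal_bound pi0 N (m := m) q K -> maximal_bound pi1 N (m := m) q K ->
  lpnorm h q (fun x => N (fun w => max2 (fun y => f y w) x)) <=
  2 * K `^ q^-1 * lpnorm h q (fun x => N (f x)).
Proof.
move=> hN h0 q1 K0 H0 H1; have N0 := lattice_norm_ge0 hN.
have hU := lattice_norm_lpnorm (I := T) h0 q1 hN.
have B pi : maximal_bound pi N (m := m) q K ->
    lpnorm h q (fun x => N (lmax pi m f x)) <=
    K `^ q^-1 * lpnorm h q (fun x => N (f x)).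
  move=> H; apply: lpnorm_bound => //.
  by rewrite !sum_powR_norm//; exact: H.
have := lattice_normD hU (fun xw => lmax pi0 m f xw.1 xw.2)
                         (fun xw => lmax pi1 m f xw.1 xw.2).
move=> /= /le_trans; apply.
by rewrite -mulrA [2 * _]mulrDl !mul1r lerD ?B.
Qed.

Fixpoint itmax n : (n.-tuple T -> R) -> n.-tuple T -> R :=
  match n with
  | 0 => fun f c => f c
  | k.+1 => fun f c => max2 (fun x =>
      itmax (fun y : k.-tuple T => f [tuple of x :: y]) [tuple of behead c])
      (thead c)
  end.

Lemma itmax_ge0 n (f : n.-tuple T -> R) c : (forall c, 0 <= f c) -> 0 <= itmax f c.
Proof. by case: n f c => [|n] f c f0 /=; [exact: f0|exact: max2_ge0]. Qed.

End two_filtrations.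

(** The mixed norm of a function on a grid of mesh [h]; it agrees with the one of
    the step function with the same values. *)
Fixpoint dmix (T : finType) (h : R) n : n.-tuple (\bar R) -> (n.-tuple T -> R) -> R :=
  match n with
  | 0 => fun _ f => `|f [tuple]|
  | k.+1 => fun p f => dmix h [tuple of behead p]
      (fun y : k.-tuple T => lpnorm h (fine (thead p)) (fun x => f [tuple of x :: y]))
  end.

Definition good_exponents n (p : n.-tuple (\bar R)) :=
  forall i : 'I_n, (1 < tnth p i < +oo)%E.

Lemma good_exponents_behead n (p : n.+1.-tuple (\bar R)) :
  good_exponents p -> good_exponents [tuple of behead p].
Proof. by move=> hp i; rewrite tnth_behead. Qed.

Lemma good_exponents_thead n (p : n.+1.-tuple (\bar R)) : good_exponents p ->
  exists2 q : R, 1 < q & thead p = q%:E.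
Proof.
move=> /(_ ord0); rewrite /thead; case: (tnth p ord0) => [q||] /andP[q1 qoo]; last 2 first.
- by rewrite ltxx in qoo.
- by [].
by exists q.
Qed.

Section dmix_theory.
Context {T : finType} (h : R) (h0 : 0 < h).

Lemma lpnorm_ge0 (I : finType) q (a : I -> R) : 0 <= lpnorm h q a.
Proof. exact: powR_ge0. Qed.

Lemma dmix_le n (p : n.-tuple (\bar R)) (f g : n.-tuple T -> R) :
  good_exponents p -> (forall c, `|f c| <= `|g c|) -> dmix h p f <= dmix h p g.
Proof.
elim: n p f g => [|n IH] p f g hp fg /=; first exact: fg.
apply: IH => [|c]; first exact: good_exponents_behead.
have [q q1 ->] := good_exponents_thead hp.
apply: ler_norm_ge0; first exact: lpnorm_ge0.
by apply: lpnorm_le => // x; exact: fg.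
Qed.

Lemma dmixZ n (p : n.-tuple (\bar R)) (c : R) (f : n.-tuple T -> R) :
  good_exponents p -> 0 <= c -> dmix h p (fun x => c * f x) = c * dmix h p f.
Proof.
elim: n p f => [|n IH] p f hp c0 /=; first by rewrite normrM (ger0_norm c0).
rewrite -IH//; last exact: good_exponents_behead.
congr dmix; apply/funext => y; have [q q1 ->] := good_exponents_thead hp.
by rewrite -lpnormZ.
Qed.

End dmix_theory.

(** In each variable in turn the maximal operator acts on functions with values
    in the space formed by the variables already treated; the exponents are
    adjusted between two variables by [maximal_bound_any]. *)
Lemma itmax_bound n (p : n.-tuple (\bar R)) (s K : R) :
  good_exponents p -> 1 < s -> 0 <= K ->
  exists2 C : R, 0 <= C &
  forall (T : finType) (pi0 pi1 : nat -> T -> nat) m (h : R)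
    (W : Type) (N : (W -> R) -> R),
  filtration pi0 -> filtration pi1 -> 0 < h -> lattice_norm N ->
  maximal_bound pi0 N (m := m) s K -> maximal_bound pi1 N (m := m) s K ->
  forall f : n.-tuple T -> W -> R,
  dmix h p (fun c => N (fun w => itmax pi0 pi1 m (fun d => f d w) c)) <=
  C * dmix h p (fun c => N (f c)).
Proof.
elim: n p s K => [|n IH] p s K hp s1 K0.
  by exists 1 => // T pi0 pi1 m h W N *; rewrite mul1r.
have [q q1 pq] := good_exponents_thead hp.
have hp' := good_exponents_behead hp.
have [K1 K10 HK1] := maximal_bound_any s1 q1 K0.
have [C C0 HC] := IH _ q K1 hp' q1 K10.
have k0 : 0 <= 2 * K1 `^ q^-1 by rewrite mulr_ge0// powR_ge0.
exists (2 * K1 `^ q^-1 * C); first exact: mulr_ge0.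
move=> T pi0 pi1 m h W N fil0 fil1 h0 hN H0 H1 f /=; rewrite pq /=.
have {}H0 := HK1 _ _ _ fil0 _ _ hN H0.
have {}H1 := HK1 _ _ _ fil1 _ _ hN H1.
pose N' (a : T * W -> R) := lpnorm h q (fun x => N (fun w => a (x, w))).
have hN' : lattice_norm N' by exact: lattice_norm_lpnorm.
pose f' (y : n.-tuple T) (xw : T * W) := f [tuple of xw.1 :: y] xw.2.
pose g y := N' (fun xw => itmax pi0 pi1 m (fun d => f' d xw) y).
apply: (@le_trans _ _ (dmix h [tuple of behead p]
    (fun y => 2 * K1 `^ q^-1 * g y))).
  apply: dmix_le => // y.
  apply: ler_norm_ge0; first exact: lpnorm_ge0.
  have := max2_bound (fun x w => itmax pi0 pi1 m (fun d => f' d (x, w)) y)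
    hN h0 q1 K10 H0 H1.
  move=> /(le_trans _); apply; rewrite le_eqVlt; apply/orP; left; apply/eqP.
  congr lpnorm; apply/funext => x; congr N; apply/funext => w.
  congr max2; apply/funext => z; rewrite /f'/=.
  by congr itmax; apply/val_inj.
rewrite (dmixZ h0 g hp' k0) -[leRHS]mulrA; apply: ler_wpM2l => //.
apply: HC => //; exact: maximal_bound_lpnorm.
Qed.

(** Values in [l^v], where the induction starts from the scalar maximal operator
    with exponent [v]. *)
Lemma itmax_bound_lv n (p : n.-tuple (\bar R)) (v : R) :
  good_exponents p -> 1 < v -> exists2 C : R, 0 <= C &
  forall (T : finType) (pi0 pi1 : nat -> T -> nat) m (h : R) (J : finType)
    (f : J -> n.-tuple T -> R),
  filtration pi0 -> filtration pi1 -> 0 < h ->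
  dmix h p (fun c => lpnorm 1 v (fun j => itmax pi0 pi1 m (f j) c)) <=
  C * dmix h p (fun c => lpnorm 1 v (fun j => f j c)).
Proof.
move=> hp v1; have [C C0 H] := itmax_bound hp v1 (powR_ge0 (v / (v - 1)) v).
exists C => // T pi0 pi1 m h J f fil0 fil1 h0.
pose N (a : J * unit -> R) := lpnorm 1 v (fun j => `|a (j, tt)|).
have hN : lattice_norm N by exact: (lattice_norm_lpnorm _ _ lattice_norm_abs1).
have B (pi : nat -> T -> nat) : filtration pi ->
    maximal_bound pi N (m := m) v ((v / (v - 1)) `^ v).
  move=> fil; apply: (maximal_bound_lpnorm ltr01 v1 lattice_norm_abs1).
  exact: maximal_bound_scalar.
have HN := H T pi0 pi1 m h _ N fil0 fil1 h0 hN (B _ fil0) (B _ fil1)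
  (fun c jt => f jt.1 c).
have E (F : n.-tuple T -> J -> R) :
    dmix h p (fun c => N (fun jt => F c jt.1)) =
    dmix h p (fun c => lpnorm 1 v (F c)).
  congr (dmix h p _); apply/funext => c; rewrite /N /lpnorm; congr ((1 * _) `^ _).
  by apply: eq_bigr => j _; rewrite normr_id.
apply: (le_trans (eqW (esym (E (fun c j => itmax pi0 pi1 m (f j) c))))).
apply: (le_trans HN); apply: eqW.
exact: (congr1 ( *%R C) (E (fun c j => f j c))).
Qed.

End mixed_norms_on_a_grid.

(** * Dyadic blocks and rectangles *)

Section dyadic_blocks.
Set Implicit Arguments.
Unset Strict Implicit.
Local Open Scope nat_scope.

(** The dyadic intervals of ['I_(2 ^ m)], translated cyclically by [t]. *)
Definition dyadic m t k (x : 'I_(2 ^ m)) : nat :=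
  ((x + t) %% 2 ^ m) %/ 2 ^ (m - k).

Lemma dyadic_eq m t k (x y : 'I_(2 ^ m)) :
  (x + t) %/ 2 ^ (m - k) = (y + t) %/ 2 ^ (m - k) ->
  dyadic t k x = dyadic t k y.
Proof.
rewrite /dyadic; move: (nat_of_ord x) (nat_of_ord y) => {}x {}y E.
have -> : 2 ^ m = 2 ^ (minn k m) * 2 ^ (m - k).
  by rewrite -expnD; congr (2 ^ _); rewrite minnE; lia.
by rewrite -!modn_divl E.
Qed.

Let rot m t (x : 'I_(2 ^ m)) : 'I_(2 ^ m) :=
  Ordinal (ltn_pmod (x + t) (expn_gt0 2 m)).

Let rot_inj m t : injective (@rot m t).
Proof.
move=> x y /(congr1 val)/= /eqP; rewrite eqn_modDr.
by rewrite !modn_small// => /eqP/val_inj.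
Qed.

Lemma card_dyadic_block m t k (x : 'I_(2 ^ m)) :
  #|block (dyadic t) k x| = 2 ^ (m - k).
Proof.
have -> : block (dyadic t) k x =
    @rot m t @^-1: [set u : 'I_(2 ^ m) | u %/ 2 ^ (m - k) == dyadic t k x]%SET.
  by apply/setP => y; rewrite !inE.
rewrite card_preimset; last exact: rot_inj.
have kpos : 0 < 2 ^ (m - k) by rewrite expn_gt0.
set j := m - k; set a := dyadic t k x.
have aj r : r < 2 ^ j -> a * 2 ^ j + r < 2 ^ m.
  move=> rj; have aE : a < 2 ^ (m - j).
    rewrite /a /dyadic -/j ltn_divLR// -expnD subnK ?ltn_pmod ?expn_gt0//.
    exact: leq_subr.
  have -> : 2 ^ m = 2 ^ (m - j) * 2 ^ j by rewrite -expnD subnK// leq_subr.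
  by rewrite (leq_trans (_ : _ < a.+1 * 2 ^ j))// ?leq_mul2r ?aE ?orbT//;
    rewrite mulSn addnC ltn_add2r.
pose e (r : 'I_(2 ^ j)) := Ordinal (aj r (ltn_ord r)).
have e_inj : injective e.
  by move=> r r' /(congr1 val)/= /addnI/val_inj.
rewrite -[RHS]card_ord -(card_imset _ e_inj); apply: eq_card => u.
rewrite inE; apply/eqP/imsetP => [uE|[r _ ->]] /=.
  exists (Ordinal (ltn_pmod u kpos)) => //; apply/val_inj => /=.
  by rewrite -uE -divn_eq.
by rewrite divnMDl// divn_small ?addn0.
Qed.

Lemma filtration_dyadic m t : filtration (@dyadic m t).
Proof.
split.
- move=> k x y; rewrite /dyadic; have [km|mk] := ltnP k m; last first.
    by rewrite (_ : m - k.+1 = m - k)//; lia.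
  have -> : m - k = (m - k.+1) + 1 by lia.
  by rewrite expnD !divnMA => ->.
- move=> x y; rewrite /dyadic subn0.
  by rewrite !divn_small// ltn_pmod// expn_gt0.
- move=> k x; rewrite !card_dyadic_block -expnS leq_exp2l//; lia.
Qed.

(** [(4 ^ m - 1) / 3]: in base two [1010...1], so that modulo [2 ^ j] it is
    about one or two thirds of [2 ^ j], for every [j <= 2 m]. *)
Fixpoint third m : nat := if m is k.+1 then 4 * third k + 1 else 0.

Lemma thirdE m : 3 * third m + 1 = 4 ^ m.
Proof. by elim: m => // m IH; rewrite expnS -IH /=; lia. Qed.

Lemma third_mod m j l : j <= m -> 3 * l + 1 <= 2 ^ j ->
  l <= third m %% 2 ^ j /\ third m %% 2 ^ j + l <= 2 ^ j.
Proof.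
move=> jm lj; have E := thirdE m.
have : 4 ^ m = 2 ^ j * 2 ^ (2 * m - j).
  by rewrite -[4]/(2 ^ 2) -expnM -expnD; congr (2 ^ _); lia.
rewrite -E; have := divn_eq (third m) (2 ^ j).
have : third m %% 2 ^ j < 2 ^ j by rewrite ltn_pmod// expn_gt0.
move: lj; move: (third m %% _) (third m %/ _) => s q.
move: (2 ^ j) (2 ^ (2 * m - j)) (third m) => D e t lD sD -> H.
have {}H : 3 * s + 1 + 3 * q * D = e * D by lia.
have qe : 3 * q < e by rewrite ltnNge; apply/negP => h; have := leq_mul h (leqnn D); lia.
have eq2 : e < 3 * q + 3.
  by rewrite ltnNge; apply/negP => h; have := leq_mul h (leqnn D); lia.
have [eE|eE] : e = 3 * q + 1 \/ e = 3 * q + 2 by lia.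
  by rewrite eE mulnDl in H; lia.
by rewrite eE mulnDl in H; lia.
Qed.

(** The translate by [third m] of a dyadic point of level [j] stays at distance at
    least about [2 ^ j / 3] from all dyadic points of that level, so that a
    shorter interval cannot be cut by both families. *)
Lemma interval_in_block m j a b x : j <= m -> a <= x < b ->
  3 * (b - a) + 1 <= 2 ^ j ->
  (forall y, a <= y < b -> y %/ 2 ^ j = x %/ 2 ^ j) \/
  (forall y, a <= y < b -> (y + third m) %/ 2 ^ j = (x + third m) %/ 2 ^ j).
Proof.
move=> jm /andP[ax xb] lj.
have D0 : 0 < 2 ^ j by rewrite expn_gt0.
have [E|nE] := eqVneq (a %/ 2 ^ j) (b.-1 %/ 2 ^ j).
  have H y : a <= y < b -> y %/ 2 ^ j = a %/ 2 ^ j.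
    move=> /andP[ay yb]; apply/eqP; rewrite eqn_leq; apply/andP; split.
      by rewrite E; apply: leq_div2r; lia.
    exact: leq_div2r.
  by left => y ay; rewrite (H y)// (H x)// ax.
right; have [s1 s2] := third_mod jm lj.
have H y : a <= y < b ->
    (y + third m) %/ 2 ^ j = third m %/ 2 ^ j + b.-1 %/ 2 ^ j.
  move=> /andP[ay yb].
  have ab : a < b.-1 %/ 2 ^ j * 2 ^ j.
    rewrite ltnNge -leq_divRL//; apply/negP => h; move/eqP: nE; apply.
    by apply/eqP; rewrite eqn_leq h andbT; apply: leq_div2r; lia.
  have := divn_eq b.-1 (2 ^ j); have := divn_eq (third m) (2 ^ j).
  move: s1 s2 ab.
  move: (third m %/ _) (third m %% _) (b.-1 %/ _) (b.-1 %% _) => q s c r.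
  move=> s1 s2 ac tE bE.
  have -> : y + third m = (q + c) * 2 ^ j + (y + s - c * 2 ^ j).
    by rewrite mulnDl; lia.
  by rewrite divnMDl// divn_small ?addn0//; lia.
by move=> y ay; rewrite (H y)// (H x)// ax.
Qed.

End dyadic_blocks.

Section rectangles.
Set Implicit Arguments.
Unset Strict Implicit.
Local Open Scope ring_scope.
Context {R : realType} (m : nat).
Notation T := 'I_(2 ^ m).

Definition dmax (f : T -> R) := max2 (dyadic 0) (dyadic (third m)) m f.

Lemma sum_block_le (t k : nat) (f : T -> R) (P : pred T) x (L : R) :
  (k <= m)%N -> (forall y, 0 <= f y) -> (2 ^ (m - k))%:R <= L ->
  (forall y, P y -> dyadic t k y = dyadic t k x) ->
  \sum_(y | P y) f y <= L * maxavg (dyadic t) m f x.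
Proof.
move=> km f0 kL HP.
apply: (@le_trans _ _ ((2 ^ (m - k))%:R * avg (dyadic t) k f x)).
  rewrite /avg card_dyadic_block mulrA mulfV ?mul1r; last first.
    by rewrite pnatr_eq0 -lt0n expn_gt0.
  rewrite [leRHS]big_mkcond/= [leLHS]big_mkcond/=; apply: ler_sum => y _.
  case: ifPn => [/HP/blockP -> //|_]; by case: ifP.
apply: ler_pM => //; first exact: avg_ge0.
apply: (le_trans (ler_norm _)).
exact: (rmax_ub (fun i => `|avg (dyadic t) i f x|)).
Qed.

Lemma sum_interval_le (f : T -> R) (a b : nat) (x : T) :
  (forall y, 0 <= f y) -> (a <= x < b)%N ->
  \sum_(y : T | (a <= y < b)%N) f y <= 6 * (b - a)%:R * dmax f x.
Proof.
move=> f0 axb; set l := (b - a)%N.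
have l0 : (0 < l)%N by rewrite /l; lia.
pose j := up_log 2 (3 * l + 1).
have jl : (3 * l + 1 <= 2 ^ j)%N by exact: up_logP.
have jl' : (2 ^ j <= 6 * l)%N.
  have : (2 ^ j.-1 < 3 * l + 1)%N by apply: up_log_gtn => //; lia.
  have : (0 < j)%N by rewrite up_log_gt0; lia.
  by case: (j) => // i _ /=; rewrite expnS; lia.
have L i : (i <= j)%N -> (2 ^ i)%:R <= 6 * l%:R :> R.
  move=> ij; rewrite -natrM ler_nat (leq_trans _ jl')// leq_exp2l//.
have M0 := maxavg_ge0 (dyadic 0) m f x.
have M1 := maxavg_ge0 (dyadic (third m)) m f x.
have l6 : 0 <= 6 * l%:R :> R by rewrite mulr_ge0.
have E0 (h : \sum_(y : T | (a <= y < b)%N) f y <=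
     6 * l%:R * maxavg (dyadic 0) m f x) :
    \sum_(y : T | (a <= y < b)%N) f y <= 6 * l%:R * dmax f x.
  by apply: (le_trans h); rewrite ler_wpM2l// lerDl.
have [jm|mj] := leqP j m; last first.
  apply: E0; apply: (@sum_block_le 0 0) => //.
    by rewrite subn0 L// ltnW.
  by move=> y _; exact: (filtration_trivial (filtration_dyadic m 0)).
have mj : (m - (m - j) = j)%N by lia.
have [H|H] := interval_in_block jm axb jl.
  apply: E0; apply: (@sum_block_le 0 (m - j)) => //.
  - exact: leq_subr.
  - by rewrite mj L.
  - by move=> y /H h; apply: dyadic_eq; rewrite !addn0 mj.
apply: (@le_trans _ _ (6 * l%:R * maxavg (dyadic (third m)) m f x)).
  apply: (@sum_block_le (third m) (m - j)) => //.
  - exact: leq_subr.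
  - by rewrite mj L.
  - by move=> y /H h; apply: dyadic_eq; rewrite mj.
by rewrite ler_wpM2l// lerDr.
Qed.

Lemma sum_tuple_cons (I : finType) n (P : pred (n.+1.-tuple I))
    (F : n.+1.-tuple I -> R) :
  \sum_(d | P d) F d =
  \sum_x \sum_(y : n.-tuple I | P [tuple of x :: y]) F [tuple of x :: y].
Proof.
rewrite (pair_big_dep xpredT (fun x (y : n.-tuple I) => P [tuple of x :: y])
  (fun x y => F [tuple of x :: y]))/=.
rewrite (reindex (fun xy : I * n.-tuple I => [tuple of xy.1 :: xy.2]))//=.
exists (fun d => (thead d, [tuple of behead d])) => [[x y] _|d _] /=.
  by congr pair => //; apply/val_inj.
by rewrite [RHS]tuple_eta; apply/val_inj.
Qed.

Definition dimax n := @itmax R T (dyadic 0) (dyadic (third m)) m n.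

(** One variable at a time, by [sum_interval_le]. *)
Lemma sum_rectangle_le n (f : n.-tuple T -> R) (a b : 'I_n -> nat)
    (c : n.-tuple T) (L : R) :
  (forall d, 0 <= f d) -> (forall i, (a i <= tnth c i < b i)%N) ->
  (forall i, (b i - a i)%:R <= L) ->
  \sum_(d : n.-tuple T | [forall i, a i <= tnth d i < b i]%N) f d <=
  (6 * L) ^+ n * dimax f c.
Proof.
elim: n f a b c => [|n IH] f a b c f0 abc abL.
  rewrite expr0 mul1r /dimax/= (bigD1 c)/=; last by apply/forallP => -[].
  by rewrite big1 ?addr0// => d /andP[_]; rewrite (tuple0 d) (tuple0 c) eqxx.
have L0 : 0 <= L by exact: le_trans (abL ord0).
have cE : c = [tuple of thead c :: behead c].
  by rewrite [LHS]tuple_eta; apply/val_inj.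
rewrite sum_tuple_cons.
pose F x := dimax (fun y => f [tuple of x :: y]) [tuple of behead c].
have F0 x : 0 <= F x by apply: itmax_ge0.
have step x : \sum_(y : n.-tuple T | [forall i, a i <=
      tnth [tuple of x :: y] i < b i]%N) f [tuple of x :: y] <=
    if (a ord0 <= x < b ord0)%N then (6 * L) ^+ n * F x else 0.
  case: ifPn => hx; last first.
    rewrite big1// => y /forallP/(_ ord0); rewrite (negbTE hx)//.
  have abc' i : (a (lift ord0 i) <= tnth [tuple of behead c] i <
      b (lift ord0 i))%N.
    have := abc (lift ord0 i); rewrite tnth_behead.
    by rewrite (_ : inord _ = lift ord0 i)//; apply/val_inj;
      rewrite /= inordK// ltnS.
  apply: le_trans (IH (fun y => f [tuple of x :: y]) _ _ _ (fun d => f0 _) abc'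
    (fun i => abL _)).
  rewrite [leLHS]big_mkcond [leRHS]big_mkcond/=; apply: ler_sum => y _.
  case: ifPn => [/forallP h|_]; last by case: ifP => _.
  rewrite ifT//; apply/forallP => i; have := h (lift ord0 i).
  by rewrite tnthS.
apply: (le_trans (ler_sum _ (fun x _ => step x))).
rewrite -big_mkcond/= -mulr_sumr exprS -mulrA [leRHS]mulrCA.
rewrite ler_wpM2l ?exprn_ge0 ?mulr_ge0//.
have h0 : (a ord0 <= thead c < b ord0)%N by exact: (abc ord0).
apply: (le_trans (sum_interval_le F0 h0)).
by rewrite ler_pM ?mulr_ge0 ?max2_ge0// ler_wpM2l.
Qed.

End rectangles.

(** * Integrals of functions that need not be Borel *)

Section lower_integral.
Set Implicit Arguments.
Unset Strict Implicit.
Context d (T : measurableType d) (R : realType).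
Variable mu : {measure set T -> \bar R}.
Implicit Types f g : T -> \bar R.

Import HBNNSimple.

(** The integral being a supremum over simple functions, the bounds of this part
    hold for every non-negative function; this is how maximal functions are
    integrated below. *)
Lemma integral_le_nnsfun f (c : \bar R) : (forall x, 0 <= f x) ->
  (forall h : {nnsfun T >-> R}, (forall x, (h x)%:E <= f x) ->
     \int[mu]_x (h x)%:E <= c) ->
  \int[mu]_x f x <= c.
Proof.
move=> f0 H; rewrite ge0_integralTE//; apply: ge_ereal_sup => _ [h hf <-].
by rewrite -integralT_nnsfun; exact: H.
Qed.

Lemma le_integral_ge0 f g : (forall x, 0 <= f x) -> (forall x, f x <= g x) ->
  \int[mu]_x f x <= \int[mu]_x g x.
Proof.
move=> f0 fg; apply: integral_le_nnsfun => // h hf.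
rewrite [leRHS]ge0_integralTE; last by move=> x; exact: le_trans (f0 x) (fg x).
apply: ereal_sup_ubound; exists h => /=; last by rewrite integralT_nnsfun.
by move=> x; exact: le_trans (hf x) (fg x).
Qed.

Lemma measurable_nnsfun_EFin (h : {nnsfun T >-> R}) :
  measurable_fun setT (fun x => (h x)%:E).
Proof. by apply/measurable_EFinP. Qed.

Lemma integralZ_le f (k : R) : (forall x, 0 <= f x) -> (0 < k)%R ->
  \int[mu]_x (k%:E * f x) <= k%:E * \int[mu]_x f x.
Proof.
move=> f0 k0; apply: integral_le_nnsfun => [x|h hf].
  by rewrite mule_ge0// lee_fin ltW.
have -> : \int[mu]_x (h x)%:E = k%:E * \int[mu]_x ((k^-1)%:E * (h x)%:E).
  rewrite -ge0_integralZl_EFin//=; last 3 first.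
  - by move=> x _; apply: mule_ge0; rewrite lee_fin ?invr_ge0 ?(ltW k0).
  - by apply: measurable_funeM; exact: measurable_nnsfun_EFin.
  - exact: ltW.
  apply: eq_integral => x _; rewrite -!EFinM mulrA mulfV ?mul1r//.
  exact: lt0r_neq0.
rewrite lee_pmul2l// ?lte_fin//; apply: le_integral_ge0 => x.
  by apply: mule_ge0; rewrite lee_fin ?invr_ge0 ?(ltW k0).
by rewrite lee_pdivrMl.
Qed.

Lemma integral_outside_null f (N : set T) : (forall x, 0 <= f x) ->
  measurable N -> mu N = 0 ->
  \int[mu]_x f x <= \int[mu]_x (f \_ (~` N)) x.
Proof.
move=> f0 mN N0; apply: integral_le_nnsfun => // h hf.
have mh := measurable_nnsfun_EFin h.
rewrite (@ge0_negligible_integral _ _ _ _ _ N)//; last by move=> x _; rewrite lee_fin.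
rewrite setTD integral_mkcond; apply: le_integral_ge0 => x.
  by rewrite /patch; case: ifP => // _; rewrite lee_fin.
by rewrite /patch; case: ifP.
Qed.

End lower_integral.

Section power_norms.
Set Implicit Arguments.
Unset Strict Implicit.
Context d (T : measurableType d) (R : realType).
Variable mu : {measure set T -> \bar R}.
Implicit Types (f g : T -> \bar R) (q : R).

Lemma le_poweR (x y : \bar R) q : (0 <= q)%R -> 0 <= x -> x <= y ->
  x `^ q <= y `^ q.
Proof.
move=> q0 x0 xy; apply: gt0_ler_poweR => //; rewrite in_itv/= leey andbT//.
exact: le_trans xy.
Qed.

Lemma poweR_KV (x : \bar R) q : q != 0%R -> 0 <= x -> (x `^ q) `^ q^-1 = x.
Proof. by move=> q0 x0; rewrite -poweRrM mulfV// poweRe1. Qed.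

Lemma poweRV_K (x : \bar R) q : q != 0%R -> 0 <= x -> (x `^ q^-1) `^ q = x.
Proof. by move=> q0 x0; rewrite -poweRrM mulVf// poweRe1. Qed.

Lemma LnormE q f : 'N[mu]_q%:E[f] = (\int[mu]_x `|f x| `^ q) `^ q^-1.
Proof. by rewrite unlock. Qed.

Lemma le_Lnorm (p : \bar R) f g : 0 < p -> (forall x, `|f x| <= `|g x|) ->
  'N[mu]_p[f] <= 'N[mu]_p[g].
Proof.
move=> p0 fg; case: p p0 => [q|_|//].
  rewrite lte_fin => q0; rewrite !LnormE.
  apply: le_poweR; first by rewrite invr_ge0 ltW.
    by apply: integral_ge0 => x _; exact: poweR_ge0.
  apply: le_integral_ge0 => x; first exact: poweR_ge0.
  by apply: le_poweR => //; exact: ltW.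
rewrite unlock; case: ifP => // _; apply: le_ess_sup.
exact: nearW.
Qed.

Lemma LnormZ_le (p : \bar R) f (k : R) : 0 < p -> (0 < k)%R ->
  'N[mu]_p[(fun x => k%:E * f x)] <= k%:E * 'N[mu]_p[f].
Proof.
move=> p0 k0; case: p p0 => [q|_|//].
  rewrite lte_fin => q0; rewrite !LnormE.
  have kq : 0 <= k%:E `^ q by exact: poweR_ge0.
  have kq0 : (0 < k `^ q)%R by exact: powR_gt0.
  have I0 : 0 <= \int[mu]_x `|f x| `^ q.
    by apply: integral_ge0 => x _; exact: poweR_ge0.
  have <- : (k%:E `^ q * \int[mu]_x `|f x| `^ q) `^ q^-1 =
            k%:E * (\int[mu]_x `|f x| `^ q) `^ q^-1.
    by rewrite poweRM// poweR_KV// ?gt_eqF// lee_fin ltW.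
  apply: le_poweR; first by rewrite invr_ge0 ltW.
    by apply: integral_ge0 => x _; exact: poweR_ge0.
  have -> : \int[mu]_x `|k%:E * f x| `^ q =
            \int[mu]_x ((k `^ q)%:E * `|f x| `^ q).
    apply: eq_integral => x _; rewrite abseM poweRM//.
    by rewrite gee0_abs ?lee_fin ?ltW.
  by apply: integralZ_le => // x; exact: poweR_ge0.
rewrite unlock; case: ifP => [mu0|_]; last by rewrite mule0.
rewrite -ess_sup_pZl//; apply: le_ess_sup; apply: nearW => x /=.
by rewrite abseM gee0_abs// lee_fin ltW.
Qed.

Lemma limn_einf_lub (u : nat -> \bar R) (y : \bar R) :
  (forall k, einfs u k <= y) -> limn_einf u <= y.
Proof.
move=> H; rewrite limn_einf_lim; apply: lime_le; first exact: is_cvg_einfs.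
exact: nearW.
Qed.

Lemma limn_einf_glb (u : nat -> \bar R) (y : \bar R) n :
  (forall k, (n <= k)%N -> y <= u k) -> y <= limn_einf u.
Proof.
move=> H; rewrite limn_einf_lim; apply: (@le_trans _ _ (einfs u n)).
  by apply: le_ereal_inf_tmp => _ [k nk <-]; exact: H.
apply: lime_ge; first exact: is_cvg_einfs.
by exists n => // k nk; apply: nondecreasing_einfs.
Qed.

Lemma einfs_ge0 (u : nat -> \bar R) k : (forall k, 0 <= u k) -> 0 <= einfs u k.
Proof. by move=> u0; apply: le_ereal_inf_tmp => _ [j _ <-]. Qed.

Lemma limn_einf_ge0 (u : nat -> \bar R) : (forall k, 0 <= u k) -> 0 <= limn_einf u.
Proof. by move=> u0; apply: (@limn_einf_glb _ _ 0%N). Qed.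

Lemma einfs_le_limn_einf (u : nat -> \bar R) k : einfs u k <= limn_einf u.
Proof.
apply: (@limn_einf_glb _ _ k) => j kj; apply: ereal_inf_lbound.
by exists j.
Qed.

Lemma le_limn_einf (u w : nat -> \bar R) : (forall k, u k <= w k) ->
  limn_einf u <= limn_einf w.
Proof.
move=> uw; apply: limn_einf_lub => k; apply: le_trans (einfs_le_limn_einf w k).
apply: le_ereal_inf_tmp => _ [j kj <-]; apply: le_trans (uw j).
by apply: ereal_inf_lbound; exists j.
Qed.

Lemma poweR_limn_einf (u : nat -> \bar R) q : (0 < q)%R -> (forall k, 0 <= u k) ->
  (limn_einf u) `^ q <= limn_einf (fun k => u k `^ q).
Proof.
move=> q0 u0; set y := limn_einf (fun k => u k `^ q).
have qn0 : q != 0%R by rewrite gt_eqF.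
have y0 : 0 <= y by apply: limn_einf_ge0 => k; exact: poweR_ge0.
suff H : limn_einf u <= y `^ q^-1.
  rewrite -(poweRV_K qn0 y0); apply: le_poweR => //; first exact: ltW.
  exact: limn_einf_ge0.
apply: limn_einf_lub => k; rewrite -[leLHS](poweR_KV qn0); last exact: einfs_ge0.
apply: le_poweR; [by rewrite invr_ge0 ltW|exact: poweR_ge0|].
apply: le_trans (einfs_le_limn_einf _ k).
apply: le_ereal_inf_tmp => _ [j kj <-]; apply: le_poweR; first exact: ltW.
  exact: einfs_ge0.
by apply: ereal_inf_lbound; exists j.
Qed.

Lemma fatou_Lnorm q (f : nat -> T -> \bar R) : (0 < q)%R ->
  (forall k, measurable_fun setT (f k)) -> (forall k x, 0 <= f k x) ->
  'N[mu]_q%:E[(fun x => limn_einf (f ^~ x))] <=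
  limn_einf (fun k => 'N[mu]_q%:E[f k]).
Proof.
move=> q0 mf f0; have q0' : (0 < q^-1)%R by rewrite invr_gt0.
have I0 k : 0 <= \int[mu]_x `|f k x| `^ q.
  by apply: integral_ge0 => x _; exact: poweR_ge0.
rewrite LnormE; under [X in _ <= limn_einf X]eq_fun do rewrite LnormE.
apply: le_trans (poweR_limn_einf q0' I0); apply: le_poweR; first exact: ltW.
  by apply: integral_ge0 => x _; exact: poweR_ge0.
apply: (@le_trans _ _ (\int[mu]_x limn_einf (fun k => `|f k x| `^ q))).
  apply: le_integral_ge0 => x; first exact: poweR_ge0.
  rewrite gee0_abs; last exact: limn_einf_ge0.
  apply: (le_trans (poweR_limn_einf q0 (fun k => f0 k x))).
  by apply: le_limn_einf => k; rewrite gee0_abs.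
apply: fatou => //.
- move=> k; apply: (measurableT_comp (measurable_poweR _)).
  exact: measurableT_comp.
- by move=> k x _; exact: poweR_ge0.
Qed.

Lemma poweR_maxe (x y : \bar R) q : (0 <= q)%R -> 0 <= x -> 0 <= y ->
  (maxe x y) `^ q <= x `^ q + y `^ q.
Proof.
move=> q0 x0 y0; rewrite /maxe; case: ifP => _.
  by rewrite leeDr// poweR_ge0.
by rewrite leeDl// poweR_ge0.
Qed.

Lemma leeD_max (x y : \bar R) : x + y <= 2%:E * maxe x y.
Proof.
rewrite (_ : 2%:E = 1 + 1); last by rewrite -EFinD.
rewrite ge0_muleDl// !mul1e.
by apply: leeD; rewrite le_max lexx ?orbT.
Qed.

(** Through [f + g <= 2 max(f, g)], used for the functions and for the integrals;
    a constant in the triangle inequality is harmless here. *)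
Lemma Lnorm_addition_le q f g : (1 < q)%R ->
  measurable_fun setT f -> measurable_fun setT g ->
  (forall x, 0 <= f x) -> (forall x, 0 <= g x) ->
  'N[mu]_q%:E[(fun x => f x + g x)] <= 4%:E * ('N[mu]_q%:E[f] + 'N[mu]_q%:E[g]).
Proof.
move=> q1 mf mg f0 g0; have q0 : (0 < q)%R by exact: lt_trans q1.
have q0' : (0 < q^-1)%R by rewrite invr_gt0.
have m0 x : 0 <= maxe (f x) (g x) by rewrite le_max f0.
have mq (h : T -> \bar R) : measurable_fun setT h ->
    measurable_fun setT (fun x => `|h x| `^ q).
  move=> mh; apply: (measurableT_comp (measurable_poweR _)).
  exact: measurableT_comp.
apply: (@le_trans _ _ (2%:E * 'N[mu]_q%:E[(fun x => maxe (f x) (g x))])).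
  apply: le_trans (LnormZ_le _ _ _) => //.
  apply: le_Lnorm => // x; rewrite !gee0_abs ?mule_ge0 ?adde_ge0//.
  exact: leeD_max.
rewrite (_ : 4%:E = 2%:E * 2%:E); last by rewrite -EFinM -natrM.
rewrite -muleA lee_pmul2l// !LnormE.
set F := \int[mu]_x `|f x| `^ q; set G := \int[mu]_x `|g x| `^ q.
have F0 : 0 <= F by apply: integral_ge0 => x _; exact: poweR_ge0.
have G0 : 0 <= G by apply: integral_ge0 => x _; exact: poweR_ge0.
apply: (@le_trans _ _ ((F + G) `^ q^-1)).
  apply: le_poweR; first exact: ltW.
    by apply: integral_ge0 => x _; exact: poweR_ge0.
  rewrite /F /G -ge0_integralD//; [|by move=> x _; exact: poweR_ge0|exact: mq|
    by move=> x _; exact: poweR_ge0|exact: mq].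
  apply: le_integral_ge0 => x; first exact: poweR_ge0.
  rewrite !gee0_abs//; exact: poweR_maxe (ltW q0) (f0 x) (g0 x).
apply: (@le_trans _ _ ((2%:E * maxe F G) `^ q^-1)).
  apply: le_poweR; [exact: ltW|exact: adde_ge0|exact: leeD_max].
have M0 : 0 <= maxe F G by rewrite le_max F0.
rewrite poweRM//; apply: lee_pmul; rewrite ?poweR_ge0//.
  rewrite poweR_EFin lee_fin ler1_powR ?ler1n// invf_le1 ?(ltW q1)//.
exact: poweR_maxe (ltW q0') F0 G0.
Qed.

End power_norms.

(** * Mixed norms *)

Section mixed_norm_theory.
Set Implicit Arguments.
Unset Strict Implicit.
Context {R : realType}.

Lemma mixed_norm_ge0 n (p : n.-tuple (\bar R)) f : 0 <= mixed_norm p f.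
Proof. by elim: n p f => [|n IH] p f /=; [exact: abse_ge0|exact: IH]. Qed.

Lemma mixed_norm_le n (p : n.-tuple (\bar R)) (f g : Rn R n -> \bar R) :
  good_exponents p -> (forall x, `|f x| <= `|g x|) ->
  mixed_norm p f <= mixed_norm p g.
Proof.
elim: n p f g => [|n IH] p f g hp fg /=; first exact: fg.
apply: IH => [|y]; first exact: good_exponents_behead.
rewrite !gee0_abs ?Lnorm_ge0//; have [q q1 ->] := good_exponents_thead hp.
by apply: le_Lnorm => //; rewrite lte_fin (lt_trans ltr01).
Qed.

Lemma mixed_normZ_le n (p : n.-tuple (\bar R)) (f : Rn R n -> \bar R) (k : R) :
  good_exponents p -> (0 < k)%R ->
  mixed_norm p (fun x => k%:E * f x) <= k%:E * mixed_norm p f.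
Proof.
elim: n p f => [|n IH] p f hp k0 /=.
  by rewrite abseM gee0_abs// lee_fin ltW.
have hp' := good_exponents_behead hp.
apply: le_trans (IH _ _ hp' k0); apply: mixed_norm_le => // y.
have [q q1 ->] := good_exponents_thead hp.
rewrite !gee0_abs ?mule_ge0 ?Lnorm_ge0 ?lee_fin ?(ltW k0)//.
by apply: LnormZ_le => //; rewrite lte_fin (lt_trans ltr01).
Qed.

Lemma measurable_section n (f : Rn R n.+1 -> \bar R) (y : Rn R n) :
  measurable_fun setT f ->
  measurable_fun setT (fun x : measurableTypeR R => f (tcons (x, y))).
Proof.
move=> mf; apply: (measurableT_comp (f := f \o @tcons R n)).
  by apply: measurableT_comp => //; exact: measurable_tcons.
exact: measurable_pair2.
Qed.

Lemma measurable_Lnorm_section n (f : Rn R n.+1 -> \bar R) (q : R) :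
  measurable_fun setT f ->
  measurable_fun setT (fun y : Rn R n =>
    'N[lebesgue_measure]_q%:E[(fun x => f (tcons (x, y)))]).
Proof.
move=> mf; under eq_fun do rewrite LnormE.
apply: (measurableT_comp (measurable_poweR _)).
pose g (xy : measurableTypeR R * Rn R n) := `|f (tcons xy)| `^ q.
apply: (@measurable_fun_fubini_tonelli_G _ _ _ _ R lebesgue_measure g).
  apply: (measurableT_comp (measurable_poweR _)).
  apply: measurableT_comp => //; apply: measurableT_comp => //.
  exact: measurable_tcons.
by move=> xy; exact: poweR_ge0.
Qed.

Lemma integral_lebRnS n (g : Rn R n.+1 -> \bar R) :
  measurable_fun setT g -> (forall x, 0 <= g x) ->
  \int[@lebRn R n.+1]_z g z =
  \int[@lebRn R n]_y \int[lebesgue_measure]_x g (tcons (x, y)).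
Proof.
move=> mg g0; transitivity
  (\int[lebesgue_measure \x @lebRn R n]_z (g \o @tcons R n) z).
  rewrite -(@preimage_setT _ _ (@tcons R n)).
  exact: (@ge0_integral_pushforward _ _ _ _ R (@tcons R n)
    (@measurable_tcons R n) (lebesgue_measure \x @lebRn R n) setT g
    measurableT mg (fun y _ => g0 y)).
apply: fubini_tonelli2 => [|x]; last exact: g0.
by apply: measurableT_comp => //; exact: measurable_tcons.
Qed.

Lemma fatou_mixed_norm n (p : n.-tuple (\bar R)) (f : nat -> Rn R n -> \bar R) :
  good_exponents p -> (forall k, measurable_fun setT (f k)) ->
  (forall k x, 0 <= f k x) ->
  mixed_norm p (fun x => limn_einf (f ^~ x)) <=
  limn_einf (fun k => mixed_norm p (f k)).
Proof.
elim: n p f => [|n IH] p f hp mf f0 /=.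
  rewrite gee0_abs; last exact: limn_einf_ge0.
  by apply: le_limn_einf => k; rewrite gee0_abs.
have hp' := good_exponents_behead hp.
have [q q1 ->] := good_exponents_thead hp.
pose g k (y : Rn R n) := 'N[lebesgue_measure]_q%:E[(fun x => f k (tcons (x, y)))].
have g0 k y : 0 <= g k y by exact: Lnorm_ge0.
have mg k : measurable_fun setT (g k) by exact: measurable_Lnorm_section.
apply: le_trans (IH _ _ hp' mg g0); apply: mixed_norm_le => // y.
rewrite !gee0_abs ?Lnorm_ge0//; last exact: limn_einf_ge0.
apply: fatou_Lnorm => //; first by rewrite (lt_trans ltr01).
by move=> k; exact: measurable_section.
Qed.

(** The constant of [Lnorm_addition_le] appears once for each variable. *)
Lemma mixed_norm_addition_le n (p : n.-tuple (\bar R)) (f g : Rn R n -> \bar R) :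
  good_exponents p -> measurable_fun setT f -> measurable_fun setT g ->
  (forall x, 0 <= f x) -> (forall x, 0 <= g x) ->
  mixed_norm p (fun x => f x + g x) <=
  (4 ^+ n)%:E * (mixed_norm p f + mixed_norm p g).
Proof.
elim: n p f g => [|n IH] p f g hp mf mg f0 g0 /=.
  by rewrite expr0 mul1e !gee0_abs ?adde_ge0.
have hp' := good_exponents_behead hp.
have [q q1 ->] := good_exponents_thead hp.
pose F (h : Rn R n.+1 -> \bar R) (y : Rn R n) :=
  'N[lebesgue_measure]_q%:E[(fun x => h (tcons (x, y)))].
have F0 h y : 0 <= F h y by exact: Lnorm_ge0.
have mF h : measurable_fun setT h -> measurable_fun setT (F h).
  by move=> mh; exact: measurable_Lnorm_section.
rewrite exprS EFinM -muleA.
have := IH [tuple of behead p] (F f) (F g) hp' (mF _ mf) (mF _ mg) (F0 f) (F0 g).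
move=> H; apply: (@le_trans _ _ (4%:E *
    mixed_norm [tuple of behead p] (fun y => F f y + F g y))); last first.
  by rewrite lee_pmul2l.
apply: le_trans (mixed_normZ_le _ hp' _) => //.
apply: mixed_norm_le => // y.
rewrite !gee0_abs ?mule_ge0 ?adde_ge0 ?F0 ?Lnorm_ge0//.
by apply: Lnorm_addition_le => //; exact: measurable_section.
Qed.

End mixed_norm_theory.

(** * Hoelder's and Minkowski's inequalities for integrals *)

Section holder_pairing.
Set Implicit Arguments.
Unset Strict Implicit.
Context d (T : measurableType d) (R : realType).
Variable mu : {measure set T -> \bar R}.

Lemma young_EFin (a A B q : R) (y : \bar R) : (1 < q)%R -> (0 <= a)%R ->
  (0 < A)%R -> (0 < B)%R -> 0 <= y ->
  a%:E * y <= (A * B / (q / (q - 1)) / A `^ (q / (q - 1)))%:E *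
                (a `^ (q / (q - 1)))%:E +
              (A * B / q / B `^ q)%:E * y `^ q.
Proof.
move=> q1 a0 A0 B0; have q0 : (0 < q)%R by exact: lt_trans q1.
have q'0 := conj_gt0 q1.
have c1 : (0 <= A * B / (q / (q - 1)) / A `^ (q / (q - 1)))%R.
  by rewrite divr_ge0 ?powR_ge0// divr_ge0 ?(ltW q'0)// mulr_ge0// ltW.
have c2 : (0 < A * B / q / B `^ q)%R.
  by rewrite !divr_gt0 ?mulr_gt0 ?powR_gt0.
case: y => [y||//]; last first.
  move=> _; rewrite poweRyr ?gt_eqF// [X in _ + X]gt0_muley ?lte_fin//.
  by rewrite addey ?leey.
rewrite lee_fin => y0; rewrite poweR_EFin -!EFinM -EFinD lee_fin.
have pq : ((q / (q - 1))^-1 + q^-1 = 1)%R by rewrite addrC conj_exponent.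
have := young_scaled a0 y0 (powR_gt0 (q / (q - 1)) A0) (powR_gt0 q B0) q'0 q0 pq.
rewrite (powR_KV _ (ltW A0)) ?(powR_KV _ (ltW B0)) ?(lt0r_neq0 q0)//; last first.
  exact: lt0r_neq0.
move=> /le_trans; apply; rewrite le_eqVlt; apply/orP; left; apply/eqP; ring.
Qed.

(** Young's inequality is integrated with the scaling that makes it sharp; the
    [e > 0] added to the norm of [G] keeps the scaling factor positive. *)
Lemma holder_pairing (q A : R) (u : T -> R) (G : T -> \bar R) :
  (1 < q)%R -> (0 < A)%R ->
  measurable_fun setT u -> (forall x, (0 <= u x)%R) ->
  measurable_fun setT G -> (forall x, 0 <= G x) ->
  \int[mu]_x (u x `^ (q / (q - 1)))%:E <= (A `^ (q / (q - 1)))%:E ->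
  \int[mu]_x ((u x)%:E * G x) <= A%:E * 'N[mu]_q%:E[G].
Proof.
move=> q1 A0 mu' u0 mG G0 uA; have q0 : (0 < q)%R by exact: lt_trans q1.
have q'0 := conj_gt0 q1.
have N0 : 0 <= 'N[mu]_q%:E[G] by exact: Lnorm_ge0.
have [Noo|Nfin] := eqVneq 'N[mu]_q%:E[G] +oo.
  by rewrite Noo gt0_muley ?lte_fin// leey.
have Nfn : 'N[mu]_q%:E[G] \is a fin_num by rewrite ge0_fin_numE// ltey.
suff H (e : R) : (0 < e)%R ->
    \int[mu]_x ((u x)%:E * G x) <= A%:E * ('N[mu]_q%:E[G] + e%:E).
  apply/lee_addgt0Pr => e e0; apply: (le_trans (H (e / A)%R _)).
    by rewrite divr_gt0.
  rewrite muleDr// ?fin_num_adde_defr// -EFinM mulrC divfK ?gt_eqF//.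
move=> e0; set N := fine 'N[mu]_q%:E[G].
have N0' : (0 <= N)%R by rewrite fine_ge0.
pose B := (N + e)%R; have B0 : (0 < B)%R by rewrite ltr_wpDl.
have -> : 'N[mu]_q%:E[G] + e%:E = B%:E by rewrite EFinD fineK.
have mG' : measurable_fun setT (fun x => G x `^ q).
  exact: (measurableT_comp (measurable_poweR _)).
have mu'' : measurable_fun setT (fun x => (u x `^ (q / (q - 1)))%:E).
  by apply/measurable_EFinP; exact: (measurableT_comp (measurable_powR _)).
have IG : \int[mu]_x G x `^ q <= (B `^ q)%:E.
  have -> : \int[mu]_x G x `^ q = 'N[mu]_q%:E[G] `^ q.
    rewrite poweR_Lnorm ?gt_eqF//; apply: eq_integral => x _.
    by rewrite gee0_abs.
  rewrite -poweR_EFin; apply: le_poweR; [exact: ltW|exact: N0|].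
  by rewrite -(fineK Nfn) lee_fin lerDl ltW.
set c1 := (A * B / (q / (q - 1)) / A `^ (q / (q - 1)))%R.
set c2 := (A * B / q / B `^ q)%R.
have c10 : (0 <= c1)%R by rewrite divr_ge0 ?powR_ge0// divr_ge0 ?(ltW q'0)// mulr_ge0// ltW.
have c20 : (0 <= c2)%R by rewrite divr_ge0 ?powR_ge0// divr_ge0 ?(ltW q0)// mulr_ge0// ltW.
apply: (@le_trans _ _ (\int[mu]_x
    (c1%:E * (u x `^ (q / (q - 1)))%:E + c2%:E * G x `^ q))).
  apply: le_integral_ge0 => x; first by rewrite mule_ge0// lee_fin.
  exact: young_EFin.
rewrite ge0_integralD//; last 4 first.
- by move=> x _; rewrite -EFinM lee_fin mulr_ge0// powR_ge0.
- exact: measurable_funeM.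
- by move=> x _; rewrite mule_ge0 ?poweR_ge0 ?lee_fin.
- exact: measurable_funeM.
rewrite !ge0_integralZl_EFin//; last 2 first.
- by move=> x _; exact: poweR_ge0.
- by move=> x _; rewrite lee_fin powR_ge0.
apply: (@le_trans _ _ (c1%:E * (A `^ (q / (q - 1)))%:E + c2%:E * (B `^ q)%:E)).
  by apply: leeD; apply: lee_wpmul2l; rewrite ?lee_fin.
rewrite -!EFinM -EFinD lee_fin /c1 /c2.
rewrite !divfK ?gt_eqF ?powR_gt0// -mulrDr [X in (_ * X)%R]addrC.
by rewrite conj_exponent// mulr1.
Qed.

End holder_pairing.

Section minkowski_integral.
Set Implicit Arguments.
Unset Strict Implicit.
Context d (T : measurableType d) (R : realType).
Variable mu : {measure set T -> \bar R}.

Lemma powR_cancel (s q : R) (X : \bar R) : (1 < q)%R -> (0 < s)%R ->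
  (s `^ q)%:E <= (s `^ (q - 1))%:E * X -> s%:E <= X.
Proof.
move=> q1 s0; rewrite -mulr_powRB1 ?(ltW s0) ?(lt_trans _ q1)// mulrC EFinM.
by rewrite lee_pmul2l// lte_fin powR_gt0.
Qed.

Definition lv v (f : nat -> \bar R) : \bar R := (\sum_(0 <= j <oo) f j `^ v) `^ v^-1.

Lemma lvE v (f : nat -> \bar R) : (0 < v)%R -> (forall j, 0 <= f j) ->
  lv v f = 'N[counting]_v%:E[f].
Proof.
move=> v0 f0; rewrite Lnorm_counting//; congr (_ `^ _).
by apply: eq_eseriesr => j _; rewrite gee0_abs.
Qed.

Lemma lv_le v (f g : nat -> \bar R) : (0 < v)%R -> (forall j, 0 <= f j) ->
  (forall j, f j <= g j) -> lv v f <= lv v g.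
Proof.
move=> v0 f0 fg; apply: le_poweR; first by rewrite invr_ge0 ltW.
  by apply: nneseries_ge0 => j _ _; exact: poweR_ge0.
apply: lee_nneseries => [j _ _|j _]; first exact: poweR_ge0.
by apply: le_poweR => //; exact: ltW.
Qed.

Lemma lv_ge0 v (f : nat -> \bar R) : 0 <= lv v f.
Proof. exact: poweR_ge0. Qed.

Lemma le_lv v (f : nat -> \bar R) j : (0 < v)%R -> (forall j, 0 <= f j) ->
  f j <= lv v f.
Proof.
move=> v0 f0; have vn0 : v != 0%R by rewrite gt_eqF.
rewrite -[leLHS](poweR_KV vn0)//; apply: le_poweR.
- by rewrite invr_ge0 ltW.
- exact: poweR_ge0.
apply: le_trans (nneseries_lim_ge j.+1 (fun i _ _ => poweR_ge0 (f i) v)).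
by rewrite big_nat_recr//= leeDr// sume_ge0// => i _; exact: poweR_ge0.
Qed.

Lemma measurable_lv v (f : nat -> T -> \bar R) :
  (forall j, measurable_fun setT (f j)) ->
  measurable_fun setT (fun x => lv v (f ^~ x)).
Proof.
move=> mf; apply: (measurableT_comp (measurable_poweR _)).
apply: ge0_emeasurable_sum => [j x _ _|j _]; first exact: poweR_ge0.
exact: (measurableT_comp (measurable_poweR _)).
Qed.

(** Minkowski's integral inequality for [l^v], in a form adapted to finitely
    many real lower bounds of the integrals. *)
Lemma lpnorm_le_integral_lv (v kappa : R) J (phi : 'I_J -> R)
    (f : nat -> T -> \bar R) :
  (1 < v)%R -> (0 <= kappa)%R -> (forall j, (0 <= phi j)%R) ->
  (forall j, measurable_fun setT (f j)) -> (forall j x, 0 <= f j x) ->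
  (forall j, (phi j)%:E <= kappa%:E * \int[mu]_x f j x) ->
  (lpnorm 1 v phi)%:E <= kappa%:E * \int[mu]_x lv v (f ^~ x).
Proof.
move=> v1 k0 phi0 mf f0 H; have v0 : (0 < v)%R by exact: lt_trans v1.
have lv0 x : 0 <= lv v (f ^~ x) by exact: lv_ge0.
set s := lpnorm 1 v phi; have s0 : (0 <= s)%R by exact: lpnorm_ge0.
have [->|sn0] := eqVneq s 0%R; first by rewrite mule_ge0// ?lee_fin// integral_ge0.
have {sn0} sp : (0 < s)%R by rewrite lt_neqAle eq_sym sn0.
have sE : (s `^ v = \sum_j phi j `^ v)%R.
  by rewrite lpnorm_powR ?ltr01// mul1r sum_powR_norm.
apply: (powR_cancel v1 sp).
have p0 j : (0 <= phi j `^ (v - 1))%R by exact: powR_ge0.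
apply: (@le_trans _ _ (kappa%:E *
    \int[mu]_x (\sum_j ((phi j `^ (v - 1))%:E * f j x)))).
  rewrite ge0_integral_sum//; last 2 first.
  - by move=> j; exact: measurable_funeM.
  - by move=> j x _; rewrite mule_ge0// lee_fin.
  rewrite sE -sumEFin ge0_sume_distrr; last first.
    move=> j _; apply: integral_ge0 => x _.
    by rewrite mule_ge0// lee_fin.
  apply: lee_sum => j _; rewrite ge0_integralZl_EFin// muleCA.
  rewrite -[X in X%:E <= _](@mulr_powRB1 _ _ v)// mulrC EFinM.
  by apply: lee_wpmul2l; rewrite ?lee_fin.
rewrite muleCA; apply: lee_wpmul2l; rewrite ?lee_fin//.
rewrite -ge0_integralZl_EFin ?powR_ge0//; last exact: measurable_lv.
apply: le_integral_ge0 => x.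
  by apply: sume_ge0 => j _; rewrite mule_ge0// lee_fin.
rewrite lvE//.
pose u (j : nat) : R := if insub j is Some i then (phi i `^ (v - 1))%R else 0%R.
have u0 j : (0 <= u j)%R by rewrite /u; case: insub.
have Su (w : nat -> \bar R) (c : 'I_J -> \bar R) : (forall j, 0 <= w j) ->
    (forall j : 'I_J, w j = c j) -> (forall j, (J <= j)%N -> w j = 0) ->
    \int[counting]_j w j = \sum_j c j.
  move=> w0 wc wJ; rewrite ge0_integral_count// (nneseries_split 0 J)//.
  rewrite add0n eseries0 ?adde0 => [|j Jj _]; last exact: wJ.
  by rewrite big_mkord; apply: eq_bigr => j _.
have uE (j : 'I_J) : u j = (phi j `^ (v - 1))%R by rewrite /u valK.
have uJ j : (J <= j)%N -> u j = 0%R.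
  by move=> Jj; rewrite /u insubF// ltnNge Jj.
rewrite -(Su (fun j => (u j)%:E * f j x)); last 3 first.
- by move=> j; rewrite mule_ge0// lee_fin.
- by move=> j; rewrite uE.
- by move=> j /uJ ->; rewrite mul0e.
apply: holder_pairing => //; first by rewrite powR_gt0.
rewrite (Su _ (fun j => (phi j `^ v)%:E)).
- by rewrite powR_conj// sumEFin -sE.
- by move=> j; rewrite lee_fin powR_ge0.
- by move=> j; rewrite uE powR_conj.
- by move=> j /uJ ->; rewrite powR0// gt_eqF// conj_gt0.
Qed.

End minkowski_integral.

(** * Grids of cubes *)

Section grids.
Set Implicit Arguments.
Unset Strict Implicit.
Context {R : realType} (o h : R) (L : nat).
Hypothesis h0 : (0 < h)%R.
Notation T := 'I_L.

(* In each direction the grid consists of [L] half-open cells of length [h]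
   starting at [o], so that every point is in at most one cube. *)

Definition incell (a : nat) (x : R) :=
  (o + a%:R * h <= x < o + a.+1%:R * h)%R.

Definition incube n (c : n.-tuple T) (x : Rn R n) :=
  [forall i, incell (tnth c i) (tnth x i)].

Lemma incell_inj a b x : incell a x -> incell b x -> a = b.
Proof.
have H u v : incell u x -> incell v x -> (u <= v)%N.
  move=> /andP[u1 _] /andP[_ v2]; have := le_lt_trans u1 v2.
  by rewrite ltrD2l ltr_pM2r// ltr_nat ltnS.
by move=> ax bx; apply/eqP; rewrite eqn_leq !H.
Qed.

Lemma incube_inj n (c d : n.-tuple T) x : incube c x -> incube d x -> c = d.
Proof.
move=> /forallP cx /forallP dx; apply/eq_from_tnth => i; apply/val_inj.
exact: incell_inj (cx i) (dx i).
Qed.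

Lemma incube_cons n a (d : n.-tuple T) x (y : Rn R n) :
  incube [tuple of a :: d] (tcons (x, y)) = incell a x && incube d y.
Proof.
apply/forallP/andP => [H|[ax /forallP dy] i].
  split; first by have := H ord0; rewrite !tnth0.
  by apply/forallP => i; have := H (lift ord0 i); rewrite !tnthS.
case: (unliftP ord0 i) => [j ->|->]; first by rewrite !tnthS.
by rewrite !tnth0.
Qed.

Lemma incube_tnil (c : 0.-tuple T) x : incube c x.
Proof. by apply/forallP => -[]. Qed.

Lemma measurable_incell a : measurable_fun setT (fun x : measurableTypeR R => (incell a x)).
Proof.
apply: (measurable_fun_bool true).
rewrite setTI (_ : _ @^-1` _ = `[(o + a%:R * h)%R, (o + a.+1%:R * h)%R[%classic)//.
Qed.

Lemma measurable_incube n (c : n.-tuple T) : measurable_fun setT (incube c).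
Proof.
apply: (measurable_fun_bool true); rewrite setTI.
rewrite (_ : _ @^-1` _ = \big[setI/setT]_(i < n)
    ((fun x : Rn R n => incell (tnth c i) (tnth x i)) @^-1` [set true])).
  apply: bigsetI_measurable => i _; rewrite -[X in measurable X]setTI.
  have H : measurable_fun setT (fun x : Rn R n => incell (tnth c i) (tnth x i)).
    apply: (measurableT_comp (measurable_incell _)); exact: measurable_tnth.
  exact: H.
rewrite -bigcap_seq; apply/seteqP; split => x /=.
  by move=> /forallP H i _; exact: H.
by move=> H; apply/forallP => i; apply: H; rewrite /= mem_index_enum.
Qed.

Lemma measurable_indicator d (U : measurableType d) (P : U -> bool) :
  measurable_fun setT P -> measurable_fun setT (fun x => (P x)%:R%:E : \bar R).
Proof.
move=> mP; apply/measurable_EFinP.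
by apply: (measurableT_comp (f := fun b : bool => b%:R : R)).
Qed.

Lemma integral_incell (a : nat) :
  \int[lebesgue_measure]_x ((incell a x)%:R%:E : \bar R) = h%:E.
Proof.
transitivity (\int[lebesgue_measure]_x
    ((\1_(`[(o + a%:R * h)%R, (o + a.+1%:R * h)%R[%classic : set R) x)%:E : \bar R)).
  by apply: eq_integral => x _; rewrite indicE mem_setE in_itv.
rewrite integral_indic// setIT.
rewrite [LHS](@lebesgue_measure_itv R
  `[(o + a%:R * h)%R, (o + a.+1%:R * h)%R[)/= lte_fin.
rewrite ltrD2l ltr_pM2r// ltr_nat ltnSn -EFinB.
by congr EFin; rewrite -natr1; ring.
Qed.

Definition step n (phi : n.-tuple T -> R) (x : Rn R n) : R :=
  (\sum_c phi c * (incube c x)%:R)%R.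

Lemma step_in n (phi : n.-tuple T -> R) c x : incube c x -> step phi x = phi c.
Proof.
move=> cx; rewrite /step (bigD1 c)//= cx mulr1 big1 ?addr0// => d dc.
case dx : (incube d x); last by rewrite mulr0.
by rewrite (incube_inj dx cx) eqxx in dc.
Qed.

Lemma step_out n (phi : n.-tuple T -> R) x : (forall c, ~~ incube c x) ->
  step phi x = 0%R.
Proof. by move=> H; rewrite /step big1// => c _; rewrite (negbTE (H c)) mulr0. Qed.

Lemma step_ge0 n (phi : n.-tuple T -> R) x : (forall c, (0 <= phi c)%R) ->
  (0 <= step phi x)%R.
Proof. by move=> phi0; apply: sumr_ge0 => c _; rewrite mulr_ge0. Qed.

Lemma measurable_step n (phi : n.-tuple T -> R) :
  measurable_fun setT (fun x => (step phi x)%:E).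
Proof.
apply/measurable_EFinP; apply: measurable_sum => c.
apply: measurable_funM => //; apply/measurable_EFinP.
exact: (measurable_indicator (measurable_incube c)).
Qed.

(** In the first variable the integral is a sum over the cells, each of length
    [h], and the inner norm is again a step function of the others. *)
Lemma mixed_norm_step n (p : n.-tuple (\bar R)) (phi : n.-tuple T -> R) :
  good_exponents p -> (forall c, (0 <= phi c)%R) ->
  mixed_norm p (fun x => (step phi x)%:E) <= (dmix h p phi)%:E.
Proof.
elim: n p phi => [|n IH] p phi hp phi0 /=.
  by rewrite (step_in _ (incube_tnil [tuple] _)).
have hp' := good_exponents_behead hp.
have [q q1 ->] := good_exponents_thead hp.
have q0 : (0 < q)%R by exact: lt_trans q1.
pose psi (d : n.-tuple T) := lpnorm h q (fun a => phi [tuple of a :: d]).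
have psi0 d : (0 <= psi d)%R by exact: lpnorm_ge0.
apply: le_trans (IH _ psi hp' psi0); apply: mixed_norm_le => // y.
rewrite !gee0_abs ?Lnorm_ge0//; last by rewrite lee_fin step_ge0.
have [[d dy]|ny] := pselect (exists d : n.-tuple T, incube d y); last first.
  have ny' d : ~~ incube d y by apply/negP => dy; apply: ny; exists d.
  rewrite [X in 'N[_]__[X]](_ : _ = cst 0); last first.
    apply/funext => x /=; rewrite step_out// => c.
    have -> : c = [tuple of thead c :: behead c].
      by rewrite [LHS]tuple_eta; apply/val_inj.
    by rewrite incube_cons negb_and ny' orbT.
  by rewrite Lnorm0 ?lee_fin ?step_ge0// eqe gt_eqF.
rewrite (step_in _ dy) LnormE /psi /lpnorm -poweR_EFin.
apply: le_poweR; first by rewrite invr_ge0 ltW.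
  by apply: integral_ge0 => x _; exact: poweR_ge0.
apply: (@le_trans _ _ (\int[lebesgue_measure]_x
    \sum_(a < L) ((`|phi [tuple of a :: d]| `^ q)%:E * (incell a x)%:R%:E))).
  apply: le_integral_ge0 => x; first exact: poweR_ge0.
  have t0 (a : T) : 0 <= (`|phi [tuple of a :: d]| `^ q)%:E * (incell a x)%:R%:E.
    by rewrite -EFinM lee_fin mulr_ge0 ?powR_ge0.
  have [[a ax]|nx] := pselect (exists a : T, incell a x).
    have cx : incube [tuple of a :: d] (tcons (x, y)) by rewrite incube_cons ax.
    rewrite (step_in _ cx) (bigD1 a)//= ax mule1.
    by rewrite leeDl// sume_ge0.
  rewrite step_out; last first.
    move=> c; have -> : c = [tuple of thead c :: behead c].
      by rewrite [LHS]tuple_eta; apply/val_inj.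
    rewrite incube_cons negb_and; apply/orP; left; apply/negP => cx.
    by apply: nx; exists (thead c).
  rewrite abse0 poweR0r ?gt_eqF// sume_ge0//.
have mI (a : T) : measurable_fun setT (fun x : measurableTypeR R =>
    (`|phi [tuple of a :: d]| `^ q)%:E * ((incell a x)%:R%:E : \bar R)).
  apply: measurable_funeM.
  exact: (measurable_indicator (measurable_incell a)).
rewrite ge0_integral_sum//.
rewrite mulr_sumr -sumEFin le_eqVlt; apply/orP; left; apply/eqP.
apply: eq_bigr => a _; rewrite ge0_integralZl_EFin ?powR_ge0//.
- by rewrite integral_incell -EFinM mulrC.
- exact: (measurable_indicator (measurable_incell a)).
Qed.

Definition cube_int n (g : Rn R n -> \bar R) (c : n.-tuple T) : \bar R :=
  \int[@lebRn R n]_x ((incube c x)%:R%:E * g x).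

Lemma cube_int_ge0 n (g : Rn R n -> \bar R) c : (forall x, 0 <= g x) ->
  0 <= cube_int g c.
Proof. by move=> g0; apply: integral_ge0 => x _; rewrite mule_ge0// lee_fin. Qed.

Lemma cube_int_cons n (g : Rn R n.+1 -> \bar R) a (d : n.-tuple T) :
  measurable_fun setT g -> (forall x, 0 <= g x) ->
  cube_int g [tuple of a :: d] =
  cube_int (fun y => \int[lebesgue_measure]_x ((incell a x)%:R%:E * g (tcons (x, y)))) d.
Proof.
move=> mg g0; rewrite /cube_int integral_lebRnS; last 2 first.
- apply: emeasurable_funM => //.
  exact: (measurable_indicator (measurable_incube _)).
- by move=> x; rewrite mule_ge0// lee_fin.
apply: eq_integral => y _; rewrite -ge0_integralZl_EFin//; last 2 first.
- by move=> x _; rewrite mule_ge0// lee_fin.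
- apply: emeasurable_funM; last exact: measurable_section.
  exact: (measurable_indicator (measurable_incell a)).
by apply: eq_integral => x _; rewrite incube_cons muleA -EFinM -natrM mulnb andbC.
Qed.

(** Averaging over the cubes of the grid does not increase the mixed norm: the
    inner norm is tested, by duality, against a step function in the first
    variable. *)
Lemma dmix_cube_average n (p : n.-tuple (\bar R)) (phi : n.-tuple T -> R)
    (g : Rn R n -> \bar R) :
  good_exponents p -> (forall c, (0 <= phi c)%R) ->
  measurable_fun setT g -> (forall x, 0 <= g x) ->
  (forall c, (phi c)%:E <= (h ^- n)%:E * cube_int g c) ->
  (dmix h p phi)%:E <= mixed_norm p g.
Proof.
elim: n p phi g => [|n IH] p phi g hp phi0 mg g0 H /=.
  rewrite ger0_norm// gee0_abs//; apply: (le_trans (H [tuple])).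
  rewrite expr0 invr1 mul1e /cube_int/= integral_dirac//; last first.
    apply: emeasurable_funM => //.
    exact: (measurable_indicator (measurable_incube _)).
  by rewrite diracT mul1e incube_tnil mul1e.
have hp' := good_exponents_behead hp.
have [q q1 ->] := good_exponents_thead hp.
have q0 : (0 < q)%R by exact: lt_trans q1.
have hn0 k : (0 <= h ^- k)%R by rewrite invr_ge0 exprn_ge0// ltW.
apply: IH => //.
- by move=> c; exact: lpnorm_ge0.
- exact: measurable_Lnorm_section.
- by move=> y; exact: Lnorm_ge0.
move=> d /=; set s := lpnorm h q _; have s0 : (0 <= s)%R by exact: lpnorm_ge0.
have [->|sn0] := eqVneq s 0%R.
  apply: mule_ge0; first by rewrite lee_fin.
  by apply: cube_int_ge0 => y; exact: Lnorm_ge0.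
have {sn0} sp : (0 < s)%R by rewrite lt_neqAle eq_sym sn0.
pose f a := phi [tuple of a :: d].
have f0 a : (0 <= f a)%R by exact: phi0.
have sE : (s `^ q = h * \sum_a f a `^ q)%R.
  by rewrite lpnorm_powR// sum_powR_norm.
apply: (powR_cancel q1 sp).
pose u a := (f a `^ (q - 1))%R; have u0 a : (0 <= u a)%R by exact: powR_ge0.
pose gs y a := \int[lebesgue_measure]_x ((incell a x)%:R%:E * g (tcons (x, y))).
have gs0 y a : 0 <= gs y a.
  by apply: integral_ge0 => x _; rewrite mule_ge0// lee_fin.
have mgs a : measurable_fun setT (gs ^~ a).
  apply: (@measurable_fun_fubini_tonelli_G _ _ _ _ R lebesgue_measure
    (fun xy => (incell a xy.1)%:R%:E * g (tcons xy))).
    apply: emeasurable_funM.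
      apply: (measurableT_comp (measurable_indicator (measurable_incell a))).
      exact: measurable_fst.
    by apply: measurableT_comp => //; exact: measurable_tcons.
  by move=> xy; rewrite mule_ge0// lee_fin.
have cu0 (y : Rn R n) : 0 <= (incube d y)%:R%:E :> \bar R by rewrite lee_fin.
have mcu := measurable_indicator (measurable_incube d).
apply: (@le_trans _ _ ((h ^- n)%:E *
    \int[@lebRn R n]_y ((incube d y)%:R%:E * \sum_a ((u a)%:E * gs y a)))).
  have -> : \int[@lebRn R n]_y ((incube d y)%:R%:E * \sum_a ((u a)%:E * gs y a)) =
      \sum_a ((u a)%:E * cube_int g [tuple of a :: d]).
    transitivity (\int[@lebRn R n]_y
        (\sum_a ((u a)%:E * ((incube d y)%:R%:E * gs y a)))).
      apply: eq_integral => y _; rewrite ge0_sume_distrr; last first.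
        by move=> a _; rewrite mule_ge0// lee_fin.
      by apply: eq_bigr => a _; rewrite muleCA.
    rewrite ge0_integral_sum//; last 2 first.
    - by move=> a; apply: measurable_funeM; exact: emeasurable_funM.
    - by move=> a y _; rewrite !mule_ge0// lee_fin.
    apply: eq_bigr => a _; rewrite cube_int_cons// ge0_integralZl_EFin//.
    - by move=> y _; rewrite mule_ge0.
    - exact: emeasurable_funM.
  rewrite sE mulr_sumr -sumEFin ge0_sume_distrr; last first.
    by move=> a _; rewrite mule_ge0 ?cube_int_ge0// lee_fin.
  apply: lee_sum => a _; rewrite muleCA.
  have -> : (h * f a `^ q = u a * (h * f a))%R.
    by rewrite -(mulr_powRB1 (f0 a) q0) /u; ring.
  rewrite EFinM; apply: lee_wpmul2l; first by rewrite lee_fin.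
  rewrite EFinM.
  apply: (@le_trans _ _ (h%:E * ((h ^- n.+1)%:E * cube_int g [tuple of a :: d]))).
    by apply: lee_wpmul2l; [rewrite lee_fin ltW|exact: H].
  rewrite muleA -EFinM exprS invfM mulrA mulfV ?mul1r//; exact: lt0r_neq0.
rewrite muleCA; apply: lee_wpmul2l; rewrite ?lee_fin//.
rewrite /cube_int -ge0_integralZl_EFin ?powR_ge0//; last 2 first.
- by move=> y _; rewrite mule_ge0// Lnorm_ge0.
- by apply: emeasurable_funM => //; exact: measurable_Lnorm_section.
apply: le_integral_ge0 => y.
  by rewrite mule_ge0// sume_ge0// => a _; rewrite mule_ge0// lee_fin.
rewrite muleCA; apply: lee_wpmul2l => //.
pose U (x : R) : R := (\sum_a u a * (incell a x)%:R)%R.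
have U0 x : (0 <= U x)%R by apply: sumr_ge0 => a _; rewrite mulr_ge0.
have mU : measurable_fun setT (U : measurableTypeR R -> R).
  apply: measurable_sum => a; apply: measurable_funM => //.
  apply/measurable_EFinP.
  exact: (measurable_indicator (measurable_incell a)).
have mgy := measurable_section y mg.
have -> : \sum_a ((u a)%:E * gs y a) =
    \int[lebesgue_measure]_x ((U x)%:E * g (tcons (x, y))).
  transitivity (\int[lebesgue_measure]_x
      \sum_a ((u a)%:E * ((incell a x)%:R%:E * g (tcons (x, y))))).
    rewrite ge0_integral_sum//; last 2 first.
    - move=> a; apply: measurable_funeM; apply: emeasurable_funM => //.
      exact: (measurable_indicator (measurable_incell a)).
    - by move=> a x _; rewrite !mule_ge0// lee_fin.
    apply: eq_bigr => a _; rewrite ge0_integralZl_EFin//.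
    - by move=> x _; rewrite mule_ge0// lee_fin.
    - apply: emeasurable_funM => //.
      exact: (measurable_indicator (measurable_incell a)).
  apply: eq_integral => x _; rewrite -sumEFin ge0_sume_distrl; last first.
    by move=> a _; rewrite lee_fin mulr_ge0.
  by apply: eq_bigr => a _; rewrite muleA EFinM.
apply: holder_pairing => //; first by rewrite powR_gt0.
rewrite powR_conj// sE.
apply: (@le_trans _ _ (\int[lebesgue_measure]_x
    \sum_a ((f a `^ q)%:E * (incell a x)%:R%:E))).
  apply: le_integral_ge0 => x; first by rewrite lee_fin powR_ge0.
  have t0 a : 0 <= (f a `^ q)%:E * (incell a x)%:R%:E.
    by rewrite -EFinM lee_fin mulr_ge0 ?powR_ge0.
  have [[a ax]|nx] := pselect (exists a : T, incell a x).
    have -> : U x = u a.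
      rewrite /U (bigD1 a)//= ax mulr1 big1 ?addr0// => b ba.
      case bx : (incell b x); last by rewrite mulr0.
      by move: ba; rewrite -val_eqE/= (incell_inj bx ax) eqxx.
    rewrite /u powR_conj// (bigD1 a)//= ax mule1 leeDl//.
    by rewrite sume_ge0.
  have -> : U x = 0%R.
    rewrite /U big1// => a _; case ax : (incell a x); last by rewrite mulr0.
    by exfalso; apply: nx; exists a.
  rewrite powR0 ?sume_ge0//; exact: lt0r_neq0 (conj_gt0 q1).
have mI (a : T) : measurable_fun setT (fun x : measurableTypeR R =>
    (f a `^ q)%:E * ((incell a x)%:R%:E : \bar R)).
  apply: measurable_funeM.
  exact: (measurable_indicator (measurable_incell a)).
rewrite ge0_integral_sum//.
rewrite mulr_sumr -sumEFin le_eqVlt; apply/orP; left; apply/eqP.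
apply: eq_bigr => a _; rewrite ge0_integralZl_EFin ?powR_ge0//.
- by rewrite integral_incell -EFinM mulrC.
- exact: (measurable_indicator (measurable_incell a)).
by move=> a x _; rewrite -EFinM lee_fin mulr_ge0 ?powR_ge0.
Qed.

End grids.

(** * Balls, boxes and the measure on [R^n] *)

Section balls.
Set Implicit Arguments.
Unset Strict Implicit.
Context {R : realType}.

Definition box n (c : Rn R n) (r : R) : set (Rn R n) :=
  [set x | [forall i, (`|tnth x i - tnth c i| < r)%R]].

Lemma measurable_box n (c : Rn R n) (r : R) : measurable (box c r).
Proof.
rewrite (_ : box c r = \big[setI/setT]_(i < n)
    ((fun x : Rn R n => `|tnth x i - tnth c i|%R) @^-1` `]-oo, r[)).
  apply: bigsetI_measurable => i _; rewrite -[X in measurable X]setTI.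
  have H : measurable_fun setT (fun x : Rn R n => `|tnth x i - tnth c i|%R).
    apply: measurableT_comp => //; apply: measurable_funB => //.
    exact: measurable_tnth.
  exact: H.
rewrite -bigcap_seq; apply/seteqP; split => x /=.
  by move=> /forallP H i _ /=; rewrite in_itv/=; exact: H.
move=> H; apply/forallP => i; have := H i; rewrite /= mem_index_enum in_itv/=.
exact.
Qed.

Lemma lebRn_box n (c : Rn R n) (r : R) : (0 < r)%R ->
  @lebRn R n (box c r) = ((2 * r) ^+ n)%:E.
Proof.
move=> r0; elim: n c => [|n IH] c.
  rewrite expr0 /= diracE mem_set//=; by apply/forallP => -[].
have mI k (b : Rn R k) :
    measurable_fun setT (fun x => (\1_(box b r) x)%:E : \bar R).
  by apply/measurable_EFinP/measurable_indic; exact: measurable_box.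
have I0 k (b : Rn R k) x : 0 <= (\1_(box b r) x)%:E :> \bar R by rewrite lee_fin.
rewrite -(setIT (box c r)) -integral_indic//; last exact: measurable_box.
rewrite (integral_lebRnS (mI _ c) (I0 _ c)).
pose c' : Rn R n := [tuple of behead c].
have E x y : \1_(box c r) (tcons (x, y)) =
    (\1_(box c' r) y * \1_(`](thead c - r)%R, (thead c + r)%R[%classic) x)%R :> R.
  rewrite !indicE -natrM mulnb; congr (_%:R); congr nat_of_bool.
  apply/idP/idP.
    rewrite inE => /forallP H; apply/andP; split; rewrite inE/=.
      apply/forallP => i; have := H (lift ord0 i); rewrite tnthS tnth_behead.
      by rewrite (_ : inord _ = lift ord0 i)//; apply/val_inj;
        rewrite /= inordK// ltnS.
    by have := H ord0; rewrite tnth0 in_itv/= ltr_distl.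
  rewrite !inE => /andP[]; rewrite !inE /= => /forallP H.
  rewrite in_itv/= -ltr_distl => H0; apply/forallP => i.
  case: (unliftP ord0 i) => [j ->|->]; last by rewrite tnth0.
  rewrite tnthS; have := H j; rewrite tnth_behead.
  by rewrite (_ : inord _ = lift ord0 j)//; apply/val_inj;
    rewrite /= inordK// ltnS.
transitivity (\int[@lebRn R n]_y ((2 * r)%:E * (\1_(box c' r) y)%:E)).
  apply: eq_integral => y _.
  under eq_integral do rewrite E EFinM.
  rewrite ge0_integralZl_EFin//; last by apply/measurable_EFinP.
  rewrite integral_indic// setIT.
  rewrite [X in _ * X](@lebesgue_measure_itv R `](thead c - r)%R, (thead c + r)%R[).
  rewrite /= lte_fin ltrD2l gtrN// -EFinD muleC.
  by congr (_%:E * _); ring.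
have r20 : (0 <= 2 * r)%R by rewrite mulr_ge0// ltW.
rewrite (ge0_integralZl_EFin _ measurableT (fun y _ => I0 _ c' y) (mI _ c') r20).
transitivity ((2 * r)%:E * @lebRn R n (box c' r)).
  by rewrite integral_indic ?setIT//; exact: measurable_box.
by rewrite IH -EFinM exprS.
Qed.

Definition enorm n (x : Rn R n) : R := Num.sqrt (\sum_(i < n) tnth x i ^+ 2).

Lemma eball_origin n (r : R) (x : Rn R n) : eball (origin n) r x = (enorm x < r)%R.
Proof.
rewrite /eball/= /enorm; congr (_ < _)%R; congr Num.sqrt.
by apply: eq_bigr => i _; rewrite tnth_mktuple subr0.
Qed.

Lemma measurable_sqrt : measurable_fun setT (Num.sqrt : R -> R).
Proof. by apply: continuous_measurable_fun; exact: sqrt_continuous. Qed.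

Lemma measurable_eball n (c : Rn R n) (r : R) : measurable (eball c r).
Proof.
have H : measurable_fun setT (fun x : Rn R n =>
    Num.sqrt (\sum_(i < n) (tnth x i - tnth c i) ^+ 2)).
  apply: (measurableT_comp measurable_sqrt); apply: measurable_sum => i.
  apply: measurable_funX; apply: measurable_funB => //; exact: measurable_tnth.
rewrite (_ : eball c r = setT `&`
    (fun x : Rn R n => Num.sqrt (\sum_(i < n) (tnth x i - tnth c i) ^+ 2))
      @^-1` `]-oo, r[).
  exact: H.
by rewrite setTI; apply/seteqP; split => x /=; rewrite in_itv.
Qed.

Lemma eball_coord n (c y : Rn R n) (r : R) (i : 'I_n) : eball c r y ->
  (`|tnth y i - tnth c i| < r)%R.
Proof.
apply: le_lt_trans; rewrite -sqrtr_sqr ler_wsqrtr// (bigD1 i)//= lerDl.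
by apply: sumr_ge0 => j _; exact: sqr_ge0.
Qed.

(** A crude comparison of the Euclidean norm with the largest coordinate. *)
Lemma sqrt_sum_le n (a : 'I_n -> R) (M : R) : (0 <= M)%R ->
  (forall i, `|a i| <= M)%R ->
  (Num.sqrt (\sum_i a i ^+ 2) <= n%:R * M)%R.
Proof.
move=> M0 aM; rewrite -[leRHS]ger0_norm ?mulr_ge0// -sqrtr_sqr ler_wsqrtr//.
apply: (@le_trans _ _ (\sum_(i < n) M ^+ 2)%R).
  apply: ler_sum => i _; rewrite -real_normK ?num_real//.
  by rewrite lerXn2r ?nnegrE.
rewrite sumr_const card_ord -[leLHS]mulr_natl exprMn ler_wpM2r ?sqr_ge0//.
rewrite -natrX ler_nat; case: (n) => // k; rewrite leq_pmulr//.
Qed.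

(** The ball contains the box with half-side [r / (2 n)]. *)
Lemma lebRn_eball_ge n (c : Rn R n) (r : R) : (0 < n)%N -> (0 < r)%R ->
  ((r / n%:R) ^+ n)%:E <= @lebRn R n (eball c r).
Proof.
move=> n0 r0; have nr0 : (0 < n%:R :> R)%R by rewrite ltr0n.
have -> : (r / n%:R = 2 * (r / (2 * n%:R)))%R by field; rewrite gt_eqF.
rewrite -(lebRn_box c); last by rewrite divr_gt0// mulr_gt0.
apply: le_measure; rewrite ?inE; [exact: measurable_box|exact: measurable_eball|].
move=> x /forallP H; rewrite /eball/=.
apply: le_lt_trans (@sqrt_sum_le _ _ (r / (2 * n%:R)) _ _) _.
- by rewrite divr_ge0// ?ltW// mulr_gt0.
- by move=> i; rewrite ltW.
rewrite (_ : (n%:R * _ = r / 2)%R); last by field; rewrite gt_eqF.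
by rewrite ltr_pdivrMr// ltr_pMr// ltr1n.
Qed.

Lemma lebRn_eball_inv_le n (c : Rn R n) (r : R) : (0 < n)%N -> (0 < r)%R ->
  (@lebRn R n (eball c r))^-1 <= ((n%:R / r) ^+ n)%:E.
Proof.
move=> n0 r0; have := lebRn_eball_ge c n0 r0.
have nr0 : (0 < n%:R :> R)%R by rewrite ltr0n.
have e0 : (0 < (r / n%:R) ^+ n)%R by rewrite exprn_gt0// divr_gt0.
case: (lebRn _) => [m||] //; last by move=> _; rewrite invey lee_fin exprn_ge0// divr_ge0// ltW.
rewrite lee_fin => em; have m0 : (0 < m)%R by exact: lt_le_trans em.
rewrite inver gt_eqF// lee_fin -invf_div exprVn.
by rewrite lef_pV2.
Qed.

End balls.

(** * Hoelder's inequality on a cube *)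

Section cubes.
Set Implicit Arguments.
Unset Strict Implicit.
Context {R : realType}.

Lemma sum_inv_cons n (p : n.+1.-tuple (\bar R)) (q : R) : (1 < q)%R ->
  thead p = q%:E -> sum_inv p = (q^-1 + sum_inv [tuple of behead p])%R.
Proof.
move=> q1 pq; rewrite /sum_inv big_ord_recl; congr (_ + _)%R.
  have -> : tnth p ord0 = q%:E by rewrite -pq.
  by rewrite inver gt_eqF// (lt_trans ltr01).
apply: eq_bigr => i _; rewrite tnth_behead; congr (fine (tnth p _)^-1).
by apply/val_inj; rewrite /= inordK// ltnS.
Qed.

Lemma sum_inv_ge0 n (p : n.-tuple (\bar R)) : good_exponents p -> (0 <= sum_inv p)%R.
Proof.
elim: n p => [|n IH] p hp; first by rewrite /sum_inv big_ord0.
have [q q1 pq] := good_exponents_thead hp.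
rewrite (sum_inv_cons q1 pq) addr_ge0 ?IH//; last exact: good_exponents_behead.
by rewrite invr_ge0 ltW// (lt_trans ltr01).
Qed.

Lemma dmix_ge_point (T : finType) (h : R) n (p : n.-tuple (\bar R))
    (phi : n.-tuple T -> R) c : (0 < h)%R -> good_exponents p ->
  (forall c, (0 <= phi c)%R) -> (phi c * h `^ sum_inv p <= dmix h p phi)%R.
Proof.
move=> h0; elim: n p phi c => [|n IH] p phi c hp phi0.
  by rewrite /sum_inv big_ord0 powRr0 mulr1 /= (tuple0 c) ger0_norm.
have hp' := good_exponents_behead hp.
have [q q1 pq] := good_exponents_thead hp.
have q0 : (0 < q)%R by exact: lt_trans q1.
rewrite (sum_inv_cons q1 pq) /= pq /=.
pose psi (d : n.-tuple T) := lpnorm h q (fun a => phi [tuple of a :: d]).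
have psi0 d : (0 <= psi d)%R by exact: lpnorm_ge0.
apply: le_trans (IH _ psi [tuple of behead c] hp' psi0).
rewrite powRD; last by rewrite (gt_eqF h0) implybT.
rewrite mulrA ler_wpM2r ?powR_ge0//.
have cE : c = [tuple of thead c :: behead c].
  by rewrite [LHS]tuple_eta; apply/val_inj.
have -> : (phi c * h `^ q^-1 = (h * phi c `^ q) `^ q^-1)%R.
  by rewrite powRM ?powR_ge0 ?(ltW h0)// powR_KV ?gt_eqF// mulrC.
apply: le_powR; first by rewrite invr_ge0 ltW.
  by rewrite mulr_ge0 ?powR_ge0 ?ltW.
rewrite ler_wpM2l ?(ltW h0)// (bigD1 (thead c))//=.
rewrite {1}cE (_ : [tuple of thead c :: behead c] =
  [tuple of thead c :: [tuple of behead c]]); last exact/val_inj.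
rewrite ger0_norm// lerDl; exact: sumr_ge0 (fun i _ => powR_ge0 _ _).
Qed.

Lemma dmix_one_cell (h t : R) n (p : n.-tuple (\bar R)) : (0 < h)%R ->
  (0 <= t)%R -> good_exponents p ->
  dmix h p (fun _ : n.-tuple 'I_1 => t) = (t * h `^ sum_inv p)%R.
Proof.
move=> h0; elim: n p t => [|n IH] p t t0 hp.
  by rewrite /sum_inv big_ord0 powRr0 mulr1 /= ger0_norm.
have hp' := good_exponents_behead hp.
have [q q1 pq] := good_exponents_thead hp.
have q0 : (0 < q)%R by exact: lt_trans q1.
rewrite (sum_inv_cons q1 pq) /= pq /=.
rewrite (IH _ _ (lpnorm_ge0 _ _ _) hp') powRD; last first.
  by rewrite (gt_eqF h0) implybT.
rewrite mulrA; congr (_ * _)%R; rewrite /lpnorm big_ord1 (ger0_norm t0).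
by rewrite powRM ?powR_ge0 ?(ltW h0)// powR_KV ?gt_eqF// mulrC.
Qed.

(** This is [dmix_cube_average] for a function carried by the single cube [c],
    whose discrete mixed norm is bounded below by one of its values. *)
Lemma cube_int_le (o h : R) L n (p : n.-tuple (\bar R)) (g : Rn R n -> \bar R)
    (c : n.-tuple 'I_L) : (0 < h)%R -> good_exponents p ->
  measurable_fun setT g -> (forall x, 0 <= g x) ->
  cube_int o h g c <= (h ^+ n * h `^ (- sum_inv p))%:E * mixed_norm p g.
Proof.
move=> h0 hp mg g0.
have hS : (0 < h `^ sum_inv p)%R by exact: powR_gt0.
have hn : (0 < h ^+ n)%R by exact: exprn_gt0.
have X0 : 0 <= cube_int o h g c by exact: cube_int_ge0.
have A0 := mixed_norm_ge0 p g.
have H t : (0 <= t)%R -> t%:E <= (h ^- n)%:E * cube_int o h g c ->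
    (t * h `^ sum_inv p)%:E <= mixed_norm p g.
  move=> t0 tX; pose phi (d : n.-tuple 'I_L) : R := if d == c then t else 0%R.
  have phi0 d : (0 <= phi d)%R by rewrite /phi; case: ifP.
  apply: (@le_trans _ _ (dmix h p phi)%:E).
    have := dmix_ge_point c h0 hp phi0; rewrite /phi eqxx.
    by rewrite lee_fin.
  apply: (dmix_cube_average (o := o) h0 hp phi0 mg g0) => d.
  rewrite /phi; case: eqP => [->//|_].
  by rewrite mule_ge0 ?cube_int_ge0// lee_fin invr_ge0 ltW.
move: A0 H; case: (mixed_norm p g) => [A||]//; last first.
  by move=> _ _; rewrite gt0_muley ?leey// lte_fin mulr_gt0// powR_gt0.
rewrite lee_fin => A0 H.
move: X0 H; case: (cube_int o h g c) => [X||]// X0 H; last first.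
  exfalso; have A10 : (0 <= (A + 1) / h `^ sum_inv p)%R.
    by rewrite divr_ge0 ?addr_ge0// ltW.
  have := H _ A10; rewrite gt0_muley ?lte_fin ?invr_gt0// leey => /(_ isT).
  by rewrite divfK ?gt_eqF// lee_fin gerDl ler10.
rewrite lee_fin in X0.
have X1 : (0 <= h ^- n * X)%R by rewrite mulr_ge0// invr_ge0 ltW.
have := H _ X1 (lexx _); rewrite -EFinM !lee_fin powRN => HX.
move: HX hS hn; move: (h ^+ n)%R (h `^ sum_inv p)%R => u w HX w0 u0.
have -> : X = (u / w * (u^-1 * X * w))%R by field; rewrite !gt_eqF.
by rewrite ler_wpM2l// divr_ge0// ltW.
Qed.

Lemma eball_in_cell n (r : R) (x : Rn R n) : eball (origin n) r x ->
  incube (- r) (2 * r) [tuple (ord0 : 'I_1) | _ < n] x.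
Proof.
move=> bx; apply/forallP => i; rewrite tnth_mktuple /incell mul0r addr0 mul1r.
have := eball_coord i bx; rewrite tnth_mktuple subr0 ltr_norml.
by move=> /andP[/ltW -> xr]/=; apply: (lt_le_trans xr); lra.
Qed.

(** Hoelder's inequality on a ball, from the one on the enclosing cube. *)
Lemma integral_ball_le n (p : n.-tuple (\bar R)) (r : R) (g : Rn R n -> \bar R) :
  (0 < r)%R -> good_exponents p -> measurable_fun setT g ->
  (forall x, 0 <= g x) ->
  \int[@lebRn R n]_x (g \_ (eball (origin n) r)) x <=
  ((2 * r) ^+ n * (2 * r) `^ (- sum_inv p))%:E *
  mixed_norm p (g \_ (eball (origin n) r)).
Proof.
move=> r0 hp mg g0; have h0 : (0 < 2 * r)%R by rewrite mulr_gt0.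
set f := g \_ _.
have f0 x : 0 <= f x by rewrite /f /patch; case: ifP.
have mf : measurable_fun setT f.
  rewrite /f; apply/(measurable_restrict _ (measurable_eball _ _)) => //.
  by rewrite setTI; exact: measurable_funS mg.
apply: le_trans (cube_int_le (- r) [tuple (ord0 : 'I_1) | _ < n] h0 hp mf f0).
apply: le_integral_ge0 => // x; rewrite /f /patch; case: ifPn => [|_]; last first.
  by rewrite mule0.
by rewrite inE => /eball_in_cell ->; rewrite mul1e.
Qed.

End cubes.

Section minkowski_series.
Set Implicit Arguments.
Unset Strict Implicit.
Context d (T : measurableType d) (R : realType).
Variable mu : {measure set T -> \bar R}.

(** Finite sections of the sequence are handled by [lpnorm_le_integral_lv]. *)
Lemma lv_integral_le (v : R) (f : nat -> T -> \bar R) : (1 < v)%R ->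
  (forall j, measurable_fun setT (f j)) -> (forall j x, 0 <= f j x) ->
  lv v (fun j => \int[mu]_x f j x) <= \int[mu]_x lv v (f ^~ x).
Proof.
move=> v1 mf f0; have v0 : (0 < v)%R by exact: lt_trans v1.
have vn0 : v != 0%R by rewrite gt_eqF.
have I0 : 0 <= \int[mu]_x lv v (f ^~ x).
  by apply: integral_ge0 => x _; exact: lv_ge0.
have fI j : \int[mu]_x f j x <= \int[mu]_x lv v (f ^~ x).
  by apply: le_integral_ge0 => // x; apply: (le_lv (f := f ^~ x)).
have fj0 j : 0 <= \int[mu]_x f j x by exact: integral_ge0.
have [->|Ifin] := eqVneq (\int[mu]_x lv v (f ^~ x)) +oo; first exact: leey.
have Ifn : \int[mu]_x lv v (f ^~ x) \is a fin_num by rewrite ge0_fin_numE ?ltey.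
have ffn j : \int[mu]_x f j x \is a fin_num.
  rewrite ge0_fin_numE//; apply: le_lt_trans (fI j) _.
  by rewrite ltey.
rewrite -[leRHS](poweR_KV vn0)//; apply: le_poweR.
- by rewrite invr_ge0 ltW.
- by apply: nneseries_ge0 => j _ _; exact: poweR_ge0.
apply: lime_le; first by apply: is_cvg_nneseries => j _ _; exact: poweR_ge0.
apply: nearW => J; rewrite big_mkord.
pose phi (j : 'I_J) : R := fine (\int[mu]_x f j x).
have phi0 j : (0 <= phi j)%R by exact: fine_ge0.
have phiE j : (phi j)%:E = \int[mu]_x f j x by rewrite fineK.
have H : (lpnorm 1 v phi)%:E <= 1%:E * \int[mu]_x lv v (f ^~ x).
  by apply: lpnorm_le_integral_lv => // j; rewrite mul1e phiE.
rewrite mul1e in H.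
have -> : \sum_(j < J) (\int[mu]_x f j x) `^ v = (lpnorm 1 v phi)%:E `^ v.
  rewrite poweR_EFin lpnorm_powR// mul1r sum_powR_norm// -sumEFin.
  by apply: eq_bigr => j _; rewrite -phiE.
by apply: le_poweR H; [exact: ltW|rewrite lee_fin lpnorm_ge0].
Qed.

End minkowski_series.

(** * The vector-valued maximal inequality in mixed norm *)

Section ball_averages_on_a_grid.
Set Implicit Arguments.
Unset Strict Implicit.
Context {R : realType} (o h : R) (m n : nat).
Hypotheses (h0 : (0 < h)%R) (n0 : (0 < n)%N).
Notation T := 'I_(2 ^ m).

Definition cell_index (y : R) : nat := Num.truncn ((y - o) / h)%R.

Lemma cell_indexP (y : R) : (o <= y)%R -> incell o h (cell_index y) y.
Proof.
move=> oy; have y0 : (0 <= (y - o) / h)%R by rewrite divr_ge0 ?subr_ge0// ltW.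
have := truncn_itv y0; rewrite -/(cell_index y) ler_pdivlMr// ltr_pdivrMr//.
by rewrite lerBrDl ltrBlDl.
Qed.

Lemma le_cell_index (y z : R) : (y <= z)%R -> (cell_index y <= cell_index z)%N.
Proof.
move=> yz; apply: le_truncn; rewrite ler_pM2r ?invr_gt0//.
by rewrite lerD2r.
Qed.

Lemma cell_exists (y : Rn R n) :
  (forall i, (o <= tnth y i < o + (2 ^ m)%:R * h)%R) ->
  exists2 c : n.-tuple T, incube o h c y &
    forall i, tnth c i = cell_index (tnth y i) :> nat.
Proof.
move=> yo; pose d : T := Ordinal (expn_gt0 2 m).
have lt i : (cell_index (tnth y i) < 2 ^ m)%N.
  have /andP[y1 y2] := yo i; have /andP[z1 z2] := cell_indexP y1.
  have := le_lt_trans z1 y2; by rewrite ltrD2l ltr_pM2r// ltr_nat.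
exists [tuple insubd d (cell_index (tnth y i)) | i < n].
  apply/forallP => i; rewrite tnth_mktuple insubdK; last exact: lt.
  by apply: cell_indexP; have /andP[] := yo i.
by move=> i; rewrite tnth_mktuple insubdK//; exact: lt.
Qed.

Variables (g : Rn R n -> \bar R) (phi : n.-tuple T -> R).
Hypotheses (mg : measurable_fun setT g) (g0 : forall x, 0 <= g x).
Hypothesis phi0 : forall c, (0 <= phi c)%R.
Hypothesis phiE : forall c, cube_int o h g c = (h ^+ n * phi c)%:E.

(** A ball that is large with respect to the mesh is covered by a rectangle of
    at most [4 r / h] cubes in each direction; the factor [24 n] collects this
    [4], the [6] of [sum_rectangle_le], and the volume of the ball. *)
Lemma ball_average_le (b : Rn R n) (r : R) (x : Rn R n) (c : n.-tuple T) :
  (h <= r)%R -> (forall i, (o <= tnth b i - r)%R) ->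
  (forall i, (tnth b i + r <= o + (2 ^ m)%:R * h)%R) ->
  eball b r x -> incube o h c x ->
  (@lebRn R n (eball b r))^-1 * \int[@lebRn R n]_(y in eball b r) g y <=
  ((24 * n%:R) ^+ n * dimax phi c)%:E.
Proof.
move=> hr bo bo' bx cx; have r0 : (0 < r)%R by exact: lt_le_trans hr.
pose lo i := cell_index (tnth b i - r)%R.
pose hi i := (cell_index (tnth b i + r)%R).+1.
have inb y : eball b r y -> exists2 d : n.-tuple T, incube o h d y &
    forall i, (lo i <= tnth d i < hi i)%N.
  move=> yb; have H i : (tnth b i - r < tnth y i < tnth b i + r)%R.
    by have := eball_coord i yb; rewrite ltr_distl.
  have [|d dy dE] := @cell_exists y.
    move=> i; have /andP[H1 H2] := H i; rewrite (le_trans (bo i) (ltW H1))/=.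
    exact: lt_le_trans H2 (bo' i).
  exists d => // i; rewrite dE ltnS; have /andP[/ltW H1 /ltW H2] := H i.
  by rewrite !le_cell_index.
have I0 : 0 <= \int[@lebRn R n]_(y in eball b r) g y by exact: integral_ge0.
have cin i : (lo i <= tnth c i < hi i)%N.
  by have [d dx] := inb x bx; rewrite (incube_inj h0 cx dx).
pose rect (d : n.-tuple T) := [forall i, lo i <= tnth d i < hi i]%N.
have len i : ((hi i - lo i)%N%:R <= 4 * r / h :> R)%R.
  have lh : (lo i <= hi i)%N.
    rewrite leqW// le_cell_index//; rewrite lerD2l; lra.
  rewrite natrB//; have u0 : (0 <= (tnth b i - r - o) / h)%R.
    by rewrite divr_ge0 ?subr_ge0// ltW.
  have w0 : (0 <= (tnth b i + r - o) / h)%R.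
    rewrite divr_ge0 ?(ltW h0)// subr_ge0 (le_trans (bo i))// lerD2l; lra.
  have /andP[_ l1] := truncn_itv u0; have /andP[l2 _] := truncn_itv w0.
  rewrite /hi -natr1; move: l1; rewrite -natr1 -/(lo i) => l1.
  have l3 : (1 <= r / h)%R by rewrite ler_pdivlMr// mul1r.
  apply: (@le_trans _ _ ((tnth b i + r - o) / h + 1 -
     ((tnth b i - r - o) / h - 1)))%R.
    apply: lerB; first by rewrite lerD2r.
    by rewrite lerBlDr ltW.
  rewrite (_ : ((tnth b i + r - o) / h + 1 - ((tnth b i - r - o) / h - 1) =
    2 * (r / h) + 2)%R); last by field; rewrite gt_eqF.
  by rewrite -mulrA; lra.
have S1 : \int[@lebRn R n]_(y in eball b r) g y <=
    \sum_(d | rect d) cube_int o h g d.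
  rewrite integral_mkcond -big_filter.
  rewrite -(@ge0_integral_sum _ _ _ (@lebRn R n) setT measurableT
    (n.-tuple T) (fun d y => (incube o h d y)%:R%:E * g y)); last 2 first.
  - move=> d; apply: emeasurable_funM => //.
    exact: (measurable_indicator (measurable_incube _ _ _)).
  - by move=> d y _; rewrite mule_ge0// lee_fin.
  have t0 d y : 0 <= (incube o h d y)%:R%:E * g y by rewrite mule_ge0// lee_fin.
  apply: le_integral_ge0 => y; first by rewrite /patch; case: ifP.
  rewrite big_filter /patch; case: ifPn => [|_]; last exact: sume_ge0.
  rewrite inE => yb; have [d dy dE] := inb y yb.
  rewrite (bigD1 d)/=; last exact/forallP.
  by rewrite dy mul1e leeDl// sume_ge0.
have S2 : \sum_(d | rect d) cube_int o h g d <=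
    (h ^+ n * ((6 * (4 * r / h)) ^+ n * dimax phi c))%:E.
  under eq_bigr do rewrite phiE; rewrite sumEFin -mulr_sumr lee_fin.
  rewrite ler_wpM2l ?exprn_ge0 ?(ltW h0)//.
  exact: sum_rectangle_le phi0 cin len.
apply: (@le_trans _ _ (((n%:R / r) ^+ n)%:E *
    (h ^+ n * ((6 * (4 * r / h)) ^+ n * dimax phi c))%:E)).
  apply: lee_pmul => //; last exact: le_trans S1 S2.
    by rewrite inve_ge0.
  exact: lebRn_eball_inv_le.
rewrite -EFinM lee_fin !mulrA -!exprMn le_eqVlt; apply/orP; left; apply/eqP.
by congr (_ ^+ n * _)%R; field; rewrite !gt_eqF.
Qed.

End ball_averages_on_a_grid.

Section maximal_inequality.
Set Implicit Arguments.
Unset Strict Implicit.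
Context {R : realType} (n : nat).
Hypothesis n0 : (0 < n)%N.

Lemma HL_max_ge0 (g : Rn R n -> \bar R) x : 0 <= HL_max g x.
Proof.
have cx1 : eball x 1 x.
  by rewrite /eball/= big1 ?sqrtr0// => i _; rewrite subrr expr0n.
apply: le_trans (ereal_sup_ubound _); last by exists (x, 1%R).
rewrite mule_ge0 ?inve_ge0//; apply: integral_ge0 => y _; exact: abse_ge0.
Qed.

Lemma measurable_limn_einf d (T : measurableType d) (f : nat -> T -> \bar R) :
  (forall k, measurable_fun setT (f k)) ->
  measurable_fun setT (fun x => limn_einf (f ^~ x)).
Proof.
move=> mf; apply: measurableT_comp => //.
apply: (@measurable_fun_limn_esup _ _ _ _ (fun k x => - f k x)) => k.
exact: measurableT_comp.
Qed.

Lemma lvZ v (k : R) (f : nat -> \bar R) : (0 < v)%R -> (0 <= k)%R ->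
  (forall j, 0 <= f j) -> lv v (fun j => k%:E * f j) = k%:E * lv v f.
Proof.
move=> v0 k0 f0; rewrite /lv.
have -> : \sum_(0 <= j <oo) (k%:E * f j) `^ v =
          k%:E `^ v * \sum_(0 <= j <oo) f j `^ v.
  rewrite poweR_EFin -nneseriesZl; last by move=> j _; exact: poweR_ge0.
  by apply: eq_eseriesr => j _; rewrite poweRM.
rewrite poweRM ?poweR_ge0//; last first.
  by apply: nneseries_ge0 => j _ _; exact: poweR_ge0.
by rewrite poweR_KV// gt_eqF.
Qed.

(** The maximal functions of the [f_j] are controlled by the lower limit of
    their counterparts on finer and finer grids of larger and larger cubes;
    the bound on a grid is the one of [itmax_bound_lv], and Fatou's lemma
    yields the conclusion. *)
Lemma maximal_inequality (p : n.-tuple (\bar R)) (v : R) :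
  good_exponents p -> (1 < v)%R ->
  exists2 C : R, (0 < C)%R & forall f : nat -> Rn R n -> \bar R,
  (forall j, measurable_fun setT (f j)) -> (forall j x, 0 <= f j x) ->
  exists G : Rn R n -> \bar R,
  [/\ measurable_fun setT G, forall x, 0 <= G x,
      forall x, lv v (fun j => HL_max (f j) x) <= G x &
      mixed_norm p G <= C%:E * mixed_norm p (fun x => lv v (f ^~ x))].
Proof.
move=> hp v1; have v0 : (0 < v)%R by exact: lt_trans v1.
have [C0 C00 HC] := itmax_bound_lv hp v1.
have c0 : (0 < (24 * n%:R) ^+ n :> R)%R by rewrite exprn_gt0// mulr_gt0// ltr0n.
set k0 := ((24 * n%:R) ^+ n)%R in c0.
exists (k0 * (C0 + 1))%R; first by rewrite mulr_gt0// ltr_wpDl.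
move=> f mf f0; set F := fun x => lv v (f ^~ x).
have F0 x : 0 <= F x by exact: lv_ge0.
have mF : measurable_fun setT F by exact: measurable_lv.
have A0 : 0 <= mixed_norm p F by exact: mixed_norm_ge0.
have [Aoo|Afin] := eqVneq (mixed_norm p F) +oo.
  exists (cst +oo); split; [exact: measurable_cst|by move=> x; exact: leey|
    by move=> x; exact: leey|].
  by rewrite Aoo gt0_muley ?leey// lte_fin mulr_gt0// ltr_wpDl.
(* the k-th grid has mesh 2^-k on the window [-2^k, 2^k)^n *)
pose h k : R := (2 ^- k)%R; pose o k : R := (- 2 ^+ k)%R.
pose m k := (2 * k + 1)%N.
have h0 k : (0 < h k)%R by rewrite invr_gt0 exprn_gt0.
have ohm k : (o k + (2 ^ m k)%:R * h k = 2 ^+ k)%R.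
  have -> : ((2 ^ m k)%:R = 2 * (2 ^+ k * 2 ^+ k) :> R)%R.
    by rewrite /m natrX addn1 exprS mul2n -addnn exprD.
  rewrite /o /h; have : (2 ^+ k : R)%R != 0%R by rewrite expf_neq0.
  by move: (2 ^+ k)%R => u un0; field.
have cfin k j (c : n.-tuple 'I_(2 ^ m k)) : cube_int (o k) (h k) (f j) c \is a fin_num.
  rewrite ge0_fin_numE; last exact: cube_int_ge0.
  apply: (@le_lt_trans _ _ (cube_int (o k) (h k) F c)).
    apply: le_integral_ge0 => x; first by rewrite mule_ge0// lee_fin.
    by apply: lee_wpmul2l; rewrite ?lee_fin//; exact: (le_lv (f := f ^~ x)).
  apply: (le_lt_trans (cube_int_le (o k) c (h0 k) hp mF F0)).
  by rewrite -ge0_fin_numE ?mule_ge0 ?lee_fin ?mulr_ge0 ?powR_ge0 ?exprn_ge0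
    ?(ltW (h0 k))// fin_numM// ge0_fin_numE ?ltey.
pose phi k j (c : n.-tuple 'I_(2 ^ m k)) : R := (h k ^- n * fine (cube_int (o k) (h k) (f j) c))%R.
have phi0 k j c : (0 <= phi k j c)%R.
  by rewrite mulr_ge0 ?invr_ge0 ?exprn_ge0 ?(ltW (h0 k))// fine_ge0// cube_int_ge0.
have phiE k j c : cube_int (o k) (h k) (f j) c = (h k ^+ n * phi k j c)%:E.
  by rewrite /phi mulrA mulfV ?mul1r ?fineK// expf_neq0// gt_eqF.
pose a k (j : nat) (c : n.-tuple 'I_(2 ^ m k)) := dimax (phi k j) c.
have a0 k j c : (0 <= a k j c)%R by apply: itmax_ge0.
pose psi k (c : n.-tuple 'I_(2 ^ m k)) := lpnorm 1 v (fun j : 'I_k => a k j c).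
pose G k x := (step (o k) (h k) (psi k) x)%:E.
have psi0 k c : (0 <= psi k c)%R by exact: lpnorm_ge0.
have G0 k x : 0 <= G k x by rewrite lee_fin step_ge0.
have mG k : measurable_fun setT (G k) by exact: measurable_step.
have Gb k : mixed_norm p (G k) <= C0%:E * mixed_norm p F.
  apply: (le_trans (mixed_norm_step _ (h0 k) hp (psi0 k))).
  apply: (@le_trans _ _ (C0 * dmix (h k) p
      (fun c => lpnorm 1 v (fun j : 'I_k => phi k j c)))%:E).
    rewrite lee_fin.
    exact: (HC _ _ _ (m k) (h k) 'I_k (fun j => phi k j)
      (filtration_dyadic (m k) 0) (filtration_dyadic (m k) (third (m k))) (h0 k)).
  rewrite EFinM; apply: lee_wpmul2l; first by rewrite lee_fin.
  apply: (dmix_cube_average (o := o k) (h0 k) hp _ mF F0) => c.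
    exact: lpnorm_ge0.
  have hn : (0 <= h k ^- n)%R by rewrite invr_ge0 exprn_ge0// ltW.
  have mi := measurable_indicator (measurable_incube (o k) (h k) c).
  have -> : cube_int (o k) (h k) F c = \int[@lebRn R n]_x
      lv v (fun j => (incube (o k) (h k) c x)%:R%:E * f j x).
    by apply: eq_integral => x _; rewrite lvZ.
  apply: (lpnorm_le_integral_lv v1 hn) => //.
  - by move=> j; exact: emeasurable_funM.
  - by move=> j x; rewrite mule_ge0// lee_fin.
  - move=> j; rewrite -/(cube_int (o k) (h k) (f j) c) phiE -EFinM lee_fin.
    by rewrite mulrA mulVf ?mul1r// expf_neq0// gt_eqF.
pose G' k x := k0%:E * G k x.
have G'0 k x : 0 <= G' k x.
  by apply: mule_ge0 => //; rewrite lee_fin ltW.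
have mG' k : measurable_fun setT (G' k) by exact: measurable_funeM.
exists (fun x => limn_einf (G' ^~ x)); split.
- exact: measurable_limn_einf.
- by move=> x; exact: limn_einf_ge0.
- move=> x.
  (* the maximal operator on the k-th grid at x, set to 0 off the window *)
  pose b k j : \bar R := k0%:E * (if (j < k)%N then
    (step (o k) (h k) (a k j) x)%:E else 0).
  have b0 k j : 0 <= b k j.
    rewrite mule_ge0 ?lee_fin ?(ltW c0)//; case: ifP => // _.
    by rewrite lee_fin step_ge0.
  have HLb j : HL_max (f j) x <= limn_einf (b ^~ j).
    apply: ge_ereal_sup => _ [[c r] /= cx <-].
    have r0 : (0 < r)%R by apply: le_lt_trans cx; exact: sqrtr_ge0.
    have -> : \int[@lebRn R n]_(y in eball c r) `|f j y| =
              \int[@lebRn R n]_(y in eball c r) f j y.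
      by apply: eq_integral => y _; rewrite gee0_abs.
    pose M := (\sum_i `|tnth c i| + r + r^-1)%R.
    have cM i : (`|tnth c i| + r <= M)%R.
      rewrite /M (bigD1 i)//= -!addrA lerD2l.
      rewrite -[leLHS]add0r; apply: lerD; first exact: sumr_ge0.
      by rewrite lerDl invr_ge0 ltW.
    have [k1 Mk1] : exists k1 : nat, (M <= 2 ^+ k1)%R.
      exists (Num.truncn M).+1; apply: (le_trans (ltW (truncnS_gt M))).
      by rewrite -natrX ler_nat ltnW// ltn_expl.
    apply: (@limn_einf_glb _ _ _ (maxn k1 j.+1)) => k.
    rewrite geq_max => /andP[k1k jk]; rewrite /b jk.
    have Mk : (M <= 2 ^+ k)%R.
      by apply: (le_trans Mk1); rewrite ler_weXn2l// ler1n.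
    have hr : (h k <= r)%R.
      rewrite /h -[leRHS]invrK lef_pV2 ?posrE ?invr_gt0 ?exprn_gt0//.
      apply: le_trans Mk; rewrite /M lerDr addr_ge0 ?(ltW r0)//.
      exact: sumr_ge0.
    have w1 i : (o k <= tnth c i - r)%R.
      have := le_trans (cM i) Mk; have := ler_norm (- tnth c i)%R.
      by rewrite normrN /o; lra.
    have w2 i : (tnth c i + r <= o k + (2 ^ m k)%:R * h k)%R.
      have := le_trans (cM i) Mk; have := ler_norm (tnth c i).
      by rewrite ohm; lra.
    have [d dx _] : exists2 d : n.-tuple 'I_(2 ^ m k), incube (o k) (h k) d x &
        forall i, tnth d i = cell_index (o k) (h k) (tnth x i) :> nat.
      apply: cell_exists => // i; have := eball_coord i cx; rewrite ltr_distl.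
      move=> /andP[x1 x2]; rewrite (le_trans (w1 i) (ltW x1))/=.
      exact: lt_le_trans x2 (w2 i).
    rewrite (step_in (h0 k) _ dx) -EFinM.
    exact: (ball_average_le (h0 k) n0 (mf j) (f0 j) (phi0 k j) (phiE k j)
      hr w1 w2 cx dx).
  have HL0 j : 0 <= HL_max (f j) x by exact: HL_max_ge0.
  apply: (le_trans (lv_le v0 HL0 HLb)).
  rewrite lvE//; last by move=> j; exact: limn_einf_ge0.
  apply: (le_trans (fatou_Lnorm _ v0 _ _)) => //.
  apply: le_limn_einf => k; rewrite -lvE//.
  have -> : lv v (b k) = k0%:E * lv v (fun j => if (j < k)%N then
      (step (o k) (h k) (a k j) x)%:E else 0).
    apply: lvZ => //; first exact: ltW.
    by move=> j; case: ifP => // _; rewrite lee_fin step_ge0.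
  apply: lee_wpmul2l; first by rewrite lee_fin ltW.
  have lvI (u : nat -> R) : (forall j, (0 <= u j)%R) ->
      lv v (fun j => if (j < k)%N then (u j)%:E else 0) =
      (lpnorm 1 v (fun j : 'I_k => u j))%:E.
    move=> u0; rewrite /lv (nneseries_split 0 k); last first.
      by move=> j _; exact: poweR_ge0.
    rewrite add0n [X in _ + X]eseries0 ?adde0; last first.
      by move=> j kj _; rewrite ltnNge kj poweR0r// gt_eqF.
    rewrite big_mkord /lpnorm mul1r -poweR_EFin -sumEFin; congr (_ `^ _).
    by apply: eq_bigr => j _; rewrite ltn_ord poweR_EFin ger0_norm.
  rewrite lvI; last by move=> j; exact: step_ge0.
  rewrite /G lee_fin.
  have [[d dx]|nx] := pselect (exists d : n.-tuple 'I_(2 ^ m k),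
      incube (o k) (h k) d x).
    rewrite (step_in (h0 k) _ dx) /psi; apply: lpnorm_le => // j.
    by rewrite (step_in (h0 k) _ dx).
  rewrite [leLHS](_ : _ = 0%R) ?step_ge0//.
  rewrite /lpnorm big1 ?mulr0 ?powR0 ?invr_neq0 ?gt_eqF// => j _.
  rewrite step_out ?normr0 ?powR0 ?gt_eqF// => d.
  by apply/negP => dx; apply: nx; exists d.
- apply: (le_trans (fatou_mixed_norm hp mG' G'0)).
  apply: limn_einf_lub => k; apply: (@le_trans _ _ (mixed_norm p (G' k))).
    by apply: ereal_inf_lbound; exists k => /=.
  apply: (le_trans (mixed_normZ_le _ hp c0)).
  rewrite EFinM -muleA; apply: lee_wpmul2l; first by rewrite lee_fin ltW.
  apply: (le_trans (Gb k)); apply: lee_wpmul2r => //.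
  by rewrite lee_fin lerDl.
Qed.

End maximal_inequality.

(** * The local estimate *)

Section local_estimate.
Set Implicit Arguments.
Unset Strict Implicit.
Context {R : realType} (n : nat).
Hypothesis n0 : (0 < n)%N.
Implicit Types (x y : Rn R n) (g : Rn R n -> \bar R).

Local Notation kappa := (4 * n%:R : R)%R.

Let kappa0 : (0 < kappa)%R.
Proof. by rewrite mulr_gt0// ltr0n. Qed.

(** Each coordinate of [y] is at most [3 M] in absolute value. *)
Lemma enorm_ball_le x y (b : Rn R n) (r rho M : R) :
  (enorm x < r)%R -> eball b rho x -> eball b rho y -> (r <= M)%R ->
  (rho <= M)%R -> (enorm y < kappa * M)%R.
Proof.
move=> xr bx by_ rM rhoM.
have xi i : (`|tnth x i| < r)%R.
  have := @eball_coord _ _ (origin n) x r i; rewrite eball_origin.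
  by move=> /(_ xr); rewrite tnth_mktuple subr0.
have M0 : (0 < M)%R.
  by apply: lt_le_trans rM; apply: le_lt_trans xr; exact: sqrtr_ge0.
have yi i : (`|tnth y i| <= 3 * M)%R.
  have h1 := eball_coord i bx; have h2 := eball_coord i by_; have h3 := xi i.
  have -> : tnth y i = (tnth y i - tnth b i - (tnth x i - tnth b i) + tnth x i)%R.
    by ring.
  apply: (le_trans (ler_normD _ _)).
  have := ler_normB (tnth y i - tnth b i)%R (tnth x i - tnth b i)%R; lra.
have M30 : (0 <= 3 * M)%R by rewrite mulr_ge0// ltW.
apply: (le_lt_trans (sqrt_sum_le M30 yi)).
have -> : (kappa * M = n%:R * (4 * M))%R by ring.
by rewrite ltr_pM2l ?ltr0n// ltr_pM2r// ltr_nat.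
Qed.

(** A dyadic version of [max(r, |y|)^(- n)]. *)
Definition tail_kernel (r : R) y : \bar R :=
  \sum_(0 <= k <oo) (((2 ^+ k * r) ^- n)%:E *
    (\1_(eball (origin n) (2 ^+ k.+1 * r)%R) y)%:E).

Lemma tail_kernel_term_ge0 (r : R) y k : (0 < r)%R ->
  0 <= ((2 ^+ k * r) ^- n)%:E *
    (\1_(eball (origin n) (2 ^+ k.+1 * r)%R) y)%:E :> \bar R.
Proof.
move=> r0; have kr0 : (0 <= 2 ^+ k * r)%R by rewrite mulr_ge0 ?exprn_ge0 ?ltW.
by rewrite -EFinM lee_fin mulr_ge0 ?invr_ge0 ?exprn_ge0.
Qed.

Lemma tail_kernel_ge0 (r : R) y : (0 < r)%R -> 0 <= tail_kernel r y.
Proof. by move=> r0; apply: nneseries_ge0 => k _ _; exact: tail_kernel_term_ge0. Qed.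

Lemma tail_kernel_ge (r M : R) y : (0 < r)%R -> (r <= M)%R -> (enorm y < M)%R ->
  (M ^- n)%:E <= tail_kernel r y.
Proof.
move=> r0 rM yM; have M0 : (0 < M)%R by exact: lt_le_trans rM.
have ex : exists k, (enorm y < 2 ^+ k.+1 * r)%R.
  exists (Num.truncn (enorm y / r)).+1.
  rewrite -ltr_pdivrMr//; apply: (lt_trans (truncnS_gt _)).
  rewrite -natrX ltr_nat; apply: (@leq_trans (2 ^ (Num.truncn (enorm y / r)).+1)%N).
    exact: ltn_expl.
  by rewrite leq_exp2l.
have [k yk kmin] := ex_minnP ex.
have kM : (2 ^+ k * r <= M)%R.
  case: k yk kmin => [|k] yk kmin; first by rewrite expr0 mul1r.
  apply: le_trans (ltW yM); rewrite leNgt; apply/negP => h.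
  by have := kmin k h; rewrite ltnn.
have kr0 : (0 < 2 ^+ k * r)%R by rewrite mulr_gt0// exprn_gt0.
apply: le_trans (nneseries_lim_ge k.+1 (fun i _ _ => tail_kernel_term_ge0 y i r0)).
rewrite big_nat_recr//=; apply: (@le_trans _ _ (((2 ^+ k * r) ^- n)%:E *
    (\1_(eball (origin n) (2 ^+ k.+1 * r)%R) y)%:E)); last first.
  by rewrite leeDr// sume_ge0// => i _; exact: tail_kernel_term_ge0.
rewrite indicE mem_set ?mule1; last by rewrite eball_origin.
by rewrite lee_fin lef_pV2 ?posrE ?exprn_gt0// lerXn2r ?nnegrE ?(ltW kr0) ?(ltW M0).
Qed.

Lemma measurable_tail_kernel (r : R) : (0 < r)%R ->
  measurable_fun setT (tail_kernel r).
Proof.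
move=> r0; apply: ge0_emeasurable_sum => [k y _ _|k _].
  exact: tail_kernel_term_ge0.
apply: measurable_funeM; apply/measurable_EFinP/measurable_indic.
exact: measurable_eball.
Qed.

(** A ball that meets the ball of radius [r] is either contained in a multiple
    of that ball, or so large that its average is seen by the kernel. *)
Lemma HL_max_le_local (r : R) x g : (0 < r)%R -> (enorm x < r)%R ->
  measurable_fun setT g -> (forall y, 0 <= g y) ->
  HL_max g x <= HL_max (g \_ (eball (origin n) (kappa * r)%R)) x +
    ((n%:R * kappa) ^+ n)%:E * \int[@lebRn R n]_y (tail_kernel r y * g y).
Proof.
move=> r0 xr mg g0; set h := g \_ _.
have I0 : 0 <= \int[@lebRn R n]_y (tail_kernel r y * g y).
  by apply: integral_ge0 => y _; rewrite mule_ge0// tail_kernel_ge0.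
have c0 : (0 <= (n%:R * kappa) ^+ n)%R.
  by rewrite exprn_ge0// mulr_ge0// ltW.
have HL0 := HL_max_ge0 h x.
apply: ge_ereal_sup => _ [[b rho] /= bx <-].
have rho0 : (0 < rho)%R by apply: le_lt_trans bx; exact: sqrtr_ge0.
have [rhor|rrho] := leP rho r.
  apply: (@le_trans _ _ (HL_max h x)); last by rewrite leeDl// mule_ge0.
  apply: le_trans (ereal_sup_ubound _); last by exists (b, rho).
  apply: lee_wpmul2l; first by rewrite inve_ge0.
  rewrite le_eqVlt; apply/orP; left; apply/eqP.
  apply: eq_integral => y; rewrite inE => yb; rewrite /h /patch mem_set//.
  by rewrite eball_origin; exact: (enorm_ball_le xr bx yb).
apply: (@le_trans _ _ (((n%:R * kappa) ^+ n)%:E *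
    \int[@lebRn R n]_y (tail_kernel r y * g y))); last by rewrite leeDr.
have kr : (0 < kappa * rho)%R by rewrite mulr_gt0.
have -> : ((n%:R * kappa) ^+ n = (n%:R / rho) ^+ n * (kappa * rho) ^+ n)%R.
  by rewrite -exprMn; congr (_ ^+ n)%R; field; rewrite gt_eqF.
rewrite EFinM -muleA; apply: lee_pmul.
- by rewrite inve_ge0.
- by apply: integral_ge0 => y _; exact: abse_ge0.
- exact: lebRn_eball_inv_le.
rewrite -ge0_integralZl_EFin//; last 3 first.
- by move=> y _; rewrite mule_ge0// tail_kernel_ge0.
- by apply: emeasurable_funM => //; exact: measurable_tail_kernel.
- by rewrite exprn_ge0// ltW.
rewrite [leLHS]integral_mkcond; apply: le_integral_ge0 => y.
  by rewrite /patch; case: ifP.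
rewrite /patch; case: ifPn => [|_]; last first.
  by rewrite !mule_ge0 ?tail_kernel_ge0// lee_fin exprn_ge0// ltW.
rewrite inE => yb; rewrite gee0_abs// muleA -[leLHS]mul1e.
apply: lee_wpmul2r => //.
have yk := enorm_ball_le xr bx yb (ltW rrho) (lexx rho).
have rk : (r <= kappa * rho)%R.
  apply: (le_trans (ltW rrho)); rewrite ler_peMl ?(ltW rho0)//.
  by rewrite -natrM ler1n muln_gt0.
have := tail_kernel_ge r0 rk yk => H.
have kn : (0 < (kappa * rho) ^+ n)%R by exact: exprn_gt0.
apply: (@le_trans _ _ (((kappa * rho) ^+ n)%:E * ((kappa * rho) ^- n)%:E)).
  by rewrite -EFinM mulfV ?lexx//; exact: lt0r_neq0.
by apply: lee_wpmul2l; rewrite ?lee_fin ?(ltW kn).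
Qed.

Lemma mixed_norm_cst_ball_le (p : n.-tuple (\bar R)) (r : R) (t : \bar R) :
  (0 < r)%R -> good_exponents p -> 0 <= t ->
  mixed_norm p (fun x => t * (\1_(eball (origin n) r) x)%:E) <=
  t * ((2 * r) `^ sum_inv p)%:E.
Proof.
move=> r0 hp; have h0 : (0 < 2 * r)%R by rewrite mulr_gt0.
case: t => [t||]//; last first.
  by move=> _; rewrite gt0_mulye ?leey// lte_fin powR_gt0.
rewrite lee_fin => t0.
apply: (@le_trans _ _ (mixed_norm p (fun x =>
    (step (- r) (2 * r) (fun _ : n.-tuple 'I_1 => t) x)%:E))).
  apply: mixed_norm_le => // x; rewrite -EFinM !gee0_abs ?lee_fin//; last 2 first.
  - exact: step_ge0.
  - exact: mulr_ge0.
  rewrite indicE; case: (boolP (x \in _)) => [|_]; last first.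
    by rewrite mulr0; exact: step_ge0.
  by rewrite inE => bx; rewrite (step_in h0 _ (eball_in_cell bx)) mulr1.
apply: (le_trans (mixed_norm_step _ h0 hp (fun=> t0))).
by rewrite (dmix_one_cell h0 t0 hp).
Qed.

Variables (p : n.-tuple (\bar R)) (hp : good_exponents p).
Notation S := (sum_inv p).

Definition ball_norm (F : Rn R n -> \bar R) (t : R) :=
  mixed_norm p (F \_ (eball (origin n) t)).

Lemma le_ball_norm (F : Rn R n -> \bar R) (s t : R) :
  (forall y, 0 <= F y) -> (s <= t)%R -> ball_norm F s <= ball_norm F t.
Proof.
move=> F0 st; apply: mixed_norm_le => // y; rewrite /patch.
case: ifPn => [|_]; last by rewrite abse0 abse_ge0.
rewrite inE eball_origin => ys; rewrite ifT// inE eball_origin.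
exact: lt_le_trans st.
Qed.

(** Hoelder's inequality on each of the balls that make up the kernel. *)
Lemma integral_tail_kernel_le (F : Rn R n -> \bar R) (r : R) : (0 < r)%R ->
  measurable_fun setT F -> (forall y, 0 <= F y) ->
  \int[@lebRn R n]_y (tail_kernel r y * F y) <=
  (4 ^+ n)%:E * \sum_(0 <= k <oo)
    (((2 ^+ k.+1 * r) `^ (- S))%:E * ball_norm F (2 ^+ k.+1 * r)%R).
Proof.
move=> r0 mF F0.
pose t k : R := (2 ^+ k * r)%R.
have t0 k : (0 < t k)%R by rewrite mulr_gt0// exprn_gt0.
have S0 := sum_inv_ge0 hp.
have m1 k : measurable_fun setT
    (fun y => ((t k ^- n)%:E * (\1_(eball (origin n) (t k.+1)) y)%:E) * F y).
  apply: emeasurable_funM => //; apply: measurable_funeM.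
  by apply/measurable_EFinP/measurable_indic; exact: measurable_eball.
have p1 k y : 0 <= ((t k ^- n)%:E * (\1_(eball (origin n) (t k.+1)) y)%:E) * F y.
  by rewrite mule_ge0// tail_kernel_term_ge0.
have mulF y : tail_kernel r y * F y <= \sum_(0 <= k <oo)
    (((t k ^- n)%:E * (\1_(eball (origin n) (t k.+1)) y)%:E) * F y).
  have := p1 ^~ y; have := F0 y; case: (F y) => [z||]//.
    rewrite lee_fin => z0 _; rewrite muleC -nneseriesZl; last first.
      by move=> k _; exact: tail_kernel_term_ge0.
    rewrite le_eqVlt; apply/orP; left; apply/eqP.
    by apply: eq_eseriesr => k _; rewrite muleC.
  move=> _ q1; have [->|K0] := eqVneq (tail_kernel r y) 0.
    by rewrite mul0e nneseries_ge0.
  have [k kpos] : exists k, 0 < (t k ^- n)%:E *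
      (\1_(eball (origin n) (t k.+1)) y)%:E :> \bar R.
    apply: contrapT => /forallNP h; move/eqP: K0; apply.
    rewrite /tail_kernel eseries0// => k _ _; apply/eqP.
    by rewrite eq_le tail_kernel_term_ge0// andbT leNgt; apply/negP/h.
  apply: le_trans (nneseries_lim_ge k.+1 (fun i _ _ => q1 i)).
  rewrite big_nat_recr//=; apply: (@le_trans _ _ +oo); first exact: leey.
  rewrite [X in _ + X]gt0_muley// addey ?leey//.
  by rewrite -ltNye (lt_le_trans ltNy0)// sume_ge0// => i _; exact: q1.
apply: (@le_trans _ _ (\sum_(0 <= k <oo) \int[@lebRn R n]_y
      (((t k ^- n)%:E * (\1_(eball (origin n) (t k.+1)) y)%:E) * F y))).
  rewrite -integral_nneseries//; apply: le_integral_ge0 => // y.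
  by rewrite mule_ge0// tail_kernel_ge0.
rewrite -nneseriesZl; last first.
  by move=> k _; rewrite mule_ge0 ?mixed_norm_ge0// lee_fin powR_ge0.
apply: lee_nneseries => [k _ _|k _]; first by apply: integral_ge0 => y _; exact: p1.
have tkn : (0 <= t k ^- n)%R by rewrite invr_ge0 exprn_ge0// ltW.
apply: (@le_trans _ _ ((t k ^- n)%:E *
    \int[@lebRn R n]_y (F \_ (eball (origin n) (t k.+1))) y)).
  have -> : \int[@lebRn R n]_y
      (((t k ^- n)%:E * (\1_(eball (origin n) (t k.+1)) y)%:E) * F y) =
      \int[@lebRn R n]_y ((t k ^- n)%:E * (F \_ (eball (origin n) (t k.+1))) y).
    apply: eq_integral => y _; rewrite -muleA; congr (_ * _).
    by rewrite indicE /patch; case: ifP => _; rewrite ?mul1e ?mul0e.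
  rewrite ge0_integralZl_EFin//.
  - by move=> y _; rewrite /patch; case: ifP.
  - apply/(measurable_restrict _ (measurable_eball _ _)) => //.
    by rewrite setTI; exact: measurable_funS mF.
apply: (@le_trans _ _ ((t k ^- n)%:E *
    (((2 * t k.+1) ^+ n * (2 * t k.+1) `^ (- S))%:E * ball_norm F (t k.+1)))).
  by apply: lee_wpmul2l; [rewrite lee_fin|exact: integral_ball_le].
rewrite !muleA -!EFinM; apply: lee_wpmul2r; first exact: mixed_norm_ge0.
have -> : (2 * t k.+1 = 4 * t k)%R by rewrite /t exprS; ring.
have tn0 : (t k ^+ n != 0)%R by rewrite expf_neq0// gt_eqF.
have cancel_mid (a b c : R) : c != 0%R -> (c^-1 * (a * c * b) = a * b)%R.
  by move=> c0; field.
have -> : ((4 * t k) ^+ n = 4 ^+ n * t k ^+ n)%R by exact: exprMn.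
rewrite lee_fin (cancel_mid (4 ^+ n)%R _ (t k ^+ n)%R)//.
apply: ler_wpM2l; first exact: exprn_ge0.
have -> : (2 ^+ k.+1 * r = 2 * t k)%R by rewrite /t exprS mulrA.
rewrite !powRN lef_pV2 ?posrE ?powR_gt0 ?mulr_gt0//.
apply: le_powR => //; first by rewrite mulr_ge0// ltW.
by rewrite ler_wpM2r ?(ltW (t0 k))// ler_nat.
Qed.

End local_estimate.

(** * From the tail to the Hardy operator *)

Section hardy.
Set Implicit Arguments.
Unset Strict Implicit.
Context {R : realType} (n : nat) (p : n.-tuple (\bar R)).
Hypothesis hp : good_exponents p.
Variable F : Rn R n -> \bar R.
Hypothesis F0 : forall y, 0 <= F y.
Local Notation S := (sum_inv p).
Local Notation mu := (@lebesgue_measure R).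

(** The function to which the boundedness of [H^*] is applied. *)
Definition hardy_density (t : R) := (t `^ (- S - 1))%:E * ball_norm p F t.

Lemma ball_norm_ge0 t : 0 <= ball_norm p F t.
Proof. exact: mixed_norm_ge0. Qed.

Lemma hardy_density_ge0 t : 0 <= hardy_density t.
Proof. by rewrite mule_ge0 ?lee_fin ?powR_ge0 ?ball_norm_ge0. Qed.

Lemma measurable_ball_norm : measurable_fun setT (ball_norm p F).
Proof.
apply: (measurability _ (ErealGenOInfty.measurableE R)).
move=> _ [_ [c ->] <-]; rewrite setTI.
apply: is_interval_measurable => s t /= + _ u /andP[su _].
rewrite !in_itv/= !andbT => h; apply: (lt_le_trans h).
exact: le_ball_norm.
Qed.

Lemma measurable_hardy_density : measurable_fun setT hardy_density.
Proof.
apply: emeasurable_funM; last exact: measurable_ball_norm.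
apply/measurable_EFinP.
exact: measurable_powR.
Qed.

(** The norm over a ball only increases with the ball, so that its value at the
    left end of a dyadic interval is bounded by an average over the interval. *)
Lemma ball_norm_le_hardy (a : R) : (0 < a)%R ->
  (a `^ (- S))%:E * ball_norm p F a <=
  (2 `^ (S + 1))%:E * \int[mu]_(t in `]a, (2 * a)%R]) hardy_density t.
Proof.
move=> a0; have a20 : (0 < 2 * a)%R by rewrite mulr_gt0.
have S0 := sum_inv_ge0 hp.
have aa : (a < 2 * a)%R by rewrite ltr_pMl// ltr1n.
have -> : (a `^ (- S) = 2 `^ (S + 1) * ((2 * a) `^ (- S - 1) * a))%R.
  have -> : (- S - 1 = - (S + 1))%R by rewrite opprD.
  rewrite powRM ?(ltW a0)// !powRN powRD; last by apply/implyP => _; rewrite gt_eqF.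
  rewrite (@powRD _ a); last by apply/implyP => _; rewrite gt_eqF.
  rewrite !powRr1 ?(ltW a0)//.
  have := powR_gt0 S a0; have := powR_gt0 S (ltr0n R 2).
  move: (2 `^ S)%R (a `^ S)%R => b c b0 c0.
  by field; rewrite ?gt_eqF.
rewrite EFinM -muleA; apply: lee_wpmul2l; first by rewrite lee_fin powR_ge0.
apply: (@le_trans _ _ (\int[mu]_(t in `]a, (2 * a)%R])
    cst (((2 * a) `^ (- S - 1))%:E * ball_norm p F a) t)).
  have I : mu `]a, (2 * a)%R] = a%:E.
    rewrite lebesgue_measure_itv/= lte_fin aa -EFinB; congr _%:E; ring.
  rewrite EFinM muleAC -I -integral_cst//.
rewrite [leLHS]integral_mkcond [leRHS]integral_mkcond.
apply: le_integral_ge0 => t; rewrite /patch; case: ifP => //.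
  by move=> _; rewrite mule_ge0 ?lee_fin ?powR_ge0 ?ball_norm_ge0.
rewrite inE/= in_itv/= => /andP[at_ ta]; have t0 := lt_trans a0 at_.
apply: lee_pmul; rewrite ?lee_fin ?powR_ge0 ?ball_norm_ge0//; last first.
  exact: le_ball_norm (ltW at_).
have -> : (- S - 1 = - (S + 1))%R by rewrite opprD.
rewrite !powRN lef_pV2 ?posrE ?powR_gt0//.
by apply: le_powR => //; [rewrite addr_ge0|exact: ltW].
Qed.

Lemma integral_hardy_le_Hstar (r a b : R) : (r <= a)%R ->
  \int[mu]_(t in `]a, b]) hardy_density t <= Hstar hardy_density r.
Proof.
move=> ra; apply: ge0_subset_integral => //.
- by apply: measurable_funS measurable_hardy_density.
- by move=> t _; exact: hardy_density_ge0.
- move=> t /=; rewrite !in_itv/= andbT => /andP[at_ _]; exact: le_lt_trans at_.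
Qed.

(** The dyadic intervals are disjoint and lie in [(r, +oo)]. *)
Lemma dyadic_tail_le_Hstar (r : R) : (0 < r)%R ->
  \sum_(0 <= k <oo)
    (((2 ^+ k.+1 * r) `^ (- S))%:E * ball_norm p F (2 ^+ k.+1 * r)%R) <=
  (2 `^ (S + 1))%:E * Hstar hardy_density r.
Proof.
move=> r0; pose t k : R := (2 ^+ k * r)%R.
have t0 k : (0 < t k)%R by rewrite mulr_gt0// exprn_gt0.
have tS k : (2 * t k = t k.+1)%R by rewrite /t exprS mulrA.
have tm : {homo t : i j / (i <= j)%N >-> (i <= j)%R}.
  by move=> i j ij; rewrite ler_wpM2r ?(ltW r0)// ler_weXn2l// ler1n.
pose D k : set R := [set` `]t k.+1, t k.+2]].
have I0 k : 0 <= \int[mu]_(x in D k) hardy_density x.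
  by apply: integral_ge0 => x _; exact: hardy_density_ge0.
apply: (@le_trans _ _ (\sum_(0 <= k <oo)
    ((2 `^ (S + 1))%:E * \int[mu]_(x in D k) hardy_density x))).
  apply: lee_nneseries => [k _ _|k _].
    by rewrite mule_ge0 ?ball_norm_ge0// lee_fin powR_ge0.
  by have := ball_norm_le_hardy (t0 k.+1); rewrite tS.
rewrite nneseriesZl//; apply: lee_wpmul2l; first by rewrite lee_fin powR_ge0.
have DT : \bigcup_k D k `<=` `]r, +oo[.
  move=> x [k _] /=; rewrite !in_itv/= andbT => /andP[h _].
  apply: le_lt_trans h; have := tm 0%N k.+1 isT; by rewrite /t expr0 mul1r.
have mD k : measurable (D k) by exact: measurable_itv.
have mU : measurable (\bigcup_k D k) by exact: bigcup_measurable.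
rewrite -ge0_integral_bigcup//.
- apply: ge0_subset_integral => //.
    by apply: measurable_funS measurable_hardy_density.
  by move=> x _; exact: hardy_density_ge0.
- by apply: measurable_funS measurable_hardy_density.
- by move=> x _; exact: hardy_density_ge0.
- apply: ltn_trivIset => i j ij; apply/seteqP; split => // x []; rewrite /D /=.
  rewrite !in_itv/= => /andP[_ xj] /andP[xi _].
  by have := tm j.+2 i.+1 ij; rewrite leNgt => /negP; apply; exact: lt_le_trans xj.
Qed.

End hardy.

Section local_maximal.
Set Implicit Arguments.
Unset Strict Implicit.
Context {R : realType} (n : nat).
Hypothesis n0 : (0 < n)%N.
Local Notation kappa := (4 * n%:R : R)%R.


Lemma lv_scale_le v (k : \bar R) (f : nat -> \bar R) : (0 < v)%R -> 0 <= k ->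
  (forall j, 0 <= f j) -> lv v (fun j => k * f j) <= k * lv v f.
Proof.
move=> v0 k0 f0; case: k k0 => [k||//]; first by rewrite lee_fin => k0; rewrite lvZ.
move=> _; have [lv0|fn0] := eqVneq (lv v f) 0; last first.
  by rewrite gt0_mulye ?leey// lt_def fn0 lv_ge0.
rewrite lv0 mule0 -lv0; apply: lv_le => // j; first by rewrite mule_ge0.
have -> : f j = 0 by apply/eqP; rewrite eq_le f0 andbT -lv0 le_lv.
by rewrite mule0.
Qed.

Lemma lv_addition_le v (f g : nat -> \bar R) : (1 < v)%R ->
  (forall j, 0 <= f j) -> (forall j, 0 <= g j) ->
  lv v (fun j => f j + g j) <= 4%:E * (lv v f + lv v g).
Proof.
move=> v1 f0 g0; have v0 : (0 < v)%R by exact: lt_trans v1.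
rewrite !lvE//; last by move=> j; exact: adde_ge0.
exact: Lnorm_addition_le.
Qed.

(** The part of [f] close to the ball is handled by the maximal inequality; the
    part far from it contributes a constant, namely an integral against the tail
    kernel, which the growth of the ball norms turns into a Hardy operator. *)
Lemma local_maximal_estimate (p : n.-tuple (\bar R)) (v : R) :
  good_exponents p -> (1 < v)%R ->
  exists2 C : R, (0 < C)%R & forall f : nat -> Rn R n -> \bar R,
  (forall j, measurable_fun setT (f j)) -> (forall j x, 0 <= f j x) ->
  forall r : R, (0 < r)%R ->
  ball_norm p (fun x => lv v (fun j => HL_max (f j) x)) r <=
  (C * r `^ sum_inv p)%:E *
    Hstar (hardy_density p (fun x => lv v (f ^~ x))) r.
Proof.
move=> hp v1; have v0 : (0 < v)%R by exact: lt_trans v1.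
have [C0 C00 HC] := maximal_inequality n0 hp v1.
have S0 := sum_inv_ge0 hp; have k0 : (0 < kappa)%R by rewrite mulr_gt0// ltr0n.
have k1 : (1 <= kappa)%R by rewrite -natrM ler1n muln_gt0.
pose c : R := ((n%:R * kappa) ^+ n)%R.
have c0 : (0 < c)%R by rewrite exprn_gt0// mulr_gt0// ltr0n.
pose S := sum_inv p.
pose h : R := (2 `^ (S + 1))%R.
have h0 : (0 < h)%R by exact: powR_gt0.
pose a1 : R := (C0 * (kappa `^ S * h))%R.
pose a2 : R := (c * (4 ^+ n * h) * 2 `^ S)%R.
have a10 : (0 < a1)%R by rewrite !mulr_gt0// powR_gt0.
have q4 : (0 < 4 ^+ n :> R)%R by exact: exprn_gt0.
have a20 : (0 < a2)%R.
  apply: mulr_gt0; last exact: powR_gt0.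
  by apply: mulr_gt0 => //; exact: mulr_gt0.
exists (4 * (4 ^+ n * (a1 + a2)))%R.
  by rewrite mulr_gt0// mulr_gt0// addr_gt0.
move=> f mf f0 r r0; set F := fun x => lv v (f ^~ x); set H := Hstar _ r.
have F0 y : 0 <= F y by exact: lv_ge0.
have mF : measurable_fun setT F by exact: measurable_lv.
have H0 : 0 <= H.
  by apply: integral_ge0 => t _; exact: hardy_density_ge0.
have kr0 : (0 < kappa * r)%R by rewrite mulr_gt0.
pose B t := eball (@origin R n) t.
pose f' j := f j \_ (B (kappa * r)%R).
have f'0 j x : 0 <= f' j x by rewrite /f' /patch; case: ifP.
have mf' j : measurable_fun setT (f' j).
  apply/(measurable_restrict _ (measurable_eball _ _)) => //.
  by rewrite setTI; exact: measurable_funS (mf j).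
have [G [mG G0 HG nG]] := HC f' mf' f'0.
pose I j := \int[@lebRn R n]_y (tail_kernel r y * f j y).
have I0 j : 0 <= I j.
  by apply: integral_ge0 => y _; rewrite mule_ge0// tail_kernel_ge0.
pose J := \int[@lebRn R n]_y (tail_kernel r y * F y).
have J0 : 0 <= J.
  by apply: integral_ge0 => y _; rewrite mule_ge0// tail_kernel_ge0.
have lvI : lv v I <= J.
  pose u j y := tail_kernel r y * f j y.
  apply: (le_trans (@lv_integral_le _ _ _ (@lebRn R n) v u v1 _ _)) => [j|j x|].
  - by apply: emeasurable_funM => //; exact: measurable_tail_kernel.
  - by rewrite mule_ge0// tail_kernel_ge0.
  apply: le_integral_ge0 => y; first exact: lv_ge0.
  by apply: lv_scale_le => //; exact: tail_kernel_ge0.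
have point x : B r x -> lv v (fun j => HL_max (f j) x) <=
    4%:E * (G x + c%:E * J).
  rewrite /B eball_origin => xr.
  apply: (@le_trans _ _ (lv v (fun j => HL_max (f' j) x + c%:E * I j))).
    apply: lv_le => // j; first exact: HL_max_ge0.
    exact: HL_max_le_local.
  apply: (le_trans (lv_addition_le v1 _ _)) => [j|j|]; first exact: HL_max_ge0.
    by rewrite mule_ge0// lee_fin ltW.
  apply: lee_wpmul2l => //; apply: leeD => //.
  apply: (le_trans (lv_scale_le _ _ _)) => //; first by rewrite lee_fin ltW.
  by apply: lee_wpmul2l => //; rewrite lee_fin ltW.
have near_le : mixed_norm p G <= (a1 * r `^ S)%:E * H.
  apply: (le_trans nG).
  apply: (@le_trans _ _ (C0%:E * ball_norm p F (kappa * r)%R)).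
    apply: lee_wpmul2l; first by rewrite lee_fin ltW.
    apply: mixed_norm_le => // x; rewrite gee0_abs ?lv_ge0//.
    rewrite /patch; case: ifPn => xB.
      rewrite gee0_abs//; apply: lv_le => // j; rewrite /f' /patch xB; exact: lexx.
    rewrite abse0; apply: (@le_trans _ _ (lv v (fun _ : nat => 0%:E * 0))).
      by apply: lv_le => // j; rewrite /f' /patch (negbTE xB) mule0.
    by rewrite lvZ// mul0e.
  have -> : (a1 * r `^ S = C0 * ((kappa * r) `^ S * h))%R.
    by rewrite powRM ?(ltW k0) ?(ltW r0)// /a1; ring.
  rewrite EFinM -muleA; apply: lee_wpmul2l; first by rewrite lee_fin ltW.
  have -> : ball_norm p F (kappa * r)%R = ((kappa * r) `^ S)%:E *
      (((kappa * r) `^ (- S))%:E * ball_norm p F (kappa * r)%R).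
    by rewrite muleA -EFinM powRN mulfV ?mul1e// gt_eqF// powR_gt0.
  rewrite EFinM -muleA; apply: lee_wpmul2l; first by rewrite lee_fin powR_ge0.
  apply: (le_trans (ball_norm_le_hardy hp F0 kr0)).
  apply: lee_wpmul2l; first by rewrite lee_fin ltW.
  by apply: integral_hardy_le_Hstar => //; rewrite ler_peMl// ltW.
have far_le : mixed_norm p (fun x => (c%:E * J) * (\1_(B r) x)%:E) <=
    (a2 * r `^ S)%:E * H.
  have cJ : 0 <= c%:E * J by rewrite mule_ge0// lee_fin ltW.
  apply: (le_trans (mixed_norm_cst_ball_le r0 hp cJ)).
  have -> : (a2 * r `^ S = (c * (4 ^+ n * h)) * (2 * r) `^ S)%R.
    by rewrite powRM ?(ltW r0)// /a2; ring.
  rewrite EFinM [leRHS]muleAC; apply: lee_wpmul2r.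
    by rewrite lee_fin powR_ge0.
  rewrite EFinM -muleA; apply: lee_wpmul2l; first by rewrite lee_fin ltW.
  apply: (le_trans (integral_tail_kernel_le hp r0 mF F0)).
  rewrite EFinM -muleA; apply: lee_wpmul2l; first by rewrite lee_fin exprn_ge0.
  exact: dyadic_tail_le_Hstar.
apply: (@le_trans _ _ (mixed_norm p (fun x =>
    4%:E * (G x + (c%:E * J) * (\1_(B r) x)%:E)))).
  apply: mixed_norm_le => // x; rewrite /patch; case: ifPn => xB; last first.
    by rewrite abse0 abse_ge0.
  rewrite indicE xB mule1 !gee0_abs ?lv_ge0//; first by apply: point; rewrite inE in xB.
  by rewrite mule_ge0// adde_ge0// mule_ge0// lee_fin ltW.
apply: (le_trans (mixed_normZ_le _ hp _)) => //.
rewrite -2!mulrA EFinM -muleA; apply: lee_wpmul2l => //.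
have m2 : measurable_fun setT (fun x => (c%:E * J) * (\1_(B r) x)%:E).
  apply: measurable_funeM; apply/measurable_EFinP/measurable_indic.
  exact: measurable_eball.
apply: (le_trans (mixed_norm_addition_le hp mG m2 G0 _)) => [x|].
  by rewrite !mule_ge0// lee_fin ltW.
rewrite EFinM -muleA; apply: lee_wpmul2l; first by rewrite lee_fin exprn_ge0.
rewrite mulrDl EFinD ge0_muleDl; first exact: leeD.
- exact: mulr_ge0 (ltW a10) (powR_ge0 _ _).
- exact: mulr_ge0 (ltW a20) (powR_ge0 _ _).
Qed.

End local_maximal.

(** * Lebesgue measurable functions *)

Section lebesgue_measurable.
Set Implicit Arguments.
Unset Strict Implicit.
Context d (T : measurableType d) (R : realType).
Variable mu : {measure set T -> \bar R}.

Lemma lmeasurable_fun_borel d' (U : measurableType d') (D : set T) (f : T -> U) :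
  measurable D -> measurable_fun setT f -> lmeasurable_fun mu D f.
Proof.
move=> mD mf _ Y mY; apply: sub_sigma_algebra.
exists (D `&` f @^-1` Y); last by exists set0; [exact: negligible_set0|rewrite setU0].
by apply: measurableI => //; rewrite -[X in measurable X]setTI; exact: mf.
Qed.

(** The sets that are Borel off a Borel null set form a sigma-algebra. *)
Lemma measurable_outside_null (A : set (g_sigma_algebraType (completed_algebra_gen mu))) :
  measurable A ->
  exists N : set T, [/\ measurable N, mu N = 0 & measurable ((A : set T) `&` ~` N)].
Proof.
pose P (A : set T) := exists N : set T,
  [/\ measurable N, mu N = 0 & measurable (A `&` ~` N)].
suff : <<s completed_algebra_gen mu >> `<=` P by apply.
apply: smallest_sub => [|_ [B mB] [M [N [mN N0 MN]]] <-].
  split.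
  - by exists set0; rewrite measure0 set0I; split.
  - move=> B [N [mN N0 mB]]; exists N; split => //.
    have -> : (setT `\` B) `&` ~` N = ~` N `\` (B `&` ~` N).
      rewrite setTD; apply/seteqP; split => x /=; tauto.
    by apply: measurableD => //; exact: measurableC.
  - move=> B /choice[N hN].
    have mN : measurable (\bigcup_k N k).
      by apply: bigcup_measurable => k _; have [] := hN k.
    exists (\bigcup_k N k); split => //.
      apply: measure_negligible => //; apply: negligible_bigcup => k.
      by have [] := hN k; exists (N k); split.
    have -> : (\bigcup_k B k) `&` ~` (\bigcup_k N k) =
        (\bigcup_k (B k `&` ~` N k)) `&` ~` (\bigcup_k N k).
      apply/seteqP; split => x [[k _ Bx] Nx]; split => //; exists k => //.
      - by split => // Nk; apply: Nx; exists k.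
      - by case: Bx.
    apply: measurableI; last exact: measurableC.
    by apply: bigcup_measurable => k _; have [] := hN k.
exists N; split => //.
have -> : (B `|` M) `&` ~` N = B `&` ~` N.
  by apply/seteqP; split => x /= [BM Nx]; split => //; [case: BM => // /MN|left].
by apply: measurableI => //; exact: measurableC.
Qed.

(** A Lebesgue measurable function is determined by countably many level sets,
    so that the exceptional null sets of the latter can be gathered in one. *)
Lemma lmeasurable_outside_null (f : T -> \bar R) : lmeasurable_fun mu setT f ->
  exists N : set T,
  [/\ measurable N, mu N = 0 & measurable_fun setT (f \_ (~` N))].
Proof.
move=> mf; pose q (k : nat) : R := ratr (odflt 0%R (unpickle k)).
pose A k : set T := [set x | (q k)%:E < f x].
have : forall k, exists N : set T,
    [/\ measurable N, mu N = 0 & measurable (A k `&` ~` N)].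
  move=> k; apply: measurable_outside_null.
  have -> : A k = setT `&` f @^-1` `](q k)%:E, +oo[.
    by rewrite setTI; apply/seteqP; split => x /=; rewrite in_itv/= andbT.
  by apply: mf => //; exact: emeasurable_itv.
move=> /choice[N hN].
have mN : measurable (\bigcup_k N k).
  by apply: bigcup_measurable => k _; have [] := hN k.
exists (\bigcup_k N k); split => //.
  apply: measure_negligible => //; apply: negligible_bigcup => k.
  by have [] := hN k; exists (N k); split.
set M := \bigcup_k N k in mN *.
apply: (measurability _ (ErealGenOInfty.measurableE R)).
move=> _ [_ [c ->] <-]; rewrite setTI.
have -> : (f \_ (~` M)) @^-1` `]c%:E, +oo[ =
    (\bigcup_(k in [set k | (c <= q k)%R]) ((A k `&` ~` N k) `&` ~` M)) `|`
    (if (c < 0)%R then M else set0).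
  apply/seteqP; split => x /=; rewrite in_itv/= andbT /patch.
    case: ifPn => [|xM]; last first.
      by rewrite lte_fin => ->; right; apply: contrapT => h; rewrite notin_setE/= in xM.
    rewrite inE/= => xM cf; left.
    have [y cy yf] : exists2 y : R, (c < y)%R & y%:E <= f x.
      case: (f x) cf => [z|_|//]; first by rewrite lte_fin => cz; exists z.
      by exists (c + 1)%R; [rewrite ltrDl|exact: leey].
    have [s] := rat_in_itvoo cy; rewrite in_itv/= => /andP[cs sy].
    have qs : q (pickle s) = ratr s by rewrite /q pickleK.
    exists (pickle s); first by rewrite /= qs ltW.
    split => //; split; first by rewrite /A/= qs (lt_le_trans _ yf)// lte_fin.
    by move=> Nx; apply: xM; exists (pickle s).
  move=> [[k /= ck [[Ax Nx] Mx]]|].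
    rewrite ifT; last by rewrite inE.
    by apply: le_lt_trans Ax; rewrite lee_fin.
  case: ifPn => // c0 Mx; rewrite ifF ?lte_fin//.
  by apply/negbTE; rewrite notin_setE/=; apply.
apply: measurableU; last by case: ifP.
apply: bigcup_measurable => k _; apply: measurableI; last exact: measurableC.
by have [] := hN k.
Qed.

End lebesgue_measurable.

(** * Passage to the Morrey norm *)

Section morrey.
Set Implicit Arguments.
Unset Strict Implicit.
Context {R : realType} (n : nat).
Implicit Types (f : Rn R n -> \bar R).

Lemma le_HL_max f g x : (forall c r, eball c r x ->
    \int[@lebRn R n]_(y in eball c r) `|f y| <=
    \int[@lebRn R n]_(y in eball c r) `|g y|) ->
  HL_max f x <= HL_max g x.
Proof.
move=> fg; apply: ge_ereal_sup => _ [[b rho] /= bx <-].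
apply: le_trans (ereal_sup_ubound _); last by exists (b, rho).
by apply: lee_wpmul2l; [rewrite inve_ge0|exact: fg].
Qed.

(** The simple functions below [|f|] may be set to [0] on [N]. *)
Lemma HL_max_outside_null f (N : set (Rn R n)) x : measurable N ->
  @lebRn R n N = 0 ->
  HL_max f x <= HL_max (abse \o (f \_ (~` N))) x.
Proof.
move=> mN N0; apply: le_HL_max => c r _.
rewrite [leLHS]integral_mkcond [leRHS]integral_mkcond.
apply: (le_trans (integral_outside_null _ mN N0)) => [y|].
  by rewrite /patch; case: ifP.
apply: le_integral_ge0 => y; rewrite /patch/=.
  by case: ifP => //; case: ifP.
by case: ifP => yN; case: ifP => yb; rewrite ?abse_id ?abse_ge0.
Qed.

Variables (p : n.-tuple (\bar R)) (theta : \bar R) (v : R) (w : R -> R).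
Hypotheses (hp : good_exponents p) (htheta : 1 < theta) (v1 : (1 < v)%R).
Hypothesis w0 : forall r, (0 < r)%R -> (0 <= w r)%R.
Local Notation LM := (local_morrey_norm p theta w).

Let theta0 : 0 < theta. Proof. exact: lt_trans htheta. Qed.

Let v0 : (0 < v)%R. Proof. exact: lt_trans v1. Qed.

Lemma le_Lnorm_on (g h : R -> \bar R) : (forall r, (0 < r)%R -> `|g r| <= `|h r|) ->
  Lnorm_on theta `]0%R, +oo[ g <= Lnorm_on theta `]0%R, +oo[ h.
Proof.
move=> gh; apply: le_Lnorm => // r; rewrite /patch; case: ifPn => //.
by rewrite inE/= in_itv/= andbT => /gh.
Qed.

Lemma Lnorm_onZ_le (k : R) (g : R -> \bar R) : (0 < k)%R ->
  Lnorm_on theta `]0%R, +oo[ (fun r => k%:E * g r) <=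
  k%:E * Lnorm_on theta `]0%R, +oo[ g.
Proof.
move=> k0; apply: le_trans (LnormZ_le _ _ _ k0) => //.
apply: le_Lnorm => // r; rewrite /patch; case: ifPn => // _.
by rewrite abse0 abse_ge0.
Qed.

Lemma le_local_morrey_norm f g : (forall x, `|f x| <= `|g x|) -> LM f <= LM g.
Proof.
move=> fg; apply: le_Lnorm_on => r r0; rewrite !abseM.
apply: lee_wpmul2l; first exact: abse_ge0.
rewrite !gee0_abs ?mixed_norm_ge0//; apply: mixed_norm_le => // x.
by rewrite /patch; case: ifP.
Qed.

Hypothesis n0 : (0 < n)%N.
Hypothesis hH : Hstar_bounded theta
  (fun r => (r `^ (sum_inv p + 1) * w r)%R) (fun r => (r `^ sum_inv p * w r)%R).

(** The weights of [H^*] absorb the powers of [r]: with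
    [g(t) = t^(- S - 1) ||F||_(L_p(B_t))], the weighted [g] on the right-hand side
    is [w] times the norm of [F] over [B_r]. *)
Lemma vector_morrey_bound : exists2 C : R, (0 < C)%R &
  forall f : nat -> Rn R n -> \bar R,
  (forall j, lmeasurable_fun (@lebRn R n) setT (f j)) ->
  LM (lv_norm v (fun j => HL_max (f j))) <= C%:E * LM (lv_norm v f).
Proof.
have [C1 C10 HC1] := local_maximal_estimate n0 hp v1.
have [C2 C20 HC2] := hH.
exists (C1 * C2)%R; first exact: mulr_gt0.
move=> f mf; have /choice[N hN] := fun j => lmeasurable_outside_null (mf j).
pose f' j := abse \o (f j \_ (~` N j)).
have f'0 j x : 0 <= f' j x by exact: abse_ge0.
have mf' j : measurable_fun setT (f' j).
  by apply: measurableT_comp => //; have [] := hN j.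
have f'f j x : f' j x <= `|f j x|.
  by rewrite /f'/= /patch; case: ifP => // _; rewrite abse0 abse_ge0.
pose F x := lv v (f' ^~ x).
have F0 x : 0 <= F x by exact: lv_ge0.
pose g := hardy_density p F.
have mg : lmeasurable_fun lebesgue_measure `]0%R, +oo[ g.
  by apply: lmeasurable_fun_borel => //; exact: measurable_hardy_density.
have g0 r : (0 < r)%R -> 0 <= g r by move=> _; exact: hardy_density_ge0.
apply: (@le_trans _ _ (Lnorm_on theta `]0%R, +oo[
    (fun r => C1%:E * ((r `^ sum_inv p * w r)%:E * Hstar g r)))).
  apply: le_Lnorm_on => r r0.
  have H0 : 0 <= Hstar g r by apply: integral_ge0 => t _; exact: hardy_density_ge0.
  rewrite !gee0_abs; last 2 first.
  - rewrite mule_ge0 ?lee_fin ?(ltW C10)// mule_ge0//.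
    by rewrite lee_fin mulr_ge0 ?powR_ge0 ?w0.
  - by rewrite mule_ge0 ?mixed_norm_ge0// lee_fin w0.
  have -> : C1%:E * ((r `^ sum_inv p * w r)%:E * Hstar g r) =
      (w r)%:E * ((C1 * r `^ sum_inv p)%:E * Hstar g r).
    by rewrite !muleA -!EFinM mulrA (mulrC (w r)).
  apply: lee_wpmul2l; first by rewrite lee_fin w0.
  apply: le_trans (HC1 f' mf' f'0 r r0).
  apply: mixed_norm_le => // x; rewrite /patch; case: ifP => // _.
  rewrite !gee0_abs ?lv_ge0//; apply: lv_le => // j; rewrite gee0_abs ?HL_max_ge0//.
  by have [mN N0 _] := hN j; exact: HL_max_outside_null.
apply: (le_trans (Lnorm_onZ_le _ C10)).
rewrite EFinM -muleA; apply: lee_wpmul2l; first by rewrite lee_fin ltW.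
apply: (le_trans (HC2 g mg g0)); apply: lee_wpmul2l; first by rewrite lee_fin ltW.
apply: le_Lnorm_on => r r0; have nr0 : (0 <= r)%R by exact: ltW.
have -> : (r `^ (sum_inv p + 1) * w r)%:E * g r = (w r)%:E * ball_norm p F r.
  rewrite /g /hardy_density muleA -EFinM; congr (_%:E * _).
  have -> : (- sum_inv p - 1 = - (sum_inv p + 1))%R by rewrite opprD.
  by rewrite powRN mulrAC mulfV ?mul1r// gt_eqF// powR_gt0.
rewrite !abseM; apply: lee_wpmul2l; first exact: abse_ge0.
rewrite !gee0_abs ?mixed_norm_ge0//; apply: mixed_norm_le => // x.
rewrite /patch; case: ifP => // _; rewrite !gee0_abs ?lv_ge0//.
exact: lv_le.
Qed.

Lemma lv_norm_single (f : nat -> Rn R n -> \bar R) x :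
  (forall j, f j.+1 x = 0) -> lv_norm v f x = `|f 0%N x|.
Proof.
move=> fz; rewrite /lv_norm (nneseries_split 0 1); last first.
  by move=> k _; exact: poweR_ge0.
rewrite big_nat1 add0n eseries0 ?adde0; last first.
  by move=> [//|k] _ _; rewrite fz abse0 poweR0r// gt_eqF.
by rewrite poweR_KV// gt_eqF.
Qed.

Lemma HL_max0 x : HL_max (cst 0 : Rn R n -> \bar R) x = 0.
Proof.
apply/eqP; rewrite eq_le HL_max_ge0 andbT.
apply: ge_ereal_sup => _ [[b rho] /= bx <-].
by rewrite integral0_eq ?mule0// => y _; exact: abse0.
Qed.

End morrey.


Theorem theorem3p1 (R : realType) (n : nat) (hn : (0 < n)%N)
    (p : n.-tuple (\bar R)) (hp : forall i : 'I_n, 1 < tnth p i < +oo)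
    (theta : \bar R) (htheta : 1 < theta) (v : R) (hv : (1 < v)%R)
    (w : R -> R) (hw : Omega theta w \/ Omega_mixed p theta w)
    (hH : Hstar_bounded theta
            (fun r => (r `^ (sum_inv p + 1) * w r)%R)
            (fun r => (r `^ sum_inv p * w r)%R)) :
  exists2 C : R, (0 < C)%R &
    (forall f : Rn R n -> \bar R, lmeasurable_fun (@lebRn R n) setT f ->
       local_morrey_norm p theta w (HL_max f) <=
       C%:E * local_morrey_norm p theta w f) /\
    (forall f : nat -> Rn R n -> \bar R,
       (forall j, lmeasurable_fun (@lebRn R n) setT (f j)) ->
       local_morrey_norm p theta w (lv_norm v (fun j => HL_max (f j))) <=
       C%:E * local_morrey_norm p theta w (lv_norm v f) /\
       local_morrey_norm p theta w (HL_max (sup_abs f)) <=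
       C%:E * local_morrey_norm p theta w (sup_abs f)).
Proof.
have w0 : forall r, (0 < r)%R -> (0 <= w r)%R by case: hw => -[[]].
have [C C0 HC] := vector_morrey_bound hp htheta hv w0 hn hH.
have scalar f : lmeasurable_fun (@lebRn R n) setT f ->
    local_morrey_norm p theta w (HL_max f) <=
    C%:E * local_morrey_norm p theta w f.
  (* the sequence (f, 0, 0, ...) *)
  move=> mf; pose u j : Rn R n -> \bar R := if j is 0 then f else cst 0.
  have v0 : (0 < v)%R by exact: lt_trans hv.
  have mu j : lmeasurable_fun (@lebRn R n) setT (u j).
    by case: j => [//|j]; exact: measurable_cst.
  apply: (@le_trans _ _ (local_morrey_norm p theta w
      (lv_norm v (fun j => HL_max (u j))))).
    apply: le_local_morrey_norm => // x.
    by rewrite lv_norm_single ?abse_id// => j; exact: HL_max0.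
  apply: (le_trans (HC u mu)); apply: lee_wpmul2l; first by rewrite lee_fin ltW.
  apply: le_local_morrey_norm => // x.
  by rewrite lv_norm_single ?abse_id.
exists C => //; split => // f mf; split; first exact: HC.
apply: scalar.
have -> : sup_abs f = fun x => esups (fun j => `|f j x|) 0%N.
  apply/funext => x; rewrite /sup_abs /esups /sdrop; congr ereal_sup.
  by apply/seteqP; split => _ [j _ <-]; exists j.
apply: measurable_fun_esups => j.
by apply: measurableT_comp => //; exact: mf.
Qed.
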